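(* Let $\overline{X}=(X_0,X_1)$ be a compatible pair of complex Banach spaces, $\Sigma=X_0+X_1$, and let $\theta\in(0,1)$. Then the image of the evaluation map $$H_{\infty}(\overline{X})\to\Sigma,\qquad f\mapsto f(\theta),$$ is the second Calderón space $\overline{X}^{\theta}$.
   Context: A compatible pair $\overline{X}=(X_0,X_1)$ consists of two complex Banach spaces continuously embedded in a common Hausdorff topological vector space. $\Sigma=X_0+X_1$ is a Banach space with norm $\|a\|_\Sigma=\inf\{\|a_0\|_{X_0}+\|a_1\|_{X_1}: a=a_0+a_1,\ a_k\in X_k\}$. Let $S=\{z\in\mathbb{C}:0\le \operatorname{Re} z\le 1\}$ and $S^i=\{0<\operatorname{Re} z<1\}$, $z=x+iy$; regard $(0,1)\subset S^i$. $H^\infty(\Sigma)$ is the space of bounded holomorphic functions $f:S^i\to\Sigma$. Every $f\in H^\infty(\Sigma)$ has distributional boundary values $f(i\cdot)$ and $f(1+i\cdot)$: the $\Sigma$-valued distributions on $\mathbb{R}$ (continuous linear maps $C_c^\infty(\mathbb{R})\to\Sigma$) given by $\varphi\mapsto\lim_{\varepsilon\to0^+}\int f(\varepsilon+iy)\varphi(y)\,dy$ and $\varphi\mapsto\lim_{\varepsilon\to0^+}\int f(1-\varepsilon+iy)\varphi(y)\,dy$, respectively. For a Banach space $X$, $\hom(L^1,X)$ is the space of continuous linear maps $L^1(\mathbb{R})\to X$ (Lebesgue measure). A $\Sigma$-valued distribution $h$ on $\mathbb{R}$ belongs to $\hom(L^1,X_k)$ if there is a continuous linear map $T:L^1(\mathbb{R})\to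 X_k$ with $h(\varphi)=T\varphi$ for all $\varphi\in C_c^\infty(\mathbb{R})$. $H_\infty(\overline{X})$ is the space of all $f\in H^\infty(\Sigma)$ such that $f(k+i\cdot)\in\hom(L^1,X_k)$ for $k=0,1$. $B(\overline{X})$ is the space of functions $g:S\to\Sigma$ that are continuous on $S$, holomorphic in $S^i$, satisfy $\|g(z)\|_\Sigma=O(|y|)$ as $|y|\to\infty$ (uniformly in $x$), and are such that for $k=0,1$ the differences $g(k+iy+it)-g(k+iy)$ belong to $X_k$ for all real $y,t$, with $$\|g(k+iy+it)-g(k+iy)\|_{X_k}\le c|t|$$ for some constant $c$ independent of $y,t$. The second Calderón space is $\overline{X}^\theta=\{g'(\theta): g\in B(\overline{X})\}\subseteq\Sigma$. *)

(* Defs.v *)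
From HB Require Import structures.
From mathcomp Require Import all_boot all_order all_algebra complex.
From mathcomp Require Import all_classical all_reals all_analysis.
From mathcomp Require Import ring lra.
Set Implicit Arguments.
Unset Strict Implicit.
Unset Printing Implicit Defensive.
Import Order.TTheory GRing.Theory Num.Theory.
Import numFieldNormedType.Exports.
Local Open Scope classical_set_scope.
Local Open Scope ring_scope.
Local Open Scope complex_scope.

(* The ambient space is not required to be locally convex. *)
Record compatiblePair (R : realType) := CompatiblePair {
  space0 : completeNormedModType R[i];
  space1 : completeNormedModType R[i];
  ambient : topologicalLmodType R[i];
  ambient_hausdorff : hausdorff_space ambient;
  emb0 : {linear space0 -> ambient};
  emb1 : {linear space1 -> ambient};
  emb0_inj : injective emb0;
  emb1_inj : injective emb1;
  emb0_continuous : continuous emb0;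
  emb1_continuous : continuous emb1 }.

Section SumSpace.
Variables (R : realType) (X : compatiblePair R).

Definition sum_pred : {pred ambient X} := fun e =>
  `[< exists a0 a1, e = emb0 X a0 + emb1 X a1 >].

Lemma sum_predP (e : ambient X) :
  reflect (exists a0 a1, e = emb0 X a0 + emb1 X a1) (e \in sum_pred).
Proof. exact: asboolP. Qed.

Lemma sum_pred_closed : submod_closed sum_pred.
Proof.
split; first by apply/sum_predP; exists 0, 0; rewrite !linear0 addr0.
move=> c u v /sum_predP[a0 [a1 ->]] /sum_predP[b0 [b1 ->]].
apply/sum_predP; exists (c *: a0 + b0), (c *: a1 + b1).
by rewrite !linearP scalerDr addrACA.
Qed.

HB.instance Definition _ :=
  GRing.isSubmodClosed.Build R[i] (ambient X) sum_pred sum_pred_closed.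

(* The sum carries no topology induced from the ambient space, only the one
   of the norm defined below. *)
Record sumSpace := SumSpace {
  sum_val :> ambient X;
  sum_valP : sum_val \in sum_pred }.

HB.instance Definition _ := [isSub for sum_val].
HB.instance Definition _ := [Choice of sumSpace by <:].
HB.instance Definition _ := [SubChoice_isSubLmodule of sumSpace by <:].

Lemma incl0_subproof (a : space0 X) : emb0 X a \in sum_pred.
Proof. by apply/sum_predP; exists a, 0; rewrite linear0 addr0. Qed.
Lemma incl1_subproof (a : space1 X) : emb1 X a \in sum_pred.
Proof. by apply/sum_predP; exists 0, a; rewrite linear0 add0r. Qed.
Definition incl0 (a : space0 X) : sumSpace := SumSpace (incl0_subproof a).
Definition incl1 (a : space1 X) : sumSpace := SumSpace (incl1_subproof a).

Definition sum_norms (a : sumSpace) : set R :=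
  [set r | exists a0 a1, a = incl0 a0 + incl1 a1 /\ `|a0| + `|a1| = r%:C].
Definition sum_norm (a : sumSpace) : R := inf (sum_norms a).


Lemma incl0_is_linear : linear incl0.
Proof. by move=> c u v; apply: val_inj; rewrite /= linearP. Qed.
HB.instance Definition _ :=
  GRing.isLinear.Build R[i] (space0 X) sumSpace *:%R incl0 incl0_is_linear.
Lemma incl1_is_linear : linear incl1.
Proof. by move=> c u v; apply: val_inj; rewrite /= linearP. Qed.
HB.instance Definition _ :=
  GRing.isLinear.Build R[i] (space1 X) sumSpace *:%R incl1 incl1_is_linear.

Lemma normReE (V : normedModType R[i]) (v : V) : `|v| = (complex.Re `|v|)%:C.
Proof.
by have /ger0_Im := normr_ge0 v; case: `|v| => a b /= ->.
Qed.

Lemma sum_norms_lbound a : has_lbound (sum_norms a).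
Proof.
exists 0 => r [a0 [a1 [_ h]]]; rewrite -ler0c -h.
by rewrite addr_ge0.
Qed.

Lemma sum_decomp a : exists a0 a1, a = incl0 a0 + incl1 a1.
Proof.
case: a => e eP; move/sum_predP: (eP) => [a0 [a1 h]].
by exists a0, a1; apply: val_inj.
Qed.

Lemma sum_norms_has_inf a : has_inf (sum_norms a).
Proof.
split; last exact: sum_norms_lbound.
have [a0 [a1 h]] := sum_decomp a.
exists (complex.Re `|a0| + complex.Re `|a1|), a0, a1; split => //.
by rewrite rmorphD /= -!normReE.
Qed.

Lemma sum_norm_le a0 a1 :
  (sum_norm (incl0 a0 + incl1 a1))%:C <= `|a0| + `|a1|.
Proof.
rewrite (normReE a0) (normReE a1) -rmorphD /= lecR.
apply: ge_inf; first exact: sum_norms_lbound.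
by exists a0, a1; split => //; rewrite rmorphD /= -!normReE.
Qed.

Lemma sum_norm_ex a (r : R) : sum_norm a < r ->
  exists a0 a1, a = incl0 a0 + incl1 a1 /\ `|a0| + `|a1| < r%:C.
Proof.
rewrite -subr_gt0 => r0.
have [s [a0 [a1 [h1 h2]]]] := inf_adherent r0 (sum_norms_has_inf a).
rewrite addrC subrK => sr.
by exists a0, a1; split => //; rewrite h2 ltcR.
Qed.

Lemma sum_norm_normD a b :
  (sum_norm (a + b))%:C <= (sum_norm a)%:C + (sum_norm b)%:C.
Proof.
rewrite -rmorphD lecR; apply/ler_addgt0Pr => e e0.
have e2 : 0 < e / 2 by rewrite divr_gt0.
have [|a0 [a1 [ea ha]]] := @sum_norm_ex a (sum_norm a + e / 2).
  by rewrite ltrDl.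
have [|b0 [b1 [eb hb]]] := @sum_norm_ex b (sum_norm b + e / 2).
  by rewrite ltrDl.
have -> : sum_norm a + sum_norm b + e =
  (sum_norm a + e / 2) + (sum_norm b + e / 2) by rewrite addrACA -splitr.
rewrite [X in sum_norm X](_ : _ = incl0 (a0 + b0) + incl1 (a1 + b1)); last first.
  by rewrite ea eb addrACA -!linearD.
rewrite -lecR (le_trans (sum_norm_le _ _))//.
have /ltW := ltrD ha hb; rewrite -rmorphD; apply: le_trans.
by rewrite addrACA lerD// ler_normD.
Qed.

Lemma sum_norm_ge0 a : 0 <= sum_norm a.
Proof.
apply: lb_le_inf; first by case: (sum_norms_has_inf a).
by move=> r [a0 [a1 [_ h]]]; rewrite -ler0c -h addr_ge0.
Qed.

Lemma sum_norm_scale_le (l : R[i]) a :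
  (sum_norm (l *: a))%:C <= `|l| * (sum_norm a)%:C.
Proof.
have -> : `|l| = (complex.Re `|l|)%:C by have := normReE (l : R[i]^o).
set c := complex.Re _.
have c0 : 0 <= c by rewrite -ler0c /c -(normReE (l : R[i]^o)).
rewrite -rmorphM lecR; apply/ler_addgt0Pr => e e0.
have c1 : 0 < c + 1 by rewrite ltr_wpDl.
have [|a0 [a1 [ea ha]]] := @sum_norm_ex a (sum_norm a + e / (c + 1)).
  by rewrite ltrDl divr_gt0.
rewrite [X in sum_norm X](_ : _ = incl0 (l *: a0) + incl1 (l *: a1)); last first.
  by rewrite ea scalerDr -!linearZ.
rewrite -lecR (le_trans (sum_norm_le _ _))//.
rewrite !normrZ -mulrDr (normReE (l : R[i]^o)) -/c.
apply: (@le_trans _ _ (c%:C * (sum_norm a + e / (c + 1))%:C)).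
  by rewrite ler_wpM2l ?ler0c// ltW.
rewrite -rmorphM lecR mulrDr lerD2l mulrCA ger_pMr//.
by rewrite ler_pdivrMr// mul1r lerDl.
Qed.

Lemma sum_norm_normZ (l : R[i]) a :
  (sum_norm (l *: a))%:C = `|l| * (sum_norm a)%:C.
Proof.
apply/eqP; rewrite eq_le sum_norm_scale_le/=.
have [->|l0] := eqVneq l 0.
  by rewrite normr0 mul0r ler0c sum_norm_ge0.
rewrite -ler_pdivlMl ?normr_gt0// -normfV.
by rewrite -[X in sum_norm X](scalerK l0) sum_norm_scale_le.
Qed.

Lemma sum_norm_eq0 a : (sum_norm a)%:C = 0 -> a = 0.
Proof.
move=> /complexI h; apply: val_inj => /=.
apply: (ambient_hausdorff ) => A B Aa B0.
have [U [V [U0 V0 UVB]]] : exists U V, [/\ nbhs (0 : space0 X) U,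
    nbhs (0 : space1 X) V & forall x y, U x -> V y -> B (emb0 X x + emb1 X y)].
  have := @add_continuous (ambient X) (0, 0).
  rewrite /continuous_at /= addr0 => /(_ B B0) [[P Q]] /= [P0 Q0] PQB.
  exists (emb0 X @^-1` P), (emb1 X @^-1` Q); split.
  - by apply: (@emb0_continuous _ X 0); rewrite linear0.
  - by apply: (@emb1_continuous _ X 0); rewrite linear0.
  - by move=> x y Px Qy; apply: (PQB (_, _)).
move/nbhs_ballP : U0 => [e /= e0 eU]; move/nbhs_ballP : V0 => [d /= d0 dV].
exists (sum_val a); split; first exact: nbhs_singleton.
pose m := Num.min (complex.Re e) (complex.Re d).
have eE : e = (complex.Re e)%:C by have/ltW/ger0_Im := e0; case: (e) => ? ? /= ->.
have dE : d = (complex.Re d)%:C by have/ltW/ger0_Im := d0; case: (d) => ? ? /= ->.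
have m0 : sum_norm a < m.
  by rewrite h lt_min -!ltcR -eE -dE e0 d0.
have [a0 [a1 [-> /= am]]] := sum_norm_ex m0.
apply: UVB; [apply: eU|apply: dV].
- rewrite -ball_normE /= sub0r normrN eE.
  apply: le_lt_trans (lt_le_trans am _); first by rewrite lerDl.
  by rewrite lecR ge_min lexx.
- rewrite -ball_normE /= sub0r normrN dE.
  apply: le_lt_trans (lt_le_trans am _); first by rewrite lerDr.
  by rewrite lecR ge_min lexx orbT.
Qed.

HB.instance Definition _ := Lmodule_isNormed.Build R[i] sumSpace
  sum_norm_normD sum_norm_normZ sum_norm_eq0.

Lemma sum_normE (a : sumSpace) : `|a| = (sum_norm a)%:C.
Proof. by []. Qed.

Let halves_sum m n : (m <= n)%N ->
  \sum_(m <= k < n) (2^-1 : R) ^+ k = 2 * 2^-1 ^+ m - 2 * 2^-1 ^+ n.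
Proof.
elim: n => [|n IH]; first by rewrite leqn0 => /eqP ->; rewrite big_geq// subrr.
rewrite leq_eqVlt => /predU1P[->|mn]; first by rewrite big_geq// subrr.
rewrite big_nat_recr//= IH// exprS.
by move: (_ ^+ m) (_ ^+ n) => a b; lra.
Qed.

Let cvg_halves (V : completeNormedModType R[i]) (u : nat -> V) :
  (forall n, `|u n| <= (2^-1 ^+ n)%:C) -> cvgn (series u).
Proof.
move=> hu; apply: cauchy_cvg; apply/cauchy_seriesP => e e0.
have eE : e = (complex.Re e)%:C by have/ltW/ger0_Im := e0; case: (e) => ? ? /= ->.
have re0 : 0 < complex.Re e by rewrite -ltcR -eE.
have h0 : (2 * 2^-1 ^+ n : R) @[n --> \oo] --> (0 : R).
  rewrite -[X in _ --> X](mulr0 2); apply: cvgMr.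
  by apply: cvg_expr; rewrite ger0_norm ?invf_lt1 ?ltr1n.
move/cvgrPdist_lt : h0 => /(_ _ re0)[N _ hN].
exists ([set n | N <= n]%N, [set n | N <= n]%N).
  by split; exists N.
move=> [m n] [/= Nm Nn]; have [nm|mn] := leqP n m.
  by rewrite big_geq// normr0.
apply: le_lt_trans (ler_norm_sum _ _ _) _.
apply: (@le_lt_trans _ _ (\sum_(m <= k < n) (2^-1 ^+ k : R))%:C).
  by rewrite rmorph_sum ler_sum.
rewrite eE ltcR halves_sum ?(ltnW mn)//.
apply: le_lt_trans (hN m Nm); rewrite sub0r normrN ger0_norm ?mulr_ge0//.
by rewrite gerBl mulr_ge0.
Qed.

Lemma sumSpace_complete (F : set_system sumSpace) :
  ProperFilter F -> cauchy F -> cvg F.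
Proof.
move=> FF /cauchyP Fc.
have hpos n : 0 < (2^-1 ^+ n.+2 : R)%:C by rewrite ltcR exprn_gt0.
have /choice[x hx] : forall n, exists x, F (ball x ((2^-1 ^+ n.+2 : R)%:C)).
  by move=> n; exact: Fc.
have hd n : `|x n.+1 - x n| < (2^-1 ^+ n)%:C.
  have [y []] := filter_ex (filterI (hx n) (hx n.+1)).
  rewrite -!ball_normE /= => h1 h2.
  rewrite distrC -(subrKA y); apply: le_lt_trans (ler_normD _ _) _.
  rewrite [`|y - _|]distrC; apply: lt_trans (ltrD h1 h2) _.
  rewrite -rmorphD ltcR !exprS.
  have : 0 < (2^-1 ^+ n : R) by rewrite exprn_gt0.
  by move: (2^-1 ^+ n) => t; lra.
have /choice[d hd2] n : exists d : space0 X * space1 X,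
    x n.+1 - x n = incl0 d.1 + incl1 d.2 /\ `|d.1| + `|d.2| < (2^-1 ^+ n)%:C.
  have := hd n; rewrite sum_normE ltcR => /sum_norm_ex[a0 [a1 h]].
  by exists (a0, a1).
pose b0 := series (fst \o d); pose b1 := series (snd \o d).
have xE n : x n = x 0%N + incl0 (b0 n) + incl1 (b1 n).
  elim: n => [|n IH].
    by rewrite /b0 /b1 /series /= !big_geq// !linear0 !addr0.
  rewrite -[LHS](subrK (x n)) (hd2 n).1 {1}IH /b0 /b1 !seriesS /= !linearD.
  by rewrite addrACA [incl0 _ + (_ + _)]addrCA.
have c0 : cvgn b0.
  apply: cvg_halves => n; apply: le_trans (ltW (hd2 n).2).
  by rewrite lerDl.
have c1 : cvgn b1.
  apply: cvg_halves => n; apply: le_trans (ltW (hd2 n).2).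
  by rewrite lerDr.
apply/cvg_ex; exists (x 0%N + incl0 (limn b0) + incl1 (limn b1)).
set l := (X in F --> X).
apply/cvgrPdist_lt => e e0.
have e3 : 0 < e / 3 by rewrite divr_gt0.
have hl n : `|l - x n| <= `|limn b0 - b0 n| + `|limn b1 - b1 n|.
  rewrite /l (xE n).
  rewrite [X in `|X|](_ : _ =
    incl0 (limn b0 - b0 n) + incl1 (limn b1 - b1 n)).
    exact: sum_norm_le.
  rewrite !linearB /= opprD addrACA; congr (_ + _).
  by rewrite opprD addrACA subrr add0r.
have [N _ hN] : \forall n \near \oo, [/\ `|limn b0 - b0 n| < e / 3,
    `|limn b1 - b1 n| < e / 3 & (2^-1 ^+ n.+2 : R)%:C < e / 3].
  have eE : e / 3 = (complex.Re (e / 3))%:C.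
    by have/ltW/ger0_Im := e3; case: (e / 3) => ? ? /= ->.
  have re3 : 0 < complex.Re (e / 3) by rewrite -ltcR -eE.
  have h0 : (2^-1 ^+ n : R) @[n --> \oo] --> (0 : R).
    by apply: cvg_expr; rewrite ger0_norm ?invf_lt1 ?ltr1n.
  move/cvgrPdist_lt : c0 => /(_ _ e3) c0; move/cvgrPdist_lt : c1 => /(_ _ e3) c1.
  move/cvgrPdist_lt : h0 => /(_ _ re3) h0.
  near=> n; split; [by near: n|by near: n|].
  rewrite eE ltcR; apply: le_lt_trans (_ : 2^-1 ^+ n < _).
    by rewrite !exprS; have : 0 <= (2^-1 ^+ n : R) by []; lra.
  have : `|0 - (2^-1 ^+ n : R)| < complex.Re (e / 3) by near: n.
  by rewrite sub0r normrN ger0_norm.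
have [h1 h2 h3] := hN N (leqnn N).
apply: filterS (hx N) => y; rewrite -ball_normE /= => hy.
rewrite -(subrKA (x N)); apply: le_lt_trans (ler_normD _ _) _.
have -> : e = e / 3 + e / 3 + e / 3 by field.
apply: ltrD (lt_trans hy h3).
exact: le_lt_trans (hl N) (ltrD h1 h2).
Unshelve. all: by end_near. Qed.

HB.instance Definition _ :=
  Uniform_isComplete.Build sumSpace sumSpace_complete.

End SumSpace.

Section VectorCalculus.
Variable R : realType.
(* R[i]^o is R[i] as a normed module over itself, so that derivatives along 1
   below are complex derivatives. *)
Local Notation C := (R[i]^o).

Definition closed_strip : set C := [set z | 0 <= complex.Re z <= 1].
Definition open_strip : set C := [set z | 0 < complex.Re z < 1].

Definition holomorphic_on (V : normedModType R[i]) (D : set C) (f : C -> V) :=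
  forall z, D z -> derivable f z 1.

(* tagged partitions a = s 0 <= t 0 <= s 1 <= t 1 <= ... <= s n = b *)
Definition is_riemann_integral (V : normedModType R[i])
    (a b : R) (F : R -> V) (v : V) :=
  forall e : R, 0 < e -> exists2 d : R, 0 < d &
    forall (n : nat) (s t : nat -> R),
      s 0%N = a -> s n = b ->
      (forall i, (i < n)%N -> [/\ s i <= t i, t i <= s i.+1 & s i.+1 - s i < d]) ->
      `|\sum_(i < n) (s i.+1 - s i)%:C *: F (t i) - v| < e%:C.

(* Integral over the whole line of a function with bounded support, 0 by
   default when it is not Riemann integrable.  It is only applied to continuous
   functions with compact support and values in a Banach space. *)
Definition line_integral (V : normedModType R[i]) (F : R -> V) : V :=
  xget 0 [set v | exists a b, [/\ a <= b,
    forall y, ~ (a <= y <= b) -> F y = 0 & is_riemann_integral a b F v]].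

Definition smooth (u : R -> R) := forall n x, derivable (derive1n n u) x 1.

Definition test_function (phi : R -> R[i]) :=
  [/\ smooth (fun y => complex.Re (phi y)),
      smooth (fun y => complex.Im (phi y)) &
      compact (closure [set y | phi y != 0])].

Definition cderive1n (n : nat) (phi : R -> R[i]) (y : R) : R[i] :=
  derive1n n (fun y => complex.Re (phi y)) y +i*
  derive1n n (fun y => complex.Im (phi y)) y.

(* Only the values on test functions matter.  Continuity for the inductive
   limit topology of the test functions is spelled out in seminorms. *)
Definition is_distribution (V : normedModType R[i]) (h : (R -> R[i]) -> V) :=
  (forall (c : R[i]) phi psi, test_function phi -> test_function psi ->
     h (fun y => c * phi y + psi y) = c *: h phi + h psi) /\
  (forall K : set R, compact K -> exists (N : nat) (M : R),
     forall phi, test_function phi -> [set y | phi y != 0] `<=` K ->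
     forall B : R,
       (forall n y, (n <= N)%N -> `|cderive1n n phi y| <= B%:C) ->
       `|h phi| <= (M * B)%:C).

Definition L1_function (u : R -> R[i]) :=
  (@lebesgue_measure R).-integrable setT (fun y => (complex.Re (u y))%:E) /\
  (@lebesgue_measure R).-integrable setT (fun y => (complex.Im (u y))%:E).

Definition L1_norm (u : R -> R[i]) : R :=
  \int[@lebesgue_measure R]_y (complex.Re `|u y|).

(* T is defined on functions rather than on classes of functions: the bound
   forces T u = T v when u = v almost everywhere. *)
Definition L1_continuous_linear (V : normedModType R[i])
    (T : (R -> R[i]) -> V) :=
  (forall (c : R[i]) u v, L1_function u -> L1_function v ->
     T (fun y => c * u y + v y) = c *: T u + T v) /\
  (exists M : R, forall u, L1_function u -> `|T u| <= (M * L1_norm u)%:C).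

End VectorCalculus.

Section CalderonSpaces.
Variables (R : realType) (X : compatiblePair R).
Local Notation C := (R[i]^o).

(* Elements of the function spaces below are total functions, of which only
   the values on the open or closed strip are constrained. *)
Definition Hinfty_sum : set (C -> sumSpace X) :=
  [set f | holomorphic_on (@open_strip R) f /\
           exists M : R, forall z, open_strip z -> `|f z| <= M%:C].

Definition boundary_value0 (f : C -> sumSpace X)
    (h : (R -> R[i]) -> sumSpace X) :=
  is_distribution h /\ forall phi, test_function phi ->
    line_integral (fun y => phi y *: f (e +i* y)) @[e --> 0^'+] --> h phi.

Definition boundary_value1 (f : C -> sumSpace X)
    (h : (R -> R[i]) -> sumSpace X) :=
  is_distribution h /\ forall phi, test_function phi ->
    line_integral (fun y => phi y *: f ((1 - e) +i* y)) @[e --> 0^'+] --> h phi.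

Definition in_hom_L1 (V : normedModType R[i]) (inc : V -> sumSpace X)
    (h : (R -> R[i]) -> sumSpace X) :=
  exists2 T, L1_continuous_linear T &
    forall phi, test_function phi -> h phi = inc (T phi).

Definition Hinfty : set (C -> sumSpace X) :=
  [set f | [/\ Hinfty_sum f,
    exists2 h, boundary_value0 f h & in_hom_L1 (@incl0 R X) h &
    exists2 h, boundary_value1 f h & in_hom_L1 (@incl1 R X) h]].

Definition lipschitz_into (V : normedModType R[i]) (inc : V -> sumSpace X)
    (g : R -> sumSpace X) :=
  exists c : R, forall y t : R, exists2 a : V,
    g (y + t) - g y = inc a & `|a| <= (c * `|t|)%:C.

Definition Bspace : set (C -> sumSpace X) :=
  [set g | [/\ {within @closed_strip R, continuous g},
    holomorphic_on (@open_strip R) g,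
    exists M Y : R, forall z, closed_strip z -> Y <= `|complex.Im z| ->
      `|g z| <= (M * `|complex.Im z|)%:C,
    lipschitz_into (@incl0 R X) (fun y => g (0 +i* y)) &
    lipschitz_into (@incl1 R X) (fun y => g (1 +i* y))]].

Definition calderon2 (theta : R) : set (sumSpace X) :=
  [set derive1 g theta%:C | g in Bspace].

End CalderonSpaces.

Arguments Hinfty_sum {R} X _.
Arguments Hinfty {R} X _.
Arguments Bspace {R} X _.
Arguments calderon2 {R} X theta _.

(* Main.v *)
From HB Require Import structures.
Require Import Defs.
From mathcomp Require Import all_boot all_order all_algebra complex.
From mathcomp Require Import all_classical all_reals all_analysis.
From mathcomp Require Import measurable_realfun.
From mathcomp Require Import ring lra.
Set Implicit Arguments.
Unset Strict Implicit.
Unset Printing Implicit Defensive.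
Import Order.TTheory GRing.Theory Num.Theory.
Import numFieldNormedType.Exports.
Local Open Scope classical_set_scope.
Local Open Scope ring_scope.
Local Open Scope complex_scope.
Local Notation Re := complex.Re.
Local Notation Im := complex.Im.

(** The two inclusions are the two directions of the fundamental theorem of
calculus along the boundary of the strip.

Let [f] be in [Hinfty X].  Since [f] is bounded, a primitive of [f] on the open
strip is Lipschitz and extends to a Lipschitz function [g] on the closed strip.
Let [T] be the operator from L^1 to X_k that represents the boundary value of
[f] on Re z = k.  Smooth bumps that tend in L^1 to the indicator of ]a, b] give
  g(k + i b) - g(k + i a) = i T(1_]a, b]),
an element of X_k of norm at most (b - a) times the norm of [T]
([strip_ext_increment]).  So [g] is in [Bspace X] and its derivative is [f]
([Hinfty_calderon2]).

Let now [g] be in [Bspace X] and [f] its derivative.  For real t the function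
g(z + i t) - g(z) is bounded by c |t| on the boundary and grows at most
linearly, so it is bounded by c |t| on the whole strip ([phragmen_lindelof]),
and division by t shows that [f] is bounded.  On the boundary, the increments of
[g] are those of a Lipschitz function G from the real line to X_k.  Such a G
need not be differentiable at any point, but it has a derivative in the weak
sense: there is a continuous operator on L^1 that maps each 1_]a, b] to
G(b) - G(a) ([lipschitz_operator]).  Up to a factor -i it is the boundary value
of [f], because the integrals of [f] over vertical segments are, up to that
factor, increments of [g], and test functions are uniform limits of step
functions ([boundary_value_exists], [Bspace_derivative]).

The analysis of Banach-valued holomorphic functions that this requires is
derived from one notion, the derivative of a function relative to a subset of
the plane ([deriv_in]).  Goursat's theorem yields primitives
([segint_primitive]); Cauchy's formula over a square, for functions that already
have a holomorphic derivative ([cauchy_formula]), shows that derivatives of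
holomorphic functions are holomorphic ([holo_derivative]); second order Taylor
expansions then give the maximum principle ([max_principle]). *)

(** * Identities between linear combinations *)

Section LinearExpressions.
Variables (K : nzRingType) (V : lmodType K).

(** Syntax trees of linear combinations, for the reflexive tactic [module] below;
a variable is an index in a list of atoms. *)
Inductive lexpr :=
  LVar of nat | LZero | LAdd of lexpr & lexpr | LOpp of lexpr | LScale of K & lexpr.

Fixpoint leval (s : seq V) (e : lexpr) : V :=
  match e with
  | LVar n => nth 0 s n
  | LZero => 0
  | LAdd a b => leval s a + leval s b
  | LOpp a => - leval s a
  | LScale c a => c *: leval s a
  end.

Fixpoint lcoef (e : lexpr) (i : nat) : K :=
  match e with
  | LVar n => if Nat.eqb n i then 1 else 0
  | LZero => 0
  | LAdd a b => lcoef a i + lcoef b i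
  | LOpp a => - lcoef a i
  | LScale c a => c * lcoef a i
  end.

Lemma leval_coef s e : leval s e = \sum_(i < size s) lcoef e i *: nth 0 s i.
Proof.
elim: e => [n||a IHa b IHb|a IHa|c a IHa] /=.
- have nE (i : nat) : (if Nat.eqb n i then 1 else 0 : K) = (i == n)%:R.
    by rewrite eq_sym -[n == i]/(Nat.eqb n i); case: (Nat.eqb n i).
  rewrite (eq_bigr (fun i : 'I_(size s) => (i == n :> nat)%:R *: nth 0 s i)); last first.
    by move=> i _; rewrite nE.
  have [ns|sn] := ltnP n (size s).
    rewrite (bigD1 (Ordinal ns))//= eqxx scale1r big1 ?addr0// => i /eqP ni.
    by case: eqP => [h|]; [case: ni; apply: val_inj|rewrite scale0r].
  rewrite nth_default// big1// => i _; case: eqP => [h|]; last by rewrite scale0r.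
  by move: (ltn_ord i); rewrite h ltnNge sn.
- by rewrite big1// => i _; rewrite scale0r.
- by rewrite IHa IHb -big_split; apply: eq_bigr => i _; rewrite scalerDl.
- by rewrite IHa -sumrN; apply: eq_bigr => i _; rewrite scaleNr.
- by rewrite IHa scaler_sumr; apply: eq_bigr => i _; rewrite scalerA.
Qed.

Fixpoint lsame (n : nat) (a b : lexpr) : Prop :=
  if n is m.+1 then lcoef a m = lcoef b m /\ lsame m a b else True.

Lemma leval_eq s a b : lsame (size s) a b -> leval s a = leval s b.
Proof.
move=> h; rewrite !leval_coef; apply: eq_bigr => i _; congr (_ *: _).
have := ltn_ord i; move: (nat_of_ord i) => {}i.
elim: (size s) h => //= n IH [h1 h2]; rewrite ltnS leq_eqVlt => /predU1P[->//|].
exact: IH.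
Qed.
End LinearExpressions.

(** [module] reduces an identity between linear combinations of vectors to the
equality of the scalar coefficients of each atom, to be solved by [ring] or
[field].  The scalars are read off the goal; [module_over K] is for goals that
contain no scaling. *)
Ltac l_mem x s := lazymatch s with
  | context [cons x _] => constr:(true) | _ => constr:(false) end.
Ltac l_atoms t s := lazymatch t with
  | GRing.add ?a ?b => let s1 := l_atoms a s in l_atoms b s1
  | GRing.opp ?a => l_atoms a s
  | GRing.scale _ ?a => l_atoms a s
  | GRing.zero => s
  | _ => let b := l_mem t s in
    lazymatch b with true => s | false => constr:(cons t s) end
  end.
Ltac l_index x s := lazymatch s with
  | cons x _ => constr:(O)
  | cons _ ?s' => let n := l_index x s' in constr:(S n)
  end.
Ltac l_reify K t s := lazymatch t with
  | GRing.add ?a ?b => let a' := l_reify K a s in let b' := l_reify K b s in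
      constr:(@LAdd K a' b')
  | GRing.opp ?a => let a' := l_reify K a s in constr:(@LOpp K a')
  | GRing.scale ?c ?a => let a' := l_reify K a s in constr:(@LScale K c a')
  | GRing.zero => constr:(@LZero K)
  | _ => let n := l_index t s in constr:(@LVar K n)
  end.
Ltac module_over K := lazymatch goal with |- @eq ?V ?a ?b =>
  let s0 := l_atoms a (@nil V) in let s := l_atoms b s0 in
  let a' := l_reify K a s in let b' := l_reify K b s in
  refine (@leval_eq K _ s a' b' _);
  cbn [lsame lcoef Nat.eqb size]; repeat split end.
Ltac module := lazymatch goal with |- context [@GRing.scale ?K _ _ _] =>
  module_over K end.

(** * Real-valued norms and complete scalars *)

Section RealNorms.
Variable R : realType.

Lemma eqW (x y : R) : x = y -> x <= y. Proof. by move->. Qed.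

(** Norms over R[i] take their values in R[i], which is only partially ordered.
Estimates are carried out in R, with [cmod] on scalars and [rnorm] on vectors. *)
Definition cmod (z : R[i]) : R := Re `|z|.

Lemma cmodE z : `|z| = (cmod z)%:C.
Proof. by have := normReE (z : R[i]^o). Qed.

Lemma ReB (z w : R[i]) : Re (z - w) = Re z - Re w.
Proof. by case: z w => [a b] [c d]. Qed.
Lemma ImB (z w : R[i]) : Im (z - w) = Im z - Im w.
Proof. by case: z w => [a b] [c d]. Qed.
Lemma ReD (z w : R[i]) : Re (z + w) = Re z + Re w.
Proof. by case: z w => [a b] [c d]. Qed.
Lemma ImD (z w : R[i]) : Im (z + w) = Im z + Im w.
Proof. by case: z w => [a b] [c d]. Qed.

Lemma cmod_ge0 z : 0 <= cmod z.
Proof. by rewrite -ler0c -cmodE. Qed.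
Lemma cmodD z w : cmod (z + w) <= cmod z + cmod w.
Proof. by rewrite -lecR rmorphD /= -!cmodE ler_normD. Qed.
Lemma cmodM z w : cmod (z * w) = cmod z * cmod w.
Proof. by apply: complexI; rewrite rmorphM /= -!cmodE normrM. Qed.
Lemma cmodN z : cmod (- z) = cmod z.
Proof. by rewrite /cmod normrN. Qed.
Lemma cmodB z w : cmod (z - w) = cmod (w - z).
Proof. by rewrite -cmodN opprB. Qed.
Lemma cmod0 : cmod 0 = 0.
Proof. by rewrite /cmod normr0. Qed.
Lemma cmod1 : cmod 1 = 1.
Proof. by rewrite /cmod normr1. Qed.
Lemma cmodV z : cmod z^-1 = (cmod z)^-1.
Proof. by apply: complexI; rewrite fmorphV /= -!cmodE normfV. Qed.
Lemma cmod_eq0 z : (cmod z == 0) = (z == 0).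
Proof. by rewrite -(inj_eq (@complexI R)) /= -cmodE normr_eq0. Qed.
Lemma cmod_gt0 z : (0 < cmod z) = (z != 0).
Proof. by rewrite lt0r cmod_ge0 andbT cmod_eq0. Qed.
Lemma cmodR (r : R) : cmod r%:C = `|r|.
Proof. by rewrite /cmod normc_def /= expr0n /= addr0 sqrtr_sqr. Qed.
Lemma cmod_sqr z : cmod z ^+ 2 = (Re z) ^+ 2 + (Im z) ^+ 2.
Proof.
by rewrite /cmod normc_def /= sqr_sqrtr// addr_ge0// sqr_ge0.
Qed.
Lemma le_cmod_Re z : `|Re z| <= cmod z.
Proof.
rewrite -(@ler_pXn2r _ 2)// ?nnegrE ?cmod_ge0// cmod_sqr real_normK ?num_real//.
by rewrite lerDl sqr_ge0.
Qed.
Lemma le_cmod_Im z : `|Im z| <= cmod z.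
Proof.
rewrite -(@ler_pXn2r _ 2)// ?nnegrE ?cmod_ge0// cmod_sqr real_normK ?num_real//.
by rewrite lerDr sqr_ge0.
Qed.
Lemma cmod_half z : cmod (z / 2) = cmod z / 2.
Proof.
rewrite cmodM cmodV; congr (_ / _).
by have -> : 2 = (2 : R)%:C :> R[i]; [rewrite rmorph_nat|rewrite cmodR ger0_norm].
Qed.
Lemma complexRI (z : R[i]) : z = (Re z)%:C + 'i * (Im z)%:C.
Proof. exact: complexE. Qed.
Lemma cmodi : cmod ('i : R[i]) = 1.
Proof. by rewrite /cmod normc_def /= expr0n /= add0r expr1n sqrtr1. Qed.
Lemma cmod_le z : cmod z <= `|Re z| + `|Im z|.
Proof.
rewrite {1}(complexRI z); apply: le_trans (cmodD _ _) _.
by rewrite cmodM !cmodR cmodi mul1r.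
Qed.

Variable V : normedModType R[i].
Definition rnorm (v : V) : R := Re `|v|.
Implicit Types u v w : V.

Lemma rnormE v : `|v| = (rnorm v)%:C. Proof. exact: normReE. Qed.
Lemma rnorm_ge0 v : 0 <= rnorm v.
Proof. by rewrite -ler0c -rnormE. Qed.
Lemma rnormD u v : rnorm (u + v) <= rnorm u + rnorm v.
Proof. by rewrite -lecR rmorphD /= -!rnormE ler_normD. Qed.
Lemma rnormN v : rnorm (- v) = rnorm v.
Proof. by rewrite /rnorm normrN. Qed.
Lemma rnormC u v : rnorm (u - v) = rnorm (v - u).
Proof. by rewrite -rnormN opprB. Qed.
Lemma rnormB u v : rnorm (u - v) <= rnorm u + rnorm v.
Proof. by rewrite -(rnormN v) rnormD. Qed.
Lemma rnorm0 : rnorm (0 : V) = 0.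
Proof. by rewrite /rnorm normr0. Qed.
Lemma rnormZ c v : rnorm (c *: v) = cmod c * rnorm v.
Proof. by apply: complexI; rewrite rmorphM /= -rnormE -cmodE normrZ -rnormE. Qed.
Lemma rnorm_eq0 v : (rnorm v == 0) = (v == 0).
Proof. by rewrite -(inj_eq (@complexI R)) /= -rnormE normr_eq0. Qed.
Lemma rnorm_tri w u v : rnorm (u - v) <= rnorm (u - w) + rnorm (w - v).
Proof. by rewrite -(subrKA w) rnormD. Qed.
Lemma le_rnorm v (M : R) : (`|v| <= M%:C) = (rnorm v <= M).
Proof. by rewrite rnormE lecR. Qed.
Lemma lt_rnorm v (M : R) : (`|v| < M%:C) = (rnorm v < M).
Proof. by rewrite rnormE ltcR. Qed.
Lemma rnorm_small v : (forall e : R, 0 < e -> rnorm v <= e) -> v = 0.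
Proof.
move=> h; apply/eqP; rewrite -rnorm_eq0 eq_le rnorm_ge0 andbT.
by apply/ler_addgt0Pr => e e0; rewrite add0r h.
Qed.
Lemma rnorm_sum (I : Type) (r : seq I) (P : pred I) (F : I -> V) :
  rnorm (\sum_(i <- r | P i) F i) <= \sum_(i <- r | P i) rnorm (F i).
Proof.
elim/big_ind2 : _ => //; first by rewrite rnorm0.
by move=> x1 x2 y1 y2 h1 h2; rewrite (le_trans (rnormD _ _))// lerD.
Qed.

(** Convergence of sequences with real bounds; it agrees with convergence along
filters by [rcvgP]. *)
Definition rcvg (u : nat -> V) (l : V) := forall e : R, 0 < e ->
  exists N, forall n, (N <= n)%N -> rnorm (u n - l) <= e.

Lemma rcvg_uniq (u : nat -> V) l l' : rcvg u l -> rcvg u l' -> l = l'.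
Proof.
move=> h h'; apply/subr0_eq; apply: rnorm_small => e e0.
have e2 : 0 < e / 2 by rewrite divr_gt0.
have [N hN] := h _ e2; have [N' hN'] := h' _ e2.
rewrite (le_trans (rnorm_tri (u (maxn N N')) _ _))// [leRHS]splitr lerD//.
  by rewrite rnormC hN// leq_maxl.
by rewrite hN'// leq_maxr.
Qed.

Lemma rcvg_le (u : nat -> V) l (M : R) : rcvg u l -> (forall n, rnorm (u n) <= M) -> rnorm l <= M.
Proof.
move=> h hM; apply/ler_addgt0Pr => e e0; have [N /(_ N (leqnn N)) hN] := h e e0.
have -> : l = u N - (u N - l) by rewrite opprB addrC subrK.
by rewrite (le_trans (rnormB _ _))// lerD.
Qed.

Lemma rcvgD (u u' : nat -> V) l l' : rcvg u l -> rcvg u' l' -> rcvg (fun n => u n + u' n) (l + l').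
Proof.
move=> h h' e e0.
have e2 : 0 < e / 2 by rewrite divr_gt0.
have [N hN] := h _ e2; have [N' hN'] := h' _ e2.
exists (maxn N N') => n; rewrite geq_max => /andP[n1 n2].
by rewrite opprD addrACA (le_trans (rnormD _ _))// [leRHS]splitr lerD ?hN ?hN'.
Qed.

Lemma rcvgZ c (u : nat -> V) l : rcvg u l -> rcvg (fun n => c *: u n) (c *: l).
Proof.
move=> h e e0.
have c1 : 0 < cmod c + 1 by rewrite ltr_wpDl ?cmod_ge0.
have [|N hN] := h (e / (cmod c + 1)); first by rewrite divr_gt0.
exists N => n /hN; rewrite -scalerBr rnormZ ler_pdivlMr// => h'.
have := rnorm_ge0 (u n - l); lra.
Qed.

Lemma rcvg_shift (u : nat -> V) l : rcvg u l -> rcvg (fun n => u n.+1) l.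
Proof. by move=> h e /h[N hN]; exists N => n Nn; rewrite hN// leqW. Qed.

Lemma rcvg_ext (u u' : nat -> V) l : u =1 u' -> rcvg u l -> rcvg u' l.
Proof. by move=> /funext <-. Qed.

Lemma rcvgP (u : nat -> V) l : rcvg u l <-> u @ \oo --> l.
Proof.
split=> [h|/cvgrPdist_le h].
  apply/cvgrPdist_le => e e0.
  have eE : e = (Re e)%:C by have/ltW/ger0_Im := e0; case: (e) => ? ? /= ->.
  have [|N hN] := h (Re e); first by rewrite -ltcR -eE.
  by exists N => // n /= /hN; rewrite rnormC eE le_rnorm.
move=> e e0; have [|N _ hN] := h e%:C; first by rewrite ltcR.
by exists N => n /hN; rewrite le_rnorm rnormC.
Qed.

End RealNorms.

Section Completeness.
Variable R : realType.

Lemma complex_gt0E (e : R[i]) : 0 < e -> exists2 r : R, 0 < r & e = r%:C.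
Proof.
move=> e0; have eE : e = (Re e)%:C.
  by have/ltW/ger0_Im := e0; case: (e) => ? ? /= ->.
by exists (Re e) => //; rewrite -ltcR -eE.
Qed.

Lemma ball_rnorm (V : normedModType R[i]) (z w : V) (e : R) :
  ball z e%:C w <-> rnorm (z - w) < e.
Proof. by rewrite -ball_normE /= lt_rnorm. Qed.

Lemma complexo_complete (F : set_system (R[i]^o)) :
  ProperFilter F -> cauchy F -> cvg F.
Proof.
move=> FF /cauchyP Fc.
have Rc : cauchy ((@Re R) @ F).
  apply/cauchyP => e e0; have [|z hz] := Fc e%:C; first by rewrite ltcR.
  exists (Re z); change (F (@Re R @^-1` ball (Re z) e)).
  apply: filterS hz => w.
  move=> hw; have {hw} h := (ball_rnorm _ _ _).1 hw; rewrite /= -ball_normE /=; apply: le_lt_trans h; by have := le_cmod_Re ((z : R[i]) - w); rewrite ReB.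
have Ic : cauchy ((@Im R) @ F).
  apply/cauchyP => e e0; have [|z hz] := Fc e%:C; first by rewrite ltcR.
  exists (Im z); change (F (@Im R @^-1` ball (Im z) e)).
  apply: filterS hz => w.
  move=> hw; have {hw} h := (ball_rnorm _ _ _).1 hw; rewrite /= -ball_normE /=; apply: le_lt_trans h; by have := le_cmod_Im ((z : R[i]) - w); rewrite ImB.
have /cvg_ex[x /cvgrPdist_lt hx] : cvg ((@Re R) @ F) by apply: cauchy_cvg.
have /cvg_ex[y /cvgrPdist_lt hy] : cvg ((@Im R) @ F) by apply: cauchy_cvg.
apply/cvg_ex; exists (x +i* y); apply/cvgrPdist_lt => _ /complex_gt0E[e e0 ->].
have e2 : 0 < e / 2 by rewrite divr_gt0.
have hx2 : F [set w : R[i]^o | `|x - Re w| < e / 2] by exact: hx.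
have hy2 : F [set w : R[i]^o | `|y - Im w| < e / 2] by exact: hy.
apply: filterS2 hx2 hy2 => w /= h1 h2.
rewrite lt_rnorm (le_lt_trans (cmod_le (_ : R[i])))// [ltRHS]splitr ltrD//.
  by rewrite ReB.
by rewrite ImB.
Qed.

End Completeness.

(** A copy of R[i]^o with its completeness, so that scalar functions are instances
of functions into a Banach space. *)
Definition cplx (R : realType) : Type := R[i]^o.
HB.instance Definition _ (R : realType) := NormedModule.copy (cplx R) (R[i]^o).
HB.instance Definition _ (R : realType) :=
  Uniform_isComplete.Build (cplx R) (@complexo_complete R).

Lemma rcvg_cauchy (R : realType) (V : completeNormedModType R[i]) (u : nat -> V) :
  (forall e : R, 0 < e -> exists N, forall n, (N <= n)%N -> rnorm (u n - u N) <= e) ->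
  exists l, rcvg u l.
Proof.
move=> h; suff /cvg_ex[l hl] : cvgn u by exists l; apply/rcvgP.
apply/cauchy_cvgP/cauchyP => _ /complex_gt0E[e e0 ->].
have [|N hN] := h (e / 2); first by rewrite divr_gt0.
exists (u N); exists N => // n /= /hN hn.
apply/ball_rnorm; rewrite rnormC (le_lt_trans hn)//.
by rewrite ltr_pdivrMr// ltr_pMr// ltr1n.
Qed.

(** * Bisection and compactness of intervals *)

Section Nested.
Variable R : realType.
Local Notation C := (R[i]^o).

Lemma halving_small (L d : R) : 0 <= L -> 0 < d ->
  exists N, forall n, (N <= n)%N -> L / 2 ^+ n < d.
Proof.
move=> L0 d0.
have h0 : (L * 2^-1 ^+ n : R) @[n --> \oo] --> (0 : R).
  rewrite -[X in _ --> X](mulr0 L); apply: cvgMl_tmp.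
  by apply: cvg_expr; rewrite ger0_norm ?invf_lt1 ?ltr1n.
move/cvgrPdist_lt : h0 => /(_ _ d0)[N _ hN]; exists N => n /hN.
by rewrite sub0r normrN exprVn ger0_norm ?divr_ge0 ?exprn_ge0.
Qed.

Lemma cmod_rnorm (z : C) : rnorm z = cmod z. Proof. by []. Qed.

(** Successors halve the size and move the point by at most the size, so the points
along a chain of successors form a Cauchy sequence.  Applied to the triangles of
Goursat's argument. *)
Lemma bisection (T : Type) (bad : T -> Prop) (p : T -> C) (sz : T -> R) :
  (forall s, 0 <= sz s) ->
  (forall s, bad s -> exists s', [/\ bad s', sz s' = sz s / 2 &
     cmod (p s' - p s) <= sz s]) ->
  forall s0, bad s0 -> exists z, forall d : R, 0 < d -> exists s,
    [/\ bad s, sz s < d & cmod (p s - z) <= 2 * sz s].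
Proof.
move=> sz0 H s0 bs0.
have /choice[nx hnx] : forall s, exists s', bad s -> [/\ bad s', sz s' = sz s / 2 &
     cmod (p s' - p s) <= sz s].
  move=> s; case: (pselect (bad s)) => [/H[s' h']|nb]; last by exists s.
  by exists s'.
pose u n := iter n nx s0.
have bu n : bad (u n) by elim: n => //= n /hnx[].
have su n : sz (u n) = sz s0 / 2 ^+ n.
  elim: n => [|n IH]; first by rewrite expr0 divr1.
  by have [_ -> _] := hnx _ (bu n); rewrite IH exprS; field; rewrite expf_neq0.
have pu n m : cmod (p (u (n + m)%N) - p (u n)) <= 2 * sz (u n) - 2 * sz (u (n + m)%N).
  elim: m => [|m IH]; first by rewrite addn0 !subrr cmod0.
  have [_ h1 h2] := hnx _ (bu (n + m)%N); rewrite addnS /=.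
  rewrite -(subrKA (p (u (n + m)%N))) (le_trans (cmodD _ _))//.
  move: h1 h2 IH; rewrite -/(u (n + m)%N); lra.
have small (d : R) : 0 < d -> exists N, forall n, (N <= n)%N -> sz (u n) < d.
  by move=> /(halving_small (sz0 s0))[N hN]; exists N => n /hN; rewrite su.
have [|z hz] := @rcvg_cauchy R (cplx R) (p \o u).
  move=> e e0; have [|N hN] := small (e / 2); first by rewrite divr_gt0.
  exists N => n Nn; rewrite -(subnKC Nn) (le_trans (pu _ _))//.
  have := hN N (leqnn _); have := sz0 (u (N + (n - N))%N).
  lra.
exists z => d /small[N hN]; exists (u N); split => //; first exact: hN.
rewrite -[_ - _]opprB cmodN.
apply: (@rcvg_le R (cplx R) (fun m => p (u (N + m)%N) - p (u N))).
  move=> e /hz[M hM]; exists M => n Mn.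
  by rewrite opprB addrA subrK; apply: hM; rewrite (leq_trans Mn)// leq_addl.
by move=> m; rewrite (le_trans (pu _ _))// gerBl mulr_ge0.
Qed.

(** Cousin's lemma: the supremum of the good right end points is good and cannot be
less than [b].  Compactness of an interval is used below mostly in this form. *)
Lemma cousin (Q : R -> R -> Prop) (a b : R) : a <= b ->
  (forall s m t, a <= s -> s <= m -> m <= t -> t <= b -> Q s m -> Q m t -> Q s t) ->
  (forall x, a <= x <= b -> exists2 d : R, 0 < d & forall s t,
     s <= x <= t -> t - s < d -> a <= s -> t <= b -> Q s t) -> Q a b.
Proof.
move=> ab comb loc.
pose A := [set x | a <= x <= b /\ Q a x].
have Aa : A a.
  have [d d0 dQ] := loc a ltac:(apply/andP; split; lra).
  by split; [apply/andP; split; lra|apply: dQ => //; [rewrite lexx|lra]].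
have Aub : has_sup A by split; [exists a|exists b => x [/andP[]]].
pose c := sup A.
have ac : a <= c by apply: sup_upper_bound.
have cb : c <= b by apply: ge_sup; [exists a|move=> x [/andP[]]].
have [d d0 dQ] := loc c ltac:(apply/andP; split; lra).
have [x [/andP[ax xb] Qx] xc] := sup_adherent d0 Aub.
rewrite -/c in xc; have xc' : x <= c by apply: sup_upper_bound => //; split; [apply/andP; split; lra|].
have Qc : Q a c by apply: (comb a x c) => //; apply: dQ => //; [apply/andP; split; lra|lra].
have [<-//|cb'] : c = b \/ c < b.
  by move: cb; rewrite le_eqVlt => /predU1P[->|]; [left|right].
pose t := Num.min b (c + d / 2).
have ct : c < t by rewrite /t lt_min cb' ltrDl divr_gt0.
have tb : t <= b by rewrite /t ge_min lexx.
have tc : t <= c + d / 2 by rewrite /t ge_min lexx orbT.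
suff At : A t by have := sup_upper_bound Aub At; rewrite -/c; lra.
split; first by apply/andP; split; lra.
by apply: (comb a c t) => //; [lra|apply: dQ => //; [apply/andP; split; lra|lra]].
Qed.
End Nested.

(** * Derivatives relative to a set *)

Section Calculus.
Variables (R : realType).
Local Notation C := (R[i]).

Definition cont_in (V : normedModType R[i]) (D : set C) (f : C -> V) (z : C) :=
  forall e : R, 0 < e -> exists2 d : R, 0 < d &
    forall w, D w -> cmod (w - z) < d -> rnorm (f w - f z) <= e.

(** With D the plane, a strip, a segment or the real line, the same calculus serves
for complex derivatives and for derivatives along a line. *)
Definition deriv_in (V : normedModType R[i]) (D : set C) (f : C -> V) (z : C) (B : V) :=
  forall e : R, 0 < e -> exists2 d : R, 0 < d &
    forall w, D w -> cmod (w - z) < d ->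
      rnorm (f w - f z - (w - z) *: B) <= e * cmod (w - z).

Definition segm (a b : C) : set C :=
  [set z | exists2 t : R, 0 <= t <= 1 & z = a + t%:C * (b - a)].

(** Allows the choice of e / (x + 1) where e / x might divide by zero. *)
Lemma small_mul (e x : R) : 0 <= e -> 0 <= x -> e / (x + 1) * x <= e.
Proof.
move=> e0 x0; have x1 : 0 < x + 1 by rewrite ltr_wpDl.
by rewrite mulrAC ler_pdivrMr// ler_wpM2l// lerDl.
Qed.

Lemma unit_small_mul (e x : R) : 0 < e -> 0 <= x ->
  exists2 s : R, 0 < s <= 1 & s * x <= e.
Proof.
move=> e0 x0; have x1 : 0 < x + 1 by rewrite ltr_wpDl.
exists (Num.min 1 (e / (x + 1))); first by rewrite lt_min ltr01 divr_gt0// ge_min lexx.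
apply: le_trans (small_mul (ltW e0) x0).
by rewrite ler_wpM2r// ge_min lexx orbT.
Qed.

Lemma segm_l a b : segm a b a.
Proof. by exists 0; rewrite ?lexx ?ler01 ?ler0n// rmorph0 mul0r addr0. Qed.
Lemma segm_r a b : segm a b b.
Proof. by exists 1; rewrite ?lexx ?ler01// rmorph1 mul1r addrC subrK. Qed.

Section Rules.
Variable V : normedModType R[i].
Implicit Types (D E : set C) (f g : C -> V).

Lemma cont_in_sub D E f z : E `<=` D -> cont_in D f z -> cont_in E f z.
Proof. by move=> ED h e /h[d d0 hd_]; exists d => // w /ED; exact: hd_. Qed.

Lemma deriv_in_sub D E f z B : E `<=` D -> deriv_in D f z B -> deriv_in E f z B.
Proof. by move=> ED h e /h[d d0 hd_]; exists d => // w /ED; exact: hd_. Qed.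

Lemma deriv_in_lip D f z B : deriv_in D f z B -> exists2 d : R, 0 < d & forall w, D w ->
  cmod (w - z) < d -> rnorm (f w - f z) <= (rnorm B + 1) * cmod (w - z).
Proof.
move=> /(_ 1 ltr01)[d d0 h]; exists d => // w Dw wz.
have -> : f w - f z = (f w - f z - (w - z) *: B) + (w - z) *: B by rewrite subrK.
rewrite (le_trans (rnormD _ _))// rnormZ mulrDl addrC [rnorm B * _]mulrC lerD2l.
exact: h.
Qed.

Lemma deriv_in_cont D f z B : deriv_in D f z B -> cont_in D f z.
Proof.
move=> /deriv_in_lip[d d0 h] e e0.
have B0 := rnorm_ge0 B; have B1 : 0 < rnorm B + 1 by rewrite ltr_wpDl.
exists (Num.min d (e / (rnorm B + 1))); first by rewrite lt_min d0 divr_gt0.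
move=> w Dw; rewrite lt_min => /andP[wd]; rewrite ltr_pdivlMr// => we.
by rewrite (le_trans (h w Dw wd))// mulrC ltW.
Qed.

Lemma deriv_in_cst D (c : V) z : deriv_in D (fun=> c) z 0.
Proof.
move=> e e0; exists 1 => // w _ _.
by rewrite subrr scaler0 subr0 rnorm0 mulr_ge0 ?cmod_ge0// ltW.
Qed.

Lemma deriv_inD D f g z A B : deriv_in D f z A -> deriv_in D g z B ->
  deriv_in D (fun w => f w + g w) z (A + B).
Proof.
move=> hf hg e e0; have e2 : 0 < e / 2 by rewrite divr_gt0.
have [d d0 h] := hf _ e2; have [d' d0' h'] := hg _ e2.
exists (Num.min d d'); first by rewrite lt_min d0.
move=> w Dw; rewrite lt_min => /andP[wd wd'].
have -> : f w + g w - (f z + g z) - (w - z) *: (A + B) =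
  (f w - f z - (w - z) *: A) + (g w - g z - (w - z) *: B).
  by module; ring.
rewrite (le_trans (rnormD _ _))// [e in leRHS]splitr mulrDl.
by rewrite lerD ?h ?h'.
Qed.

Lemma deriv_inZ D f z B (c : C) : deriv_in D f z B -> deriv_in D (fun w => c *: f w) z (c *: B).
Proof.
move=> hf e e0.
have c1 : 0 < cmod c + 1 by rewrite ltr_wpDl ?cmod_ge0.
have [|d d0 h] := hf (e / (cmod c + 1)); first by rewrite divr_gt0.
exists d => // w Dw /(h w Dw).
have -> : c *: f w - c *: f z - (w - z) *: (c *: B) = c *: (f w - f z - (w - z) *: B).
  by module; ring.
rewrite rnormZ => h'.
apply: le_trans (ler_wpM2l (cmod_ge0 c) h') _.
by rewrite mulrA ler_wpM2r ?cmod_ge0// mulrC small_mul ?cmod_ge0 ?(ltW e0).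
Qed.

Lemma deriv_inN D f z B : deriv_in D f z B -> deriv_in D (fun w => - f w) z (- B).
Proof.
move=> /(deriv_inZ (-1)); rewrite scaleN1r.
by rewrite (_ : (fun w => -1 *: f w) = (fun w => - f w))//; apply/funext => w; rewrite scaleN1r.
Qed.

Lemma deriv_inB D f g z A B : deriv_in D f z A -> deriv_in D g z B ->
  deriv_in D (fun w => f w - g w) z (A - B).
Proof. by move=> hf /deriv_inN; exact: deriv_inD. Qed.

Lemma deriv_in_affine D E f (p q : C) z B : deriv_in D f (p + q * z) B ->
  (forall w, E w -> D (p + q * w)) -> deriv_in E (fun w => f (p + q * w)) z (q *: B).
Proof.
move=> hf ED e e0.
have c1 : 0 < cmod q + 1 by rewrite ltr_wpDl ?cmod_ge0.
have [|d d0 h] := hf (e / (cmod q + 1)); first by rewrite divr_gt0.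
exists (d / (cmod q + 1)); first by rewrite divr_gt0.
move=> w Ew; rewrite ltr_pdivlMr// => wz.
have E1 : p + q * w - (p + q * z) = (w - z) * q by ring.
have := h _ (ED w Ew); rewrite E1 scalerA cmodM => h'.
have c0 := cmod_ge0 (w - z).
apply: le_trans (h' _) _; first by apply: le_lt_trans wz; rewrite mulrDr lerDl mulr1.
by rewrite [cmod _ * cmod q]mulrC mulrA ler_wpM2r// small_mul ?cmod_ge0 ?(ltW e0).
Qed.

Lemma deriv_in_square D (z w : C) (B : V) :
  deriv_in D (fun u => ((u - z) ^+ 2 / 2) *: B) w ((w - z) *: B).
Proof.
move=> r r0; have B1 : 0 < rnorm B + 1 by rewrite ltr_wpDl ?rnorm_ge0.
exists (r / (rnorm B + 1)); first by rewrite divr_gt0.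
move=> v _ vw.
have -> : ((v - z) ^+ 2 / 2) *: B - ((w - z) ^+ 2 / 2) *: B -
   (v - w) *: ((w - z) *: B) = ((v - w) * ((v - w) / 2)) *: B.
  by module; field.
have n0 := rnorm_ge0 B; have c0 := cmod_ge0 (v - w).
rewrite rnormZ cmodM cmod_half -mulrA mulrC ler_wpM2r//.
apply: le_trans (_ : r / (rnorm B + 1) * rnorm B <= _); last by rewrite small_mul// ltW.
by rewrite ler_wpM2r//; lra.
Qed.

End Rules.

Lemma deriv_inM (V : normedModType R[i]) (D : set C) (k : C -> cplx R) (f : C -> V) z (b : cplx R) B : deriv_in D k z b -> deriv_in D f z B ->
  deriv_in D (fun w => (k w : C) *: f w) z ((k z : C) *: B + (b : C) *: f z).
Proof.
move=> hk hf e e0.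
have [dk dk0 lk] := deriv_in_lip hk.
have k1 : 0 < cmod (k z) + 1 by rewrite ltr_wpDl ?cmod_ge0.
have f1 : 0 < rnorm (f z) + 1 by rewrite ltr_wpDl ?rnorm_ge0.
have b1 : 0 < rnorm b + 1 by rewrite ltr_wpDl ?rnorm_ge0.
have e3 : 0 < e / 3 by rewrite divr_gt0.
have [|d d0 h] := hf (e / 3 / (cmod (k z) + 1)); first by rewrite divr_gt0.
have [|d' d'0 h'] := hk (e / 3 / (rnorm (f z) + 1)); first by rewrite divr_gt0.
have [|d2 d20 h2] := deriv_in_cont hf (e := e / 3 / (rnorm b + 1)); first by rewrite divr_gt0.
exists (Num.min (Num.min dk d) (Num.min d' d2)); first by rewrite !lt_min dk0 d0 d'0.
move=> w Dw; rewrite !lt_min => /andP[/andP[wk wd] /andP[wd' wd2]].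
have -> : (k w : C) *: f w - (k z : C) *: f z - (w - z) *: ((k z : C) *: B + (b : C) *: f z) =
  (k z : C) *: (f w - f z - (w - z) *: B) +
  ((k w : C) - k z - (w - z) * b) *: f z + ((k w : C) - k z) *: (f w - f z).
  by module; ring.
have H1 := h _ Dw wd; have H3 := h2 _ Dw wd2.
have H2 : cmod ((k w : C) - k z - (w - z) * b) <= e / 3 / (rnorm (f z) + 1) * cmod (w - z) := h' _ Dw wd'.
have H4 : cmod ((k w : C) - k z) <= (rnorm b + 1) * cmod (w - z) := lk _ Dw wk.
have -> : e * cmod (w - z) = e / 3 * cmod (w - z) + e / 3 * cmod (w - z) + e / 3 * cmod (w - z).
  by field.
rewrite (le_trans (rnormD _ _))// lerD//.
- rewrite (le_trans (rnormD _ _))// lerD//.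
    rewrite rnormZ; apply: le_trans (ler_wpM2l (cmod_ge0 _) H1) _.
    by rewrite mulrA ler_wpM2r ?cmod_ge0// mulrC small_mul ?(ltW e3) ?cmod_ge0.
  rewrite rnormZ; apply: le_trans (ler_wpM2r (rnorm_ge0 _) H2) _.
  by rewrite mulrAC ler_wpM2r ?cmod_ge0// small_mul ?(ltW e3) ?rnorm_ge0.
- rewrite rnormZ; apply: le_trans (ler_pM (cmod_ge0 _) (rnorm_ge0 _) H4 H3) _.
  by apply: eqW; field; rewrite gt_eqF.
Qed.

Lemma deriv_in_id D z : deriv_in D (id : C -> cplx R) z (1 : C).
Proof.
move=> e e0; exists 1 => // w _ _.
have -> : (w : cplx R) - z - (w - z) *: (1 : C) = 0 :> cplx R.
  by rewrite -[_ *: _]/((w - z : C) * 1) mulr1 subrr.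
by rewrite rnorm0 mulr_ge0 ?cmod_ge0// ltW.
Qed.

Lemma deriv_in_inv D (z : C) : z != 0 ->
  deriv_in D (fun w => w^-1 : cplx R) z (- (z^-1 * z^-1)).
Proof.
move=> z0 e e0; set m := cmod z; have m0 : 0 < m by rewrite cmod_gt0.
exists (Num.min (m / 2) (e * m ^+ 3 / 2)).
  by rewrite lt_min !divr_gt0// mulr_gt0// exprn_gt0.
move=> w _; rewrite lt_min => /andP[w1 w2].
have mw : m / 2 <= cmod w.
  have : m <= cmod w + cmod (w - z).
    by rewrite cmodB /m -{1}(subrK w z) addrC cmodD.
  move: w1; lra.
have w0 : w != 0 by rewrite -cmod_gt0 (lt_le_trans _ mw)// divr_gt0.
have -> : w^-1 - z^-1 - (w - z) *: (- (z^-1 * z^-1) : cplx R) =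
   (w - z) * (w - z) * (w^-1 * z^-1 * z^-1) :> C.
  by rewrite -[_ *: _]/((w - z : C) * _); field; rewrite w0 z0.
rewrite cmod_rnorm !cmodM !cmodV -/m.
have c0 := cmod_ge0 (w - z).
rewrite mulrAC; apply: ler_wpM2r => //.
apply: le_trans (_ : e * m ^+ 3 / 2 * (2 / m * m^-1 * m^-1) <= _); last first.
  by apply: eqW; field; rewrite gt_eqF.
rewrite ler_pM// ?mulr_ge0 ?invr_ge0 ?cmod_ge0 ?(ltW m0) ?(ltW w2)//.
rewrite !ler_pM2r ?invr_gt0//.
rewrite -[2 / m]invrK lef_pV2 ?posrE ?cmod_gt0// ?invr_gt0 ?divr_gt0//.
by rewrite invfM invrK mulrC.
Qed.

Section MeanValue.
Variable V : normedModType R[i].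
Implicit Types f : C -> V.

Let segm_dist (a b : C) (s t : R) : s <= t ->
  cmod (a + t%:C * (b - a) - (a + s%:C * (b - a))) = (t - s) * cmod (b - a).
Proof.
move=> st; have -> : a + t%:C * (b - a) - (a + s%:C * (b - a)) = (t - s)%:C * (b - a).
  by rewrite rmorphB /=; ring.
by rewrite cmodM cmodR ger0_norm// subr_ge0.
Qed.

(** For every e > 0 the bound with M + e holds for short subintervals around each
point, and it adds up, so Cousin's lemma applies. *)
Lemma mean_value f a b (M : R) :
  (forall z, segm a b z -> exists2 B, deriv_in (segm a b) f z B & rnorm B <= M) ->
  rnorm (f b - f a) <= M * cmod (b - a).
Proof.
move=> H; set L := cmod (b - a).
have L0 : 0 <= L by exact: cmod_ge0.
pose g t := a + t%:C * (b - a).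
have sgg t : 0 <= t <= 1 -> segm a b (g t) by exists t.
suff K e : 0 < e -> rnorm (f b - f a) <= (M + e) * L.
  apply/ler_addgt0Pr => e e0.
  have L1 : 0 < L + 1 by rewrite ltr_wpDl.
  have := K (e / (L + 1)) (divr_gt0 e0 L1); rewrite mulrDl => /le_trans; apply.
  by rewrite lerD2l small_mul// ltW.
move=> e0.
have g0 : g 0 = a by rewrite /g rmorph0 mul0r addr0.
have g1 : g 1 = b by rewrite /g rmorph1 mul1r addrC subrK.
have : rnorm (f (g 1) - f (g 0)) <= (M + e) * ((1 - 0) * L).
  apply: (@cousin R (fun s t => rnorm (f (g t) - f (g s)) <= (M + e) * ((t - s) * L))) => //.
    move=> s m t _ _ _ _ h1 h2; rewrite (le_trans (rnorm_tri (f (g m)) _ _))//.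
    by rewrite (le_trans (lerD h2 h1))// -mulrDr -mulrDl subrKA.
  move=> x x01; have [B hB MB] := H _ (sgg _ x01).
  have [d d0 hdd] := hB e e0.
  have L1 : 0 < L + 1 by rewrite ltr_wpDl.
  exists (d / (L + 1)); first by rewrite divr_gt0.
  move=> s t /andP[sx xt] ts s0 t1.
  have close : (t - s) * L < d.
    move: ts; rewrite ltr_pdivlMr// mulrDr mulr1 => /(le_lt_trans _); apply.
    by rewrite lerDl subr_ge0; lra.
  have ht : rnorm (f (g t) - f (g x) - (g t - g x) *: B) <= e * ((t - x) * L).
    rewrite -segm_dist//; apply: hdd; first by apply: sgg; lra.
    rewrite segm_dist//; apply: le_lt_trans close; rewrite ler_wpM2r//; lra.
  have hs : rnorm (f (g s) - f (g x) - (g s - g x) *: B) <= e * ((x - s) * L).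
    rewrite -segm_dist// cmodB; apply: hdd; first by apply: sgg; lra.
    rewrite cmodB segm_dist//; apply: le_lt_trans close; rewrite ler_wpM2r//; lra.
  have -> : f (g t) - f (g s) = (g t - g s) *: B +
     ((f (g t) - f (g x) - (g t - g x) *: B) - (f (g s) - f (g x) - (g s - g x) *: B)).
    by module; ring.
  rewrite (le_trans (rnormD _ _))// mulrDl lerD//.
    rewrite rnormZ segm_dist; last lra.
    by rewrite mulrC ler_wpM2r// mulr_ge0//; lra.
  rewrite (le_trans (rnormB _ _))// (le_trans (lerD ht hs))// -mulrDr -mulrDl.
  by rewrite subrKA.
by rewrite g0 g1 subr0 mul1r.
Qed.

(** The mean value inequality for f(w) - w L. *)
Lemma mean_value_lin f a b (L : V) (e : R) :
  (forall z, segm a b z -> exists2 B, deriv_in (segm a b) f z B & rnorm (B - L) <= e) ->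
  rnorm (f b - f a - (b - a) *: L) <= e * cmod (b - a).
Proof.
move=> H.
have -> : f b - f a - (b - a) *: L = (f b - b *: L) - (f a - a *: L) by module; ring.
apply: (mean_value (f := fun w => f w - w *: L)) => z /H[B hB BL].
exists (B - (z *: (0 : V) + (1 : C) *: L)); last by rewrite scaler0 add0r scale1r.
by apply: deriv_inB => //; apply: deriv_inM (deriv_in_cst _ _ _); exact: deriv_in_id.
Qed.

Lemma cont_in_unif f a b : (forall z, segm a b z -> cont_in (segm a b) f z) ->
  forall e : R, 0 < e -> exists2 d : R, 0 < d &
  forall u v, segm a b u -> segm a b v -> cmod (u - v) < d -> rnorm (f u - f v) <= e.
Proof.
move=> H e e0; set L := cmod (b - a).
have L0 : 0 <= L by exact: cmod_ge0.
have L1 : 0 < L + 1 by rewrite ltr_wpDl.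
pose g t := a + t%:C * (b - a).
have sgg t : 0 <= t <= 1 -> segm a b (g t) by exists t.
pose Q s t := exists2 d : R, 0 < d & forall x, s <= x <= t -> 0 <= x <= 1 ->
  forall v, segm a b v -> cmod (v - g x) < d -> rnorm (f v - f (g x)) <= e.
suff [d d0 dQ] : Q 0 1.
  by exists d => // u v su [t t01 ->]; exact: dQ.
apply: cousin => //.
  move=> s m t _ _ _ _ [d d0 dQ] [d' d0' hd']; exists (Num.min d d').
    by rewrite lt_min d0.
  move=> x /andP[sx xt] x01 v sv; rewrite lt_min => /andP[h h'].
  have [xm|mx] := leP x m; first by apply: dQ => //; rewrite sx.
  by apply: hd' => //; rewrite xt ltW.
move=> x x01; have e2 : 0 < e / 2 by rewrite divr_gt0.
have [d d0 hdd] := H _ (sgg _ x01) _ e2.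
exists (d / 2 / (L + 1)); first by rewrite !divr_gt0.
move=> s t /andP[sx xt] ts s0 t1.
exists (d / 2); first by rewrite divr_gt0.
move=> y /andP[sy yt] y01 v sv vy.
have xy : cmod (g y - g x) < d / 2.
  have : `|y - x| < d / 2 / (L + 1).
    by apply: le_lt_trans ts; rewrite ler_norml; lra.
  rewrite ltr_pdivlMr// => hh; apply: le_lt_trans hh.
  have [yx|xy] := leP x y.
    by rewrite segm_dist// ger0_norm ?subr_ge0// ler_wpM2l ?subr_ge0// -/L lerDl.
  rewrite cmodB distrC segm_dist ?(ltW xy)// ger0_norm ?subr_ge0 ?(ltW xy)//.
  by rewrite ler_wpM2l ?subr_ge0 ?(ltW xy)// -/L lerDl.
rewrite (le_trans (rnorm_tri (f (g x)) _ _))// [leRHS]splitr lerD//.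
  apply: hdd => //; apply: le_lt_trans (_ : cmod (v - g y) + cmod (g y - g x) < _).
    by rewrite -(subrKA (g y)) cmodD.
  by rewrite [ltRHS]splitr ltrD.
rewrite rnormC; apply: hdd; first exact: sgg.
by apply: lt_trans xy _; rewrite ltr_pdivrMr// ltr_pMr// ltr1n.
Qed.

End MeanValue.

End Calculus.

(** * Integrals along segments *)

Section SegmentIntegral.
Variables (R : realType).
Local Notation C := (R[i]).

Definition mid (a b : C) : C := (a + b) / 2.

Lemma mid_segm a b : segm a b (mid a b).
Proof.
exists 2^-1; first by apply/andP; split; lra.
by rewrite /mid fmorphV rmorph_nat; field.
Qed.

Lemma segm_convex (a b u v : C) : segm a b u -> segm a b v -> segm u v `<=` segm a b.
Proof.
move=> [s /andP[s0 s1] ->] [r /andP[r0 r1] ->] z [t /andP[t0 t1] ->].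
exists (s + t * (r - s)); first by apply/andP; split; nra.
by rewrite !rmorphD !rmorphM /= rmorphB /=; ring.
Qed.

Lemma segm_cmod (a b w : C) : segm a b w -> cmod (w - a) <= cmod (b - a).
Proof.
move=> [t /andP[t0 t1] ->]; rewrite addrAC subrr add0r cmodM cmodR ger0_norm//.
by rewrite ler_piMl// cmod_ge0.
Qed.

Lemma segm_mid_cmod (u v w : C) : segm u v w -> cmod (w - mid u v) <= cmod (v - u).
Proof.
move=> [t /andP[t0 t1] ->].
have -> : u + t%:C * (v - u) - mid u v = (t - 2^-1)%:C * (v - u).
  by rewrite rmorphB /= fmorphV rmorph_nat /mid; field.
rewrite cmodM cmodR ler_piMl ?cmod_ge0//.
by rewrite ler_norml; apply/andP; split; lra.
Qed.

Lemma midBl a b : mid a b - a = (b - a) / 2. Proof. by rewrite /mid; field. Qed.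
Lemma midBr a b : b - mid a b = (b - a) / 2. Proof. by rewrite /mid; field. Qed.
Lemma mid_comm a b : mid a b = mid b a. Proof. by rewrite /mid addrC. Qed.

Variable V : completeNormedModType R[i].
Implicit Types (f g : C -> V).

(** The Riemann sum over 2 ^ n equal pieces with their midpoints as tags.  The
recursion makes additivity at the midpoint and reversal immediate, and these are
what Goursat's theorem uses. *)
Fixpoint midsum (n : nat) f (a b : C) : V :=
  if n is n'.+1 then midsum n' f a (mid a b) + midsum n' f (mid a b) b
  else (b - a) *: f (mid a b).

(** Errors proportional to the lengths of the pieces add up to an error
proportional to the length of the segment.  The family [A] is additive under
halving: a linear function, a finer sum, or the increment of a primitive. *)
Lemma midsum_cmp (A : nat -> C -> C -> V) f (e : R) :
  (forall j a b, A j.+1 a b = A j a (mid a b) + A j (mid a b) b) ->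
  forall n a b,
  (forall u v, segm a b u -> segm a b v -> cmod (v - u) * 2 ^+ n = cmod (b - a) ->
     rnorm ((v - u) *: f (mid u v) - A 0%N u v) <= e * cmod (v - u)) ->
  rnorm (midsum n f a b - A n a b) <= e * cmod (b - a).
Proof.
move=> HA; elim => [|n IH] a b H /=.
  by apply: H; [exact: segm_l|exact: segm_r|rewrite expr0 mulr1].
rewrite HA opprD addrACA (le_trans (rnormD _ _))//.
have -> : e * cmod (b - a) = e * cmod (mid a b - a) + e * cmod (b - mid a b).
  by rewrite midBl midBr cmod_half; field.
rewrite lerD//; apply: IH => u v hu hv uv; apply: H.
- exact: segm_convex (segm_l _ _) (mid_segm _ _) _ hu.
- exact: segm_convex (segm_l _ _) (mid_segm _ _) _ hv.
- by rewrite exprS mulrCA uv midBl cmod_half mulrC divfK.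
- exact: segm_convex (mid_segm _ _) (segm_r _ _) _ hu.
- exact: segm_convex (mid_segm _ _) (segm_r _ _) _ hv.
- by rewrite exprS mulrCA uv midBr cmod_half mulrC divfK.
Qed.

Lemma midsum_near f a b (L : V) (e : R) n :
  (forall w, segm a b w -> rnorm (f w - L) <= e) ->
  rnorm (midsum n f a b - (b - a) *: L) <= e * cmod (b - a).
Proof.
move=> H; apply: (midsum_cmp (A := fun _ a b => (b - a) *: L)) => [_ u v|u v hu hv _].
  by rewrite -scalerDl; congr (_ *: _); ring.
rewrite -scalerBr rnormZ mulrC ler_wpM2r ?cmod_ge0// H//.
exact: segm_convex hu hv _ (mid_segm _ _).
Qed.

Definition segint f (a b : C) : V := xget 0 [set v | rcvg (fun n => midsum n f a b) v].

Definition cont_segm f a b := forall z, segm a b z -> cont_in (segm a b) f z.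

Lemma cont_segm_sub f a b u v : segm a b u -> segm a b v -> cont_segm f a b -> cont_segm f u v.
Proof.
move=> hu hv H z hz; have sub := segm_convex hu hv.
by apply: (cont_in_sub sub); apply: H; exact: sub.
Qed.

Lemma segm_rev (a b : C) : segm a b `<=` segm b a.
Proof. exact: segm_convex (segm_r _ _) (segm_l _ _). Qed.

Lemma cont_segm_rev f a b : cont_segm f a b -> cont_segm f b a.
Proof. by apply: cont_segm_sub; [exact: segm_r|exact: segm_l]. Qed.

Lemma segint_cvg f a b : cont_segm f a b -> rcvg (fun n => midsum n f a b) (segint f a b).
Proof.
move=> H; rewrite /segint; case: xgetP => [v _ //|/forallNP N].
exfalso; suff [l hl] : exists l, rcvg (fun n => midsum n f a b) l by case: N; exists l.
apply: rcvg_cauchy => e e0; set L := cmod (b - a).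
have L0 : 0 <= L by exact: cmod_ge0.
have L1 : 0 < L + 1 by rewrite ltr_wpDl.
have [|d d0 hd_] := cont_in_unif H (e := e / (L + 1)); first by rewrite divr_gt0.
have [N0 /(_ N0 (leqnn _)) hN0] := halving_small L0 d0.
exists N0 => n Nn; rewrite rnormC.
apply: le_trans (_ : e / (L + 1) * L <= _); last by rewrite small_mul// ltW.
rewrite -(subnKC Nn).
apply: (midsum_cmp (A := fun j => midsum (j + (n - N0)) f)) => // u v hu hv uv.
rewrite add0n rnormC; apply: midsum_near => w hw.
have hsw : segm a b w by exact: segm_convex hu hv _ hw.
apply: hd_ => //; first exact: segm_convex hu hv _ (mid_segm _ _).
apply: le_lt_trans hN0; rewrite -[L]uv mulfK ?expf_neq0//.
exact: segm_mid_cmod hw.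
Qed.

Lemma segint_uniq f a b v : cont_segm f a b -> rcvg (fun n => midsum n f a b) v -> segint f a b = v.
Proof. by move=> /segint_cvg h /(rcvg_uniq h). Qed.

Lemma segint_split f a b : cont_segm f a b ->
  segint f a b = segint f a (mid a b) + segint f (mid a b) b.
Proof.
move=> H; apply: (rcvg_uniq (u := fun n => midsum n.+1 f a b)).
  by apply: (@rcvg_shift _ _ (fun n => midsum n f a b)); exact: segint_cvg.
apply: rcvgD; apply: segint_cvg; apply: cont_segm_sub H;
  by [exact: segm_l|exact: segm_r|exact: mid_segm].
Qed.

Lemma midsum_rev f a b n : midsum n f b a = - midsum n f a b.
Proof.
elim: n a b => [|n IH] a b /=; first by rewrite mid_comm -scaleNr opprB.
by rewrite mid_comm IH [midsum n f _ a]IH opprD addrC.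
Qed.

Lemma segint_rev f a b : cont_segm f a b -> segint f b a = - segint f a b.
Proof.
move=> H; apply: segint_uniq; first exact: cont_segm_rev.
apply: (rcvg_ext (u := fun n => (-1 : C) *: midsum n f a b)).
  by move=> n; rewrite [RHS]midsum_rev scaleN1r.
by rewrite -[- segint f a b]scaleN1r; apply: (@rcvgZ _ _ (-1) (fun n => midsum n f a b)); exact: segint_cvg.
Qed.

Lemma cont_in_lin f g (c : C) D z : cont_in D f z -> cont_in D g z -> cont_in D (fun w => f w + c *: g w) z.
Proof.
move=> hf hg e e0.
have c1 : 0 < cmod c + 1 by rewrite ltr_wpDl ?cmod_ge0.
have e2 : 0 < e / 2 by rewrite divr_gt0.
have [d d0 h] := hf _ e2.
have [|d' d'0 h'] := hg (e / 2 / (cmod c + 1)); first by rewrite divr_gt0.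
exists (Num.min d d'); first by rewrite lt_min d0.
move=> w Dw; rewrite lt_min => /andP[wd wd'].
rewrite opprD addrACA -scalerBr (le_trans (rnormD _ _))// [leRHS]splitr lerD ?h// rnormZ.
apply: le_trans (ler_wpM2l (cmod_ge0 c) (h' _ Dw wd')) _.
by rewrite mulrC small_mul ?cmod_ge0// ltW.
Qed.

Lemma segint_lin f g (c : C) a b : cont_segm f a b -> cont_segm g a b ->
  segint (fun w => f w + c *: g w) a b = segint f a b + c *: segint g a b.
Proof.
move=> hf hg; apply: segint_uniq.
  by move=> z hz; apply: cont_in_lin; [exact: hf|exact: hg].
apply: (rcvg_ext (u := fun n => midsum n f a b + c *: midsum n g a b)); last first.
  by apply: rcvgD; [exact: segint_cvg|apply: rcvgZ; exact: segint_cvg].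
move=> n; elim: n a b {hf hg} => [|n IH] a b /=.
  by rewrite scalerDr !scalerA [c * _]mulrC.
by rewrite -!IH scalerDr addrACA.
Qed.

Lemma segint_near f a b (L : V) (e : R) : cont_segm f a b ->
  (forall w, segm a b w -> rnorm (f w - L) <= e) ->
  rnorm (segint f a b - (b - a) *: L) <= e * cmod (b - a).
Proof.
move=> /segint_cvg H K.
apply: (@rcvg_le _ _ (fun n => midsum n f a b - (b - a) *: L)).
  move=> r /H[N hN]; exists N => n /hN.
  by rewrite opprB addrA subrK.
by move=> n; exact: midsum_near.
Qed.

Lemma segint_bound f a b (M : R) : cont_segm f a b ->
  (forall w, segm a b w -> rnorm (f w) <= M) -> rnorm (segint f a b) <= M * cmod (b - a).
Proof.
move=> H K; have := @segint_near f a b 0 M H; rewrite scaler0 subr0; apply.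
by move=> w /K; rewrite subr0.
Qed.

(** On each piece the increment of [P] differs from the term of the midpoint sum by
what the mean value inequality allows, and [f] is uniformly continuous. *)
Lemma segint_ftc f P a b : cont_segm f a b ->
  (forall z, segm a b z -> deriv_in (segm a b) P z (f z)) -> segint f a b = P b - P a.
Proof.
move=> H HP; apply: segint_uniq => //.
move=> e e0; set L := cmod (b - a).
have L0 : 0 <= L by exact: cmod_ge0.
have L1 : 0 < L + 1 by rewrite ltr_wpDl.
have [|d d0 hd_] := cont_in_unif H (e := e / (L + 1)); first by rewrite divr_gt0.
have [N0 hN0] := halving_small L0 d0.
exists N0 => n /hN0 hn.
apply: le_trans (_ : e / (L + 1) * L <= _); last by rewrite small_mul// ltW.
apply: (midsum_cmp (A := fun j a b => P b - P a)) => // [_ u v|u v hu hv uv].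
  by rewrite [RHS]addrC subrKA.
rewrite rnormC; apply: mean_value_lin => z hz.
have hsw : segm a b z by exact: segm_convex hu hv _ hz.
exists (f z); first by apply: deriv_in_sub (segm_convex hu hv) _; exact: HP.
apply: hd_ => //; first exact: segm_convex hu hv _ (mid_segm _ _).
apply: le_lt_trans hn; rewrite -[L]uv mulfK ?expf_neq0//.
exact: segm_mid_cmod hz.
Qed.

(** * Goursat's theorem and primitives *)

Definition convex_in (D : set C) := forall a b, D a -> D b -> segm a b `<=` D.
Definition closed_in (D : set C) :=
  forall z, (forall e : R, 0 < e -> exists2 w, D w & cmod (w - z) < e) -> D z.
Definition holo (D : set C) f := forall z, D z -> exists B, deriv_in D f z B.

Lemma holo_cont_segm D f a b : convex_in D -> D a -> D b -> holo D f -> cont_segm f a b.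
Proof.
move=> cD Da Db hf z hz; have sub := cD _ _ Da Db.
have [B hB] := hf z (sub _ hz).
exact: cont_in_sub sub (deriv_in_cont hB).
Qed.

Section Goursat.
Variables (D : set C) (f : C -> V).
Hypotheses (cD : convex_in D) (clD : closed_in D) (hf : holo D f).

Let triint g (s : C * C * C) :=
  segint g s.1.1 s.1.2 + segint g s.1.2 s.2 + segint g s.2 s.1.1.
Let perim (s : C * C * C) : R :=
  cmod (s.1.2 - s.1.1) + cmod (s.2 - s.1.2) + cmod (s.1.1 - s.2).
Let inD (s : C * C * C) := [/\ D s.1.1, D s.1.2 & D s.2].

Let sc a b : D a -> D b -> cont_segm f a b.
Proof. by move=> Da Db; exact: holo_cont_segm hf. Qed.

Let perim_ge0 s : 0 <= perim s.
Proof. by rewrite /perim !addr_ge0 ?cmod_ge0. Qed.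

(** The integral over a triangle is the sum of the integrals over the four triangles
cut out by the midpoints of the sides. *)
Let triint_quarter s (e : R) : inD s -> e < rnorm (triint f s) -> exists s',
  [/\ inD s', e / 4 < rnorm (triint f s'), perim s' = perim s / 2 & cmod (s'.1.1 - s.1.1) <= perim s].
Proof.
case: s => [[a b] c] [/= Da Db Dc] he.
pose p := mid a b; pose q := mid b c; pose r := mid c a.
have Dp : D p by exact: cD (mid_segm _ _).
have Dq : D q by exact: cD (mid_segm _ _).
have Dr : D r by exact: cD (mid_segm _ _).
have E : triint f (a, b, c) = triint f (a, p, r) + triint f (p, b, q) + triint f (r, q, c) + triint f (p, q, r).
  rewrite /triint /= (segint_split (sc Da Db)) (segint_split (sc Db Dc)) (segint_split (sc Dc Da)).
  rewrite -/p -/q -/r (segint_rev (sc Dp Dq)) (segint_rev (sc Dq Dr)) (segint_rev (sc Dr Dp)).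
  by module_over R[i]; ring.
have h2 x y : cmod (mid x y - x) = cmod (y - x) / 2 by rewrite midBl cmod_half.
have h3 x y : cmod (y - mid x y) = cmod (y - x) / 2 by rewrite midBr cmod_half.
have hpq : cmod (q - p) = cmod (a - c) / 2.
  by rewrite -cmod_half -cmodN; congr cmod; rewrite /p /q /mid; field.
have hqr : cmod (r - q) = cmod (b - a) / 2.
  by rewrite -cmod_half -cmodN; congr cmod; rewrite /r /q /mid; field.
have hrp : cmod (p - r) = cmod (c - b) / 2.
  by rewrite -cmod_half -cmodN; congr cmod; rewrite /r /p /mid; field.
have c1 := cmod_ge0 (b - a); have c2 := cmod_ge0 (c - b); have c3 := cmod_ge0 (a - c).
have pa : cmod (p - a) <= perim (a, b, c) by rewrite h2 /perim /=; lra.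
have ra : cmod (r - a) <= perim (a, b, c) by rewrite cmodB h3 /perim /=; lra.
have good s' : inD s' -> perim s' = perim (a, b, c) / 2 ->
   cmod (s'.1.1 - a) <= perim (a, b, c) ->
   (exists s', [/\ inD s', e / 4 < rnorm (triint f s'), perim s' = perim (a, b, c) / 2 &
      cmod (s'.1.1 - a) <= perim (a, b, c)]) \/ rnorm (triint f s') <= e / 4.
  move=> hD hp hc; have [|lt] := leP (rnorm (triint f s')) (e / 4); [by right|left].
  by exists s'.
have p1 : perim (a, p, r) = perim (a, b, c) / 2.
  by rewrite /perim /= h2 (cmodB r p) hrp h3; field.
have p2 : perim (p, b, q) = perim (a, b, c) / 2.
  by rewrite /perim /= h3 (h2 b c) (cmodB p q) hpq; field.
have p3 : perim (r, q, c) = perim (a, b, c) / 2.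
  by rewrite /perim /= (cmodB q r) hqr (h3 b c) (h2 c a); field.
have p4 : perim (p, q, r) = perim (a, b, c) / 2.
  by rewrite /perim /= hpq hqr hrp; field.
have aa : cmod (a - a) <= perim (a, b, c) by rewrite subrr cmod0.
have [//|t1] := good (a, p, r) (And3 Da Dp Dr) p1 aa.
have [//|t2] := good (p, b, q) (And3 Dp Db Dq) p2 pa.
have [//|t3] := good (r, q, c) (And3 Dr Dq Dc) p3 ra.
have [//|t4] := good (p, q, r) (And3 Dp Dq Dr) p4 pa.
move: he; rewrite E ltNge => /negP[].
have -> : e = e / 4 + e / 4 + e / 4 + e / 4 by field.
by do 3 rewrite (le_trans (rnormD _ _))// lerD//.
Qed.

(** Otherwise bisection produces triangles that shrink to a point z and whose
integrals exceed e times the square of the perimeter.  Near z the function [f] is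
close to its affine approximation, which has a primitive. *)
Let triint_small s (e : R) : inD s -> 0 < e -> rnorm (triint f s) <= e * perim s ^+ 2.
Proof.
move=> Ds e0; rewrite leNgt; apply/negP => bads.
pose bad s := inD s /\ e * perim s ^+ 2 < rnorm (triint f s).
have [|z hz] := @bisection R _ bad (fun s => s.1.1) perim perim_ge0 _ s (conj Ds bads).
  move=> s1 [D1 /(triint_quarter D1)[s2 [D2 h2 p2 c2]]]; exists s2; split => //; split => //.
  by move: h2; rewrite p2; congr (_ < _); field.
have Dz : D z.
  apply: clD => r r0; have r3 : 0 < r / 3 by rewrite divr_gt0.
  have [s1 [[[D1 _ _] _] h1 h2]] := hz _ r3.
  by exists s1.1.1 => //; lra.
have [B hB] := hf Dz.
have [|d d0 hd_] := hB (e / 4); first by rewrite divr_gt0.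
have d4 : 0 < d / 4 by rewrite divr_gt0.
have [[[a b] c] [[[/= Da Db Dc] h0] h1 h2]] := hz _ d4.
set p := perim (a, b, c) in h0 h1 h2; have p0 : 0 <= p by exact: perim_ge0.
pose g w := f z + (w - z) *: B.
pose P (w : C) := w *: f z + ((w - z) ^+ 2 / 2) *: B.
have Pg E w : deriv_in E P w (g w).
  apply: deriv_inD (deriv_in_square _ _ _ _).
  have := deriv_inM (deriv_in_id E w) (deriv_in_cst E (f z) w).
  by rewrite scaler0 add0r scale1r.
have gc x y : cont_segm g x y.
  move=> w _; apply: (deriv_in_cont (B := B)) => r r0; exists 1 => // u _ _.
  have -> : g u - g w - (u - w) *: B = 0 by rewrite /g; module; ring.
  by rewrite rnorm0 mulr_ge0 ?cmod_ge0// ltW.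
have gtri : triint g (a, b, c) = 0.
  rewrite /triint /= !(@segint_ftc g P) //.
  by module_over R[i]; ring.
have close w : D w -> cmod (w - a) <= p -> rnorm (f w - g w) <= e * p.
  move=> Dw wa; have wz : cmod (w - z) <= 3 * p.
    by rewrite -(subrKA a) (le_trans (cmodD _ _))//; lra.
  rewrite /g opprD addrA; apply: le_trans (hd_ w Dw _) _; first by lra.
  by have := cmod_ge0 (w - z); nra.
have c1 := cmod_ge0 (b - a); have c2 := cmod_ge0 (c - b); have c3 := cmod_ge0 (a - c).
have hab w : segm a b w -> rnorm (f w - g w) <= e * p.
  move=> hw; apply: close; first exact: cD hw.
  by rewrite (le_trans (segm_cmod hw))// /p /perim /=; lra.
have hbc w : segm b c w -> rnorm (f w - g w) <= e * p.
  move=> hw; apply: close; first exact: cD hw.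
  rewrite -(subrKA b) (le_trans (cmodD _ _))//; have := segm_cmod hw.
  by rewrite /p /perim /=; lra.
have hca w : segm c a w -> rnorm (f w - g w) <= e * p.
  move=> hw; apply: close; first exact: cD hw.
  have := segm_cmod (segm_rev hw).
  by rewrite [cmod (c - a)]cmodB /p /perim /=; lra.
have K x y : D x -> D y -> (forall w, segm x y w -> rnorm (f w - g w) <= e * p) ->
    rnorm (segint f x y - segint g x y) <= e * p * cmod (y - x).
  move=> Dx Dy H; rewrite -scaleN1r -segint_lin//; last exact: sc.
  apply: segint_bound => [|w /H]; last by rewrite scaleN1r.
  by move=> w hw; apply: cont_in_lin; [exact: sc|exact: gc].
move: h0; rewrite ltNge => /negP; apply.
have -> : triint f (a, b, c) = (segint f a b - segint g a b) + (segint f b c - segint g b c) +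
    (segint f c a - segint g c a).
  by rewrite -[LHS]subr0 -gtri /triint /=; module_over R[i]; ring.
have -> : e * p ^+ 2 = e * p * cmod (b - a) + e * p * cmod (c - b) + e * p * cmod (a - c).
  by rewrite /p /perim /=; ring.
by do 2 rewrite (le_trans (rnormD _ _))// lerD ?K//.
Qed.

Lemma goursat a b c : D a -> D b -> D c -> segint f a b + segint f b c + segint f c a = 0.
Proof.
move=> Da Db Dc; have Ds : inD (a, b, c) by [].
apply: rnorm_small => e e0; set p := perim (a, b, c) ^+ 2.
have p0 : 0 <= p by rewrite exprn_ge0// perim_ge0.
have p1 : 0 < p + 1 by rewrite ltr_wpDl.
apply: le_trans (triint_small Ds (divr_gt0 e0 p1)) _.
by rewrite small_mul// ltW.
Qed.

(** By Goursat's theorem the increment of [segint f a] from z to w is the integral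
of [f] over the segment from z to w. *)
Lemma segint_primitive a z : D a -> D z -> deriv_in D (segint f a) z (f z).
Proof.
move=> Da Dz e e0; have [B hB] := hf Dz.
have [d d0 h] := deriv_in_cont hB e0; exists d => // w Dw wz.
have -> : segint f a w - segint f a z = segint f z w.
  have := goursat Da Dz Dw; rewrite (segint_rev (sc Da Dw)) => /eqP.
  by rewrite subr_eq0 => /eqP <-; rewrite addrC addKr.
apply: segint_near => [|u hu]; first exact: sc.
apply: h; first exact: cD hu.
exact: le_lt_trans (segm_cmod hu) wz.
Qed.

End Goursat.
End SegmentIntegral.

(** * Second order expansions *)

Section Taylor.
Variables (R : realType).
Local Notation C := (R[i]).
Variable V : normedModType R[i].
Implicit Types (f g : C -> V).

Lemma deriv_in_local (D E : set C) f g z B (r : R) : 0 < r ->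
  (forall w, E w -> cmod (w - z) < r -> D w /\ g w = f w) -> E z ->
  deriv_in D f z B -> deriv_in E g z B.
Proof.
move=> r0 H Ez h e /h[d d0 hd_].
have [_ gz] : D z /\ g z = f z by apply: H => //; rewrite subrr cmod0.
exists (Num.min d r); first by rewrite lt_min d0.
move=> w Ew; rewrite lt_min => /andP[wd wr].
by have [Dw ->] := H w Ew wr; rewrite gz; exact: hd_.
Qed.

Lemma deriv_in_uniq f z A B : deriv_in setT f z A -> deriv_in setT f z B -> A = B.
Proof.
move=> hA hB; apply/subr0_eq/rnorm_small => e e0.
have e2 : 0 < e / 2 by rewrite divr_gt0.
have [d d0 h] := hA _ e2; have [d' d'0 h'] := hB _ e2.
pose m := Num.min d d' / 2; pose w : C := z + m%:C.
have m0 : 0 < m by rewrite divr_gt0// lt_min d0.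
have md : m < d by rewrite /m ltr_pdivrMr// gt_min ltr_pMr// ltr1n.
have md' : m < d' by rewrite /m ltr_pdivrMr// gt_min ltr_pMr// ltr1n orbT.
have wz : w - z = m%:C by rewrite /w addrC addKr.
have cwz : cmod (w - z) = m by rewrite wz cmodR gtr0_norm.
have k1 := h w I ltac:(rewrite cwz//); have k2 := h' w I ltac:(rewrite cwz//).
have : rnorm ((w - z) *: (A - B)) <= e * m.
  have -> : (w - z) *: (A - B) = (f w - f z - (w - z) *: B) - (f w - f z - (w - z) *: A).
    by module; ring.
  rewrite (le_trans (rnormB _ _))//; move: k1 k2; rewrite cwz; lra.
by rewrite rnormZ cwz mulrC ler_pM2r.
Qed.

(** The mean value inequality applied to G minus the quadratic term, whose
derivative is within e |w - z| of f(z). *)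
Lemma taylor2 (D : set C) f G z B : convex_in D -> D z ->
  (forall w, D w -> deriv_in D G w (f w)) -> deriv_in D f z B ->
  forall e : R, 0 < e -> exists2 d : R, 0 < d & forall u, D u -> cmod (u - z) < d ->
    rnorm (G u - G z - (u - z) *: f z - ((u - z) ^+ 2 / 2) *: B) <= e * cmod (u - z) ^+ 2.
Proof.
move=> cD Dz HG Hf e e0; have [d d0 hd_] := Hf e e0; exists d => // u Du uz.
pose Q (w : C) := ((w - z) ^+ 2 / 2) *: B.
have hQ E w : deriv_in E Q w ((w - z) *: B) by exact: deriv_in_square.
have -> : G u - G z - (u - z) *: f z - ((u - z) ^+ 2 / 2) *: B =
   (G u - Q u) - (G z - Q z) - (u - z) *: f z.
  by rewrite /Q subrr expr0n /= mul0r; module; ring.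
rewrite expr2 mulrA.
apply: (mean_value_lin (f := fun w => G w - Q w)) => w hw.
have Dw : D w by exact: cD hw.
exists (f w - (w - z) *: B).
  by apply: deriv_inB => //; apply: (deriv_in_sub (cD _ _ Dz Du)); exact: HG.
rewrite addrAC; apply: le_trans (hd_ w Dw _) _.
  exact: le_lt_trans (segm_cmod hw) uz.
by rewrite ler_wpM2l ?(ltW e0)//; exact: segm_cmod.
Qed.

End Taylor.

Section InvPowers.
Variable R : realType.
Local Notation C := (R[i]).

Lemma cmodX (z : C) n : cmod (z ^+ n) = cmod z ^+ n.
Proof. by elim: n => [|n IH]; rewrite ?expr0 ?cmod1// !exprS cmodM IH. Qed.

Lemma cmod_nat n : cmod (n%:R : C) = n%:R.
Proof. by rewrite -(rmorph_nat (real_complex R)) cmodR ger0_norm. Qed.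

(** For a = 1 / (w - z) and b = 1 / (w - z'), with h = z' - z, this is the first
order expansion of (w - z)^-n in z.  The constant depends only on a bound for [a]
and [b], hence is uniform in w on a contour that keeps away from z and z'. *)
Lemma inv_pow_taylor (L : R) n : exists2 M : R, 0 <= M & forall a b h : C,
  cmod a <= L -> cmod b <= L -> b - a = h * a * b ->
  cmod (b ^+ n - a ^+ n - n%:R * h * a ^+ n.+1) <= M * cmod h ^+ 2.
Proof.
elim: n => [|n [M M0 IH]].
  exists 0 => // a b h _ _ _.
  by rewrite !expr0 subrr !mul0r subr0 cmod0.
pose L' := `|L|.
exists (L' * M + n.+1%:R * L' ^+ n.+3).
  by rewrite addr_ge0// mulr_ge0 ?exprn_ge0// ?ler0n// normr_ge0.
move=> a b h aL bL ab.
have aL' : cmod a <= L' by rewrite (le_trans aL)// ler_norm.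
have bL' : cmod b <= L' by rewrite (le_trans bL)// ler_norm.
have -> : b ^+ n.+1 - a ^+ n.+1 - n.+1%:R * h * a ^+ n.+2 =
  b * (b ^+ n - a ^+ n - n%:R * h * a ^+ n.+1) + n.+1%:R * (h * a ^+ n.+1 * (b - a)).
  rewrite -natr1 !exprS; move: (a ^+ n) (b ^+ n) (n%:R) => x y k.
  apply/eqP; rewrite -subr_eq0; apply/eqP.
  transitivity (x * ((b - a) - h * a * b)); first by ring.
  by rewrite ab subrr mulr0.
rewrite ab (le_trans (cmodD _ _))// mulrDl lerD//.
  by rewrite cmodM -[leRHS]mulrA ler_pM ?cmod_ge0//; exact: IH.
have -> : n.+1%:R * (h * a ^+ n.+1 * (h * a * b)) = n.+1%:R * (a ^+ n.+2 * b) * h ^+ 2.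
  by rewrite !exprS; ring.
rewrite cmodM cmodX ler_wpM2r ?exprn_ge0 ?cmod_ge0// cmodM cmod_nat ler_wpM2l//.
rewrite cmodM cmodX [leRHS]exprSr ler_pM ?exprn_ge0 ?cmod_ge0//.
by rewrite lerXn2r ?nnegrE ?cmod_ge0 // normr_ge0.
Qed.
End InvPowers.

(** * Integrals with scalar kernels over a square *)

Section IntegralMore.
Variable R : realType.
Local Notation C := (R[i]).
Variable V : completeNormedModType R[i].
Implicit Types (f g : C -> V) (k : C -> cplx R).

Lemma midsum_eq f g a b n : (forall w, segm a b w -> f w = g w) -> midsum n f a b = midsum n g a b.
Proof.
elim: n a b => [|n IH] a b H /=; first by rewrite H//; exact: mid_segm.
by congr (_ + _); apply: IH => w hw; apply: H; apply: segm_convex hw;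
  by [exact: segm_l|exact: mid_segm|exact: segm_r].
Qed.

Lemma segint_eq f g a b : (forall w, segm a b w -> f w = g w) -> segint f a b = segint g a b.
Proof.
move=> H; rewrite /segint; congr (xget _ _); apply/seteqP.
by split => v /=; apply: rcvg_ext => n; rewrite (midsum_eq n H).
Qed.

Lemma rcvgZr (u : nat -> cplx R) (l : cplx R) (c : V) :
  rcvg u l -> rcvg (fun n => (u n : C) *: c) ((l : C) *: c).
Proof.
move=> h e e0; have c1 : 0 < rnorm c + 1 by rewrite ltr_wpDl ?rnorm_ge0.
have [|N hN] := h (e / (rnorm c + 1)); first by rewrite divr_gt0.
exists N => n /hN hn; rewrite -scalerBl rnormZ.
apply: le_trans (ler_wpM2r (rnorm_ge0 _) hn) _.
by rewrite small_mul ?rnorm_ge0// ltW.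
Qed.

Lemma cont_inM D k f z : cont_in D k z -> cont_in D f z -> cont_in D (fun w => (k w : C) *: f w) z.
Proof.
move=> hk hf e e0; have e3 : 0 < e / 3 by rewrite divr_gt0.
have k1 : 0 < cmod (k z) + 1 by rewrite ltr_wpDl ?cmod_ge0.
have f1 : 0 < rnorm (f z) + 1 by rewrite ltr_wpDl ?rnorm_ge0.
have [|d1 d10 h1] := hf (e / 3 / (cmod (k z) + 1)); first by rewrite divr_gt0.
have [|d2 d20 h2] := hk (e / 3 / (rnorm (f z) + 1)); first by rewrite divr_gt0.
have [d3 d30 h3] := hf _ e3.
have [d4 d40 h4] := hk _ ltr01.
exists (Num.min (Num.min d1 d2) (Num.min d3 d4)); first by rewrite !lt_min d10 d20 d30.
move=> w Dw; rewrite !lt_min => /andP[/andP[w1 w2] /andP[w3 w4]].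
have {}h1 := h1 w Dw w1; have {}h3 := h3 w Dw w3.
have {}h2 : cmod ((k w : C) - k z) <= _ := h2 w Dw w2.
have {}h4 : cmod ((k w : C) - k z) <= _ := h4 w Dw w4.
have -> : (k w : C) *: f w - (k z : C) *: f z = (k z : C) *: (f w - f z) +
  ((k w : C) - k z) *: f z + ((k w : C) - k z) *: (f w - f z) by module; ring.
have -> : e = e / 3 + e / 3 + e / 3 by field.
rewrite (le_trans (rnormD _ _))// lerD//; last first.
  rewrite rnormZ; apply: le_trans (ler_pM (cmod_ge0 _) (rnorm_ge0 _) h4 h3) _.
  by rewrite mul1r.
rewrite (le_trans (rnormD _ _))// lerD// rnormZ.
  apply: le_trans (ler_wpM2l (cmod_ge0 _) h1) _.
  by rewrite mulrC small_mul ?cmod_ge0// ltW.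
apply: le_trans (ler_wpM2r (rnorm_ge0 _) h2) _.
by rewrite small_mul ?rnorm_ge0// ltW.
Qed.

Lemma cont_in_cst D (c : V) z : cont_in D (fun=> c) z.
Proof. by move=> e e0; exists 1 => // w _ _; rewrite subrr rnorm0 ltW. Qed.

Lemma midsum_scal k (c : V) a b n :
  midsum n (fun w => (k w : C) *: c) a b = (midsum n k a b : C) *: c.
Proof.
elim: n a b => [|n IH] a b /=; last by rewrite !IH -scalerDl.
by rewrite scalerA.
Qed.

Lemma segint_scal k (c : V) a b : cont_segm k a b ->
  segint (fun w => (k w : C) *: c) a b = (segint k a b : C) *: c.
Proof.
move=> H; apply: segint_uniq.
  by move=> z hz; apply: cont_inM (cont_in_cst _ _ _); exact: H.
apply: (rcvg_ext (u := fun n => (midsum n k a b : C) *: c)).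
  by move=> n; rewrite midsum_scal.
exact/rcvgZr/segint_cvg.
Qed.

Lemma cont_segm_bounded f a b : cont_segm f a b -> exists2 M : R, 0 <= M &
  forall w, segm a b w -> rnorm (f w) <= M.
Proof.
move=> H; pose g t := a + t%:C * (b - a).
have [d d0 hd_] := cont_in_unif H ltr01.
pose Q s t := exists2 M : R, 0 <= M & forall x, s <= x <= t -> 0 <= x <= 1 -> rnorm (f (g x)) <= M.
suff [M M0 hM] : Q 0 1 by exists M => // w [t t01 ->]; exact: hM.
have L1 : 0 < cmod (b - a) + 1 by rewrite ltr_wpDl ?cmod_ge0.
apply: cousin => //.
  move=> s m t _ _ _ _ [M1 M10 h1] [M2 M20 h2]; exists (M1 + M2); first exact: addr_ge0.
  move=> x /andP[sx xt] x01; have [xm|mx] := leP x m.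
    by rewrite (le_trans (h1 _ _ x01)) ?lerDl// sx.
  by rewrite (le_trans (h2 _ _ x01)) ?lerDr// xt ltW.
move=> x x01; exists (d / (cmod (b - a) + 1)); first by rewrite divr_gt0.
move=> s t /andP[sx xt] ts s0 t1; exists (rnorm (f (g x)) + 1).
  by rewrite addr_ge0 ?rnorm_ge0.
move=> y /andP[sy yt] y01.
have -> : f (g y) = f (g x) + (f (g y) - f (g x)) by rewrite addrC subrK.
rewrite (le_trans (rnormD _ _))// lerD2l; apply: hd_; [by exists y|by exists x|].
have -> : g y - g x = (y - x)%:C * (b - a) by rewrite /g rmorphB /=; ring.
rewrite cmodM cmodR; move: ts; rewrite ltr_pdivlMr// => ts; apply: le_lt_trans ts.
apply: le_trans (_ : (t - s) * cmod (b - a) <= _).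
  by rewrite ler_wpM2r ?cmod_ge0// ler_norml; lra.
by rewrite ler_wpM2l ?lerDl// subr_ge0; lra.
Qed.

End IntegralMore.

Section Square.
Variable R : realType.
Local Notation C := (R[i]).
Variables (z0 : C) (r : R).
Hypothesis r0 : 0 < r.

(** The vertices of the contour of Cauchy's formula: two triangles fill the square,
and multiplication by 'i permutes its sides. *)
Definition vertex (k : nat) : C := z0 + r%:C * 'i ^+ k.

Lemma vertex_cmod k : cmod (vertex k - z0) = r.
Proof.
by rewrite /vertex addrC addKr cmodM cmodX cmodi expr1n mulr1 cmodR gtr0_norm.
Qed.

Lemma vertex4 : vertex 4 = vertex 0.
Proof. by rewrite /vertex expr0 -[4%N]/(2 * 2)%N exprM sqr_i sqrrN expr1n. Qed.

Lemma cmod_diag (t : R) : 0 <= t <= 1 -> 1 / 2 <= cmod (1 + t%:C * ('i - 1)) <= 1.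
Proof.
move=> /andP[t0 t1].
have E : cmod (1 + t%:C * ('i - 1)) ^+ 2 = (1 - t) ^+ 2 + t ^+ 2.
  by rewrite cmod_sqr /=; congr (_ ^+ 2 + _ ^+ 2); ring.
have c0 := cmod_ge0 (1 + t%:C * ('i - 1)).
have s0 := sqr_ge0 (t - 2^-1).
apply/andP; split; rewrite -(@ler_pXn2r _ 2) ?nnegrE// ?E ?divr_ge0//.
  by move: s0; lra.
by rewrite expr1n; nra.
Qed.

Lemma side_pt k w : segm (vertex k) (vertex k.+1) w ->
  exists2 t : R, 0 <= t <= 1 & w - z0 = r%:C * 'i ^+ k * (1 + t%:C * ('i - 1)).
Proof.
move=> [t t01 ->]; exists t => //; rewrite /vertex exprS; ring.
Qed.

Lemma cmod_ipow k : cmod ('i ^+ k : C) = 1.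
Proof. by rewrite cmodX cmodi expr1n. Qed.

Lemma side_cmod k w : segm (vertex k) (vertex k.+1) w -> r / 2 <= cmod (w - z0) <= r.
Proof.
move=> /side_pt[t /cmod_diag/andP[t1 t2] ->].
rewrite !cmodM cmod_ipow mulr1 cmodR gtr0_norm//.
have := ler_wpM2l (ltW r0) t1; have := ler_wpM2l (ltW r0) t2.
by move=> h1 h2; apply/andP; split; lra.
Qed.

Lemma side_len k : cmod (vertex k.+1 - vertex k) <= 2 * r.
Proof.
have -> : vertex k.+1 - vertex k = r%:C * 'i ^+ k * ('i - 1) by rewrite /vertex exprS; ring.
rewrite !cmodM cmod_ipow mulr1 cmodR gtr0_norm// mulrC ler_wpM2r ?(ltW r0)//.
by rewrite (le_trans (cmodD _ _))// cmodN cmodi cmod1.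
Qed.

Lemma side_far k w z : segm (vertex k) (vertex k.+1) w -> cmod (z - z0) < r / 4 ->
  r / 4 <= cmod (w - z).
Proof.
move=> /side_cmod/andP[h _] zz.
have : cmod (w - z0) <= cmod (w - z) + cmod (z - z0).
  by rewrite -(subrKA z) cmodD.
lra.
Qed.

Lemma far_neq w z : r / 4 <= cmod (w - z) -> w - z != 0.
Proof. by move=> h; rewrite -cmod_gt0 (lt_le_trans _ h)// divr_gt0. Qed.

Lemma deriv_in_invB D (z w : C) : w - z != 0 ->
  deriv_in D (fun u => (u - z)^-1 : cplx R) w (- ((w - z)^-1 * (w - z)^-1)).
Proof.
move=> wz.
have := @deriv_in_affine R (cplx R) setT D (fun u => u^-1 : cplx R) (- z) 1 w (- ((w - z)^-1 * (w - z)^-1)).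
rewrite (_ : - z + 1 * w = w - z); last by ring.
rewrite (_ : (fun u => (- z + 1 * u)^-1 : cplx R) = (fun u => (u - z)^-1 : cplx R)); last first.
  by apply/funext => u; congr (_^-1 : C); ring.
by rewrite scale1r => H; apply: H => //; exact: deriv_in_inv.
Qed.

Section Kernel.
Variable V : completeNormedModType R[i].
Variable G : C -> V.
Hypothesis Gc : forall k, cont_segm G (vertex k) (vertex k.+1).

Definition ckernel (n : nat) (z : C) : C -> V := fun w => (w - z)^-1 ^+ n *: G w.

Lemma ckernel_cont n z k : cmod (z - z0) < r / 4 -> cont_segm (ckernel n z) (vertex k) (vertex k.+1).
Proof.
move=> zz w hw; apply: (@cont_inM _ _ _ (fun w => (w - z)^-1 ^+ n)); last exact: Gc.
have wz := far_neq (side_far hw zz).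
elim: n => [|n IH].
  rewrite (_ : (fun w => (w - z)^-1 ^+ 0 : cplx R) = (fun=> 1 : cplx R)); last first.
    by apply/funext => u; rewrite expr0.
  exact: cont_in_cst.
rewrite (_ : (fun w => (w - z)^-1 ^+ n.+1 : cplx R) =
  (fun w => ((w - z)^-1 : C) *: ((w - z)^-1 ^+ n : cplx R))); last first.
  by apply/funext => u; rewrite exprS.
exact: cont_inM (deriv_in_cont (deriv_in_invB _ wz)) IH.
Qed.

Definition contour_int (n : nat) (z : C) : V :=
  \sum_(k < 4) segint (ckernel n z) (vertex k) (vertex k.+1).

(** Differentiation under the integral, by the expansion [inv_pow_taylor], which is
uniform along the contour. *)
Lemma contour_int_deriv n z : cmod (z - z0) < r / 4 -> deriv_in setT (contour_int n) z (n%:R *: contour_int n.+1 z).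
Proof.
move=> zz.
have /choice[M hM] : forall k, exists M : R, 0 <= M /\
    forall w, segm (vertex k) (vertex k.+1) w -> rnorm (G w) <= M.
  by move=> k; have [M M0 H] := cont_segm_bounded (Gc (k := k)); exists M.
pose M' := \sum_(k < 4) M k.
have [A A0 hA] := inv_pow_taylor (4 / r) n.
pose B := A * M' * (2 * r).
have M'0 : 0 <= M' by rewrite sumr_ge0// => k _; case: (hM k).
have B0 : 0 <= B by rewrite !mulr_ge0// ltW.
move=> e e0.
exists (Num.min (r / 4 - cmod (z - z0)) (e / (B + 1))).
  by rewrite lt_min subr_gt0 zz divr_gt0// ltr_wpDl.
move=> w _; rewrite lt_min => /andP[wz we].
have wz0 : cmod (w - z0) < r / 4.
  have : cmod (w - z0) <= cmod (w - z) + cmod (z - z0) by rewrite -(subrKA z) cmodD.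
  lra.
have c0 := cmod_ge0 (w - z).
suff : rnorm (contour_int n w - contour_int n z - (w - z) *: (n%:R *: contour_int n.+1 z)) <= B * cmod (w - z) ^+ 2.
  move=> /le_trans; apply; rewrite expr2 mulrA ler_wpM2r// mulrC.
  apply: le_trans (ler_wpM2r B0 (ltW we)) _.
  by rewrite small_mul// ltW.
rewrite scalerA /contour_int scaler_sumr -!sumrB (le_trans (rnorm_sum _ _ _))//.
rewrite /B /M' mulr_sumr !mulr_suml ler_sum// => k _.
have [Mk0 hMk] := hM k.
set c := (w - z) * n%:R.
have cw := ckernel_cont n (k := k) wz0; have cz := ckernel_cont n (k := k) zz.
have cz' := ckernel_cont n.+1 (k := k) zz.
have -> : segint (ckernel n w) (vertex k) (vertex k.+1) - segint (ckernel n z) (vertex k) (vertex k.+1) -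
   c *: segint (ckernel n.+1 z) (vertex k) (vertex k.+1) =
  segint (fun u => ckernel n w u + (-1) *: ckernel n z u + (- c) *: ckernel n.+1 z u) (vertex k) (vertex k.+1).
  rewrite segint_lin//; last by move=> u hu; apply: cont_in_lin; [exact: cw|exact: cz].
  by rewrite segint_lin// scaleN1r scaleNr.
have bnd u : segm (vertex k) (vertex k.+1) u ->
   rnorm (ckernel n w u + (-1) *: ckernel n z u + (- c) *: ckernel n.+1 z u) <= A * M k * cmod (w - z) ^+ 2.
  move=> hu; have fw := side_far hu wz0; have fz := side_far hu zz.
  have nw := far_neq fw; have nz := far_neq fz.
  have -> : ckernel n w u + (-1) *: ckernel n z u + (- c) *: ckernel n.+1 z u =
    ((u - w)^-1 ^+ n - (u - z)^-1 ^+ n - n%:R * (w - z) * (u - z)^-1 ^+ n.+1) *: G u.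
    by rewrite /ckernel /c; module; ring.
  have inv_le x : r / 4 <= cmod (u - x) -> cmod (u - x)^-1 <= 4 / r.
    move=> h; rewrite cmodV -[4 / r]invrK lef_pV2 ?posrE ?invf_div//.
    + by rewrite (lt_le_trans _ h)// divr_gt0.
    + by rewrite divr_gt0.
  rewrite rnormZ [leRHS]mulrAC ler_pM ?cmod_ge0 ?rnorm_ge0//; last exact: hMk.
  apply: hA; [exact: inv_le|exact: inv_le|].
  by field; rewrite nw nz.
apply: le_trans (segint_bound _ bnd) _.
  by move=> u hu; apply: cont_in_lin; [apply: cont_in_lin; [exact: cw|exact: cz]|exact: cz'].
rewrite [leLHS]mulrAC; apply: ler_wpM2r; first exact: exprn_ge0.
by apply: ler_wpM2l; [exact: mulr_ge0|exact: side_len].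
Qed.

End Kernel.
End Square.

(** * The winding number of the square *)

Section Winding.
Variable R : realType.
Local Notation C := (R[i]).
Variables (z0 : C) (r : R).
Hypothesis r0 : 0 < r.

Let one : C -> cplx R := fun=> 1.
Let one_scont a b : cont_segm one a b.
Proof. by move=> z _; exact: cont_in_cst. Qed.

Let oneS := fun k : nat => @one_scont (vertex z0 r k) (vertex z0 r k.+1).

(** 2 i pi times the winding number.  Near the centre it is a nonzero constant, which
is how Cauchy's formula determines the function. *)
Definition winding (z : C) : cplx R := contour_int z0 r one 1 z.

(** (w - z)^-2 has a primitive along the closed contour. *)
Let contour_int2 z : cmod (z - z0) < r / 4 -> contour_int z0 r one 2 z = 0.
Proof.
move=> zz; pose P (w : C) : cplx R := - (w - z)^-1.
have E (k : nat) : segint (ckernel one 2 z) (vertex z0 r k) (vertex z0 r k.+1) =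
    P (vertex z0 r k.+1) - P (vertex z0 r k).
  apply: segint_ftc; first exact: ckernel_cont oneS _ _ _ zz.
  move=> w hw; have wz := far_neq r0 (side_far r0 hw zz).
  have -> : ckernel one 2 z w = - - ((w - z)^-1 * (w - z)^-1) :> cplx R.
    by rewrite opprK /ckernel /one -[_ *: _]/(_ * (1 : C)) mulr1.
  exact: deriv_inN (deriv_in_invB _ wz).
transitivity (\sum_(k < 4) (P (vertex z0 r k.+1) - P (vertex z0 r k))).
  by apply: eq_bigr => k _; rewrite E.
rewrite -(big_mkord xpredT (fun k => P (vertex z0 r k.+1) - P (vertex z0 r k))).
by rewrite telescope_sumr// vertex4 subrr.
Qed.

Lemma winding_const z : cmod (z - z0) < r / 4 -> winding z = winding z0.
Proof.
move=> zz; apply/subr0_eq/eqP; rewrite -rnorm_eq0 eq_le rnorm_ge0 andbT.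
rewrite -[leRHS](mul0r (cmod (z - z0))); apply: mean_value => w /segm_cmod hw.
have ww : cmod (w - z0) < r / 4 by exact: le_lt_trans hw zz.
exists 0; last by rewrite rnorm0.
apply: (deriv_in_sub (D := setT)) => //.
have := contour_int_deriv r0 oneS 1 ww; rewrite contour_int2//.
by rewrite scaler0.
Qed.

Let inv (w : C) : cplx R := w^-1.

(** An affine map takes each side to the segment from 1 to 'i and dw / (w - z0) to
dw / w. *)
Let midsum_inv_side k n :
  midsum n (ckernel one 1 z0) (vertex z0 r k) (vertex z0 r k.+1) = midsum n inv 1 'i.
Proof.
pose q : C := r%:C * 'i ^+ k.
have q0 : q != 0 by rewrite -cmod_gt0 /q cmodM cmod_ipow mulr1 cmodR normr_gt0 gt_eqF.
have -> : vertex z0 r k = z0 + q * 1 by rewrite /vertex /q mulr1.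
have -> : vertex z0 r k.+1 = z0 + q * 'i by rewrite /vertex /q exprS; ring.
suff H a b : midsum n (ckernel one 1 z0) (z0 + q * a) (z0 + q * b) = midsum n inv a b.
  exact: H.
elim: n a b => [|n IH] a b /=.
  have -> : z0 + q * b - (z0 + q * a) = q * (b - a) by ring.
  have -> : mid (z0 + q * a) (z0 + q * b) = z0 + q * mid a b by rewrite /mid; field.
  have -> : ckernel one 1 z0 (z0 + q * mid a b) = (q^-1 : C) *: inv (mid a b).
    rewrite /ckernel /one /inv -![_ *: _]/((_ : C) * (_ : C)) mulr1 expr1.
    by rewrite [z0 + _]addrC addrK invfM.
  by rewrite scalerA mulrAC mulfV// mul1r.
have -> : mid (z0 + q * a) (z0 + q * b) = z0 + q * mid a b by rewrite /mid; field.
by rewrite !IH.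
Qed.

Let ei (t : R) : C := 1 + t%:C * ('i - 1).

(** The argument increases along the segment from 1 to 'i. *)
Let ei_inv (s t u : R) : s <= t -> 0 <= u <= 1 ->
  t - s <= Im ((ei t - ei s) * (ei u)^-1).
Proof.
move=> st u01; have /andP[h1 h2] := cmod_diag u01.
have e2 : cmod (ei u) ^+ 2 <= 1 by rewrite expr_le1// cmod_ge0.
have e0 : 0 < cmod (ei u) ^+ 2 by rewrite exprn_gt0//; lra.
have -> : Im ((ei t - ei s) * (ei u)^-1) = (t - s) / cmod (ei u) ^+ 2.
  have E : (ei u)^-1 = (cmod (ei u) ^+ 2)^-1%:C * ((1 - u) -i* u).
    have n0 : ei u != 0 by rewrite -cmod_gt0; lra.
    apply: (mulfI n0); rewrite mulfV// mulrCA.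
    have -> : ei u * ((1 - u) -i* u) = (cmod (ei u) ^+ 2)%:C.
      rewrite cmod_sqr /ei; apply/eqP; rewrite eq_complex /=.
      by apply/andP; split; apply/eqP; ring.
    by rewrite -rmorphM /= mulVf ?gt_eqF.
  by rewrite E /ei /=; ring.
by rewrite ler_pdivlMr// -[leRHS]mulr1 ler_wpM2l// subr_ge0.
Qed.

Let midsum_inv_Im n (s t : R) : 0 <= s -> s <= t -> t <= 1 ->
  t - s <= Im (midsum n inv (ei s) (ei t) : C).
Proof.
have midE (a b : R) : mid (ei a) (ei b) = ei ((a + b) / 2).
  by rewrite /mid /ei rmorphM /= rmorphD /= fmorphV rmorph_nat; field.
elim: n s t => [|n IH] s t s0 st t1.
  by rewrite [midsum _ _ _ _]/= midE; apply: ei_inv => //; apply/andP; split; lra.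
have h1 := IH s ((s + t) / 2) ltac:(lra) ltac:(lra) ltac:(lra).
have h2 := IH ((s + t) / 2) t ltac:(lra) ltac:(lra) ltac:(lra).
rewrite [midsum _ _ _ _]/= midE.
change (t - s <= Im ((midsum n inv (ei s) (ei ((s + t) / 2)) : C) +
  midsum n inv (ei ((s + t) / 2)) (ei t))).
by rewrite ImD; apply: le_trans (lerD h1 h2); lra.
Qed.

(** All four sides contribute the same integral, whose imaginary part is positive. *)
Lemma winding_neq0 : (winding z0 : C) != 0.
Proof.
pose I0 : C := segint (ckernel one 1 z0) (vertex z0 r 0) (vertex z0 r 1).
have zz : cmod (z0 - z0) < r / 4 by rewrite subrr cmod0 divr_gt0.
have E k : segint (ckernel one 1 z0) (vertex z0 r k) (vertex z0 r k.+1) = I0.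
  rewrite /I0 /segint; congr (xget _ _); apply/seteqP.
  by split => v /=; apply: rcvg_ext => n; rewrite !midsum_inv_side.
have -> : (winding z0 : C) = I0 + I0 + I0 + I0.
  by rewrite /winding /contour_int !big_ord_recr big_ord0 /= !E add0r.
have sc := ckernel_cont r0 oneS 1 (k := 0%N) zz.
have [|N hN] := segint_cvg sc (e := 2^-1); first by rewrite invr_gt0.
have := hN N (leqnn N); rewrite midsum_inv_side => h.
have h1 : 1 - 0 <= Im (midsum N inv (ei 0) (ei 1) : C) by apply: midsum_inv_Im.
have ei0 : ei 0 = 1 by rewrite /ei rmorph0 mul0r addr0.
have ei1 : ei 1 = 'i by rewrite /ei rmorph1 mul1r addrC subrK.
rewrite ei0 ei1 in h1.
have := le_trans (le_cmod_Im ((midsum N inv 1 'i : C) - I0)) h.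
rewrite ImB ler_norml => /andP[h2 h3].
apply/eqP => /(congr1 (@Im R)); rewrite !ImD /=; lra.
Qed.

End Winding.

(** * Cauchy's formula and regularity *)

Section Cauchy.
Variable R : realType.
Local Notation C := (R[i]).
Variable V : completeNormedModType R[i].

Lemma deriv_in_open (D : set C) (f : C -> V) z B (d : R) : 0 < d ->
  (forall w, cmod (w - z) < d -> D w) -> deriv_in D f z B -> deriv_in setT f z B.
Proof.
move=> d0 H; apply: (@deriv_in_local _ _ _ _ _ _ _ _ d) => // w _ wd.
by split => //; exact: H.
Qed.

(** The difference quotient q of G at z is holomorphic on D.  At z itself this
follows from the second order expansion of G, which is available because G has
the holomorphic derivative f.  So Goursat's theorem applies to q on all of D, and
the integral of q over the square vanishes. *)
Lemma cauchy_formula (D : set C) (G f : C -> V) z0 (r : R) z :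
  convex_in D -> closed_in D -> 0 < r -> (forall w, cmod (w - z0) <= r -> D w) ->
  (forall w, D w -> deriv_in D G w (f w)) -> holo D f -> cmod (z - z0) < r / 4 ->
  contour_int z0 r G 1 z = (winding z0 r z : C) *: G z.
Proof.
move=> cD clD r0 BD hG hf zz.
have Dz : D z by apply: BD; lra.
have Dv k : D (vertex z0 r k).
  by apply: BD; rewrite vertex_cmod.
have Gc k : cont_segm G (vertex z0 r k) (vertex z0 r k.+1).
  by apply: (@holo_cont_segm _ _ D) => // w Dw; exists (f w); exact: hG.
pose q w := if w == z then f z else (w - z)^-1 *: (G w - G z).
have hq : holo D q.
  move=> w Dw; have [->|wz] := eqVneq w z.
    have [B hB] := hf z Dz.
    exists ((1 / 2 : C) *: B) => e e0.
    have [d d0 hd_] := taylor2 cD Dz hG hB e0.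
    exists d => // u Du uz; rewrite /q eqxx.
    have [->|nuz] := eqVneq u z.
      by rewrite !subrr scale0r subrr rnorm0 cmod0 mulr0.
    have nz : u - z != 0 by rewrite subr_eq0.
    have -> : (u - z)^-1 *: (G u - G z) - f z - (u - z) *: ((1 / 2 : C) *: B) =
      (u - z)^-1 *: (G u - G z - (u - z) *: f z - ((u - z) ^+ 2 / 2) *: B).
      by module; field; rewrite nz.
    rewrite rnormZ cmodV ler_pdivrMl ?cmod_gt0//.
    by rewrite mulrCA -expr2; exact: hd_.
  have nz : w - z != 0 by rewrite subr_eq0.
  have [B hB] : exists B, deriv_in D (fun u => ((u - z)^-1 : cplx R) *: (G u - G z)) w B.
    eexists; apply: deriv_inM; first exact: deriv_in_invB.
    by apply: deriv_inB (deriv_in_cst _ _ _); exact: hG.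
  exists B; apply: (@deriv_in_local _ _ D D _ _ _ _ (cmod (w - z))) hB => //.
    by rewrite cmod_gt0.
  move=> u Du; rewrite cmodB => uw; split => //; rewrite /q.
  by case: eqP uw => // ->; rewrite ltxx.
have qc a b : D a -> D b -> cont_segm q a b by move=> Da Db; exact: holo_cont_segm hq.
have H0 : \sum_(k < 4) segint q (vertex z0 r k) (vertex z0 r k.+1) = 0.
  (* the diagonal from vertex 0 to vertex 2 cuts the square into two triangles *)
  have h1 := goursat cD clD hq (Dv 0%N) (Dv 1%N) (Dv 2%N).
  have h2 := goursat cD clD hq (Dv 0%N) (Dv 2%N) (Dv 3%N).
  rewrite !big_ord_recr big_ord0 /= add0r vertex4.
  rewrite (segint_rev (qc _ _ (Dv 0%N) (Dv 2%N))) in h1.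
  rewrite -[RHS]addr0 -[X in _ = X + _]h1 -[X in _ = _ + X]h2.
  by module_over R[i]; ring.
have kc := ckernel_cont r0 Gc 1 zz.
pose one : C -> cplx R := fun=> 1.
have onec k : cont_segm one (vertex z0 r k) (vertex z0 r k.+1) by move=> w _; exact: cont_in_cst.
have oc := ckernel_cont r0 onec 1 zz.
apply/subr0_eq; rewrite -H0 /winding /contour_int.
have -> : ((\sum_(k < 4) segint (ckernel one 1 z) (vertex z0 r k) (vertex z0 r k.+1) : cplx R) : C) *: G z =
  \sum_(k < 4) segint (fun w => (ckernel one 1 z w : C) *: G z) (vertex z0 r k) (vertex z0 r k.+1).
  rewrite scaler_suml; apply: eq_bigr => k _; rewrite segint_scal//; exact: oc.
rewrite -sumrB; apply: eq_bigr => k _.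
rewrite -[X in _ - X]scale1r -scaleNr -segint_lin//; last first.
  by move=> w hw; apply: cont_inM (cont_in_cst _ _ _); exact: oc.
apply: segint_eq => w hw.
have wz := far_neq r0 (side_far r0 hw zz).
rewrite /q ifN; last by rewrite -subr_eq0.
rewrite /ckernel /one -[_ *: (1 : cplx R)]/((_ : C) * 1) mulr1.
by module; ring.
Qed.

Definition strip (x1 x2 : R) : set C := [set z | x1 <= Re z <= x2].
Lemma strip_convex x1 x2 : convex_in (strip x1 x2).
Proof.
move=> a b /andP[a1 a2] /andP[b1 b2] _ [t /andP[t0 t1] ->].
have -> : a + t%:C * (b - a) = (1 - t)%:C * a + t%:C * b by rewrite rmorphB /=; ring.
rewrite /strip /= ReD.
have E (s : R) (w : C) : Re (s%:C * w) = s * Re w.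
  by case: w => u v /=; rewrite mul0r subr0.
by rewrite !E; apply/andP; split; nra.
Qed.

Lemma strip_closed x1 x2 : closed_in (strip x1 x2).
Proof.
move=> z H; have K (e : R) : 0 < e -> x1 <= Re z + e /\ Re z <= x2 + e.
  move=> /H[w /andP[w1 w2] wz]; have := le_trans (le_cmod_Re (w - z)) (ltW wz).
  by rewrite ReB ler_norml; lra.
by apply/andP; split; apply/ler_addgt0Pr => e /K[]; lra.
Qed.

Lemma open_stripP z : open_strip z -> exists2 d : R, 0 < d &
  [/\ forall w, cmod (w - z) <= d -> strip (Re z - d) (Re z + d) w &
   strip (Re z - d) (Re z + d) `<=` (@open_strip R)].
Proof.
move=> /andP[z0 z1]; pose d := Num.min (Re z) (1 - Re z) / 2.
have m0 : 0 < Num.min (Re z) (1 - Re z) by rewrite lt_min z0 subr_gt0.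
have dx : 2 * d <= Re z by rewrite /d mulrC divfK// ge_min lexx.
have dy : 2 * d <= 1 - Re z by rewrite /d mulrC divfK// ge_min lexx orbT.
have d0 : 0 < d by rewrite divr_gt0.
exists d => //; split.
  move=> w wz; have := le_trans (le_cmod_Re (w - z)) wz.
  by rewrite ReB ler_norml /strip /= => ?; apply/andP; split; lra.
by move=> w /andP[w1 w2]; apply/andP; split; lra.
Qed.

Lemma open_closed_strip : @open_strip R `<=` @closed_strip R.
Proof. by move=> z /andP[/ltW z0 /ltW z1]; apply/andP. Qed.

Lemma open_strip_open z : open_strip z -> exists2 d : R, 0 < d & forall w, cmod (w - z) < d -> open_strip w.
Proof.
by move=> /open_stripP[d d0 [h1 h2]]; exists d => // w /ltW /h1; exact: h2.
Qed.

(** Cauchy's formula for a primitive G of f near z0 expresses G by a kernel integral.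
By uniqueness of derivatives, f and f' are then kernel integrals too, and these
can be differentiated once more. *)
Lemma holo_derivative (f f' : C -> V) :
  (forall z, open_strip z -> deriv_in setT f z (f' z)) -> holo (@open_strip R) f'.
Proof.
move=> hf z0 Oz0; have [r r0 [BD DO]] := open_stripP Oz0.
set D := strip _ _ in BD DO.
have cD : convex_in D by exact: strip_convex.
have clD : closed_in D by exact: strip_closed.
have hfD : holo D f.
  by move=> w Dw; exists (f' w); apply: (@deriv_in_sub _ _ setT) => //; apply: hf; exact: DO.
have Dz0 : D z0 by apply: BD; rewrite subrr cmod0 ltW.
pose G := segint f z0.
have hG w : D w -> deriv_in D G w (f w) by move=> Dw; exact: segint_primitive.
pose K : C := winding z0 r z0.
have K0 : K != 0 by exact: winding_neq0.
have Gc k : cont_segm G (vertex z0 r k) (vertex z0 r k.+1).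
  apply: (@holo_cont_segm _ _ D) => //; try by apply: BD; rewrite vertex_cmod.
  by move=> w Dw; exists (f w); exact: hG.
pose H n z := K^-1 *: contour_int z0 r G n z.
have hH n z : cmod (z - z0) < r / 4 -> deriv_in setT (H n) z (n%:R *: H n.+1 z).
  move=> zz; rewrite /H scalerA mulrC -scalerA; apply: deriv_inZ.
  exact: contour_int_deriv.
have near z : cmod (z - z0) < r / 4 -> exists2 d : R, 0 < d &
    forall w, cmod (w - z) < d -> cmod (w - z0) < r / 4.
  move=> zz; exists (r / 4 - cmod (z - z0)); first by rewrite subr_gt0.
  move=> w wz; have : cmod (w - z0) <= cmod (w - z) + cmod (z - z0) by rewrite -(subrKA z) cmodD.
  by move: wz; lra.
have step (A B A' B' : C -> V) : (forall z, cmod (z - z0) < r / 4 -> A z = B z) ->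
    (forall z, cmod (z - z0) < r / 4 -> deriv_in setT A z (A' z)) ->
    (forall z, cmod (z - z0) < r / 4 -> deriv_in setT B z (B' z)) ->
    forall z, cmod (z - z0) < r / 4 -> A' z = B' z.
  move=> AB hA hB z zz; apply: deriv_in_uniq (hA z zz) _.
  have [d d0 hn] := near z zz.
  by apply: (@deriv_in_local _ _ setT setT B _ _ _ d) => // [w _ /hn/AB//|]; exact: hB.
have GH z : cmod (z - z0) < r / 4 -> G z = H 1%N z.
  move=> zz; rewrite /H (cauchy_formula cD clD r0 BD hG hfD zz).
  by rewrite winding_const// scalerA mulVf// scale1r.
have fH : forall z, cmod (z - z0) < r / 4 -> f z = 1%:R *: H 2 z.
  apply: (step _ _ _ _ GH) => [z zz|z zz]; last exact: hH.
  have [d d0 hn] := near z zz.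
  apply: (deriv_in_open d0 _ (hG z _)) => [w /hn ww|]; apply: BD; lra.
have f'H : forall z, cmod (z - z0) < r / 4 -> f' z = 2%:R *: H 3 z.
  apply: (step _ _ _ _ fH) => z zz.
    by apply: hf; apply: DO; apply: BD; lra.
  rewrite (_ : (fun z => 1%:R *: H 2 z) = H 2); last by apply/funext => w; rewrite scale1r.
  exact: hH.
exists (2%:R *: (3%:R *: H 4 z0)).
apply: (deriv_in_sub (D := setT)) => //.
have z0z0 : cmod (z0 - z0) < r / 4 by rewrite subrr cmod0 divr_gt0.
apply: (@deriv_in_local _ _ setT setT (fun z => 2%:R *: H 3 z) _ _ _ (r / 4)) => //.
- by rewrite divr_gt0.
- by move=> w _ /f'H.
- by apply: deriv_inZ; exact: hH.
Qed.

End Cauchy.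

(** * The maximum principle and the Phragmen-Lindelof theorem *)

Section MaximumPrinciple.
Variable R : realType.
Local Notation C := (R[i]).
Variable V : completeNormedModType R[i].

Lemma rect_max (v : C -> R) (Y : R) : 0 <= Y ->
  (forall z, closed_strip z -> forall e : R, 0 < e -> exists2 d : R, 0 < d &
     forall w, closed_strip w -> cmod (w - z) < d -> `|v w - v z| <= e) ->
  exists2 c, closed_strip c /\ `|Im c| <= Y &
    forall w, closed_strip w -> `|Im w| <= Y -> v w <= v c.
Proof.
move=> Y0 vc; pose A := `[(0 : R), 1]%classic `*` `[- Y, Y]%classic.
pose f (p : R * R) := v (p.1 +i* p.2).
have AP p : A p <-> (0 <= p.1 <= 1) /\ (- Y <= p.2 <= Y).
  by rewrite /A /= !in_itv.
have [|||[x y] xyA xymax] := @compact_EVT_max (R * R)%type R f A.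
- by exists (0, 0); apply/AP => /=; split; apply/andP; split; lra.
- by apply: compact_setX; exact: segment_compact.
- apply/subspace_continuousP => p /AP[p1 p2]; apply/cvgrPdist_le => e e0.
  have [d d0 hd_] := vc (p.1 +i* p.2) p1 e e0.
  have d2 : 0 < d / 2 by rewrite divr_gt0.
  apply/nbhs_ballP; exists (d / 2) => // q [q1 q2] /AP[q3 q4].
  rewrite distrC; apply: hd_ => //.
  apply: le_lt_trans (cmod_le _) _ => /=.
  rewrite [ltRHS]splitr ltrD//.
    by move: q1; rewrite -ball_normE /= distrC.
  by move: q2; rewrite -ball_normE /= distrC.
- exists (x +i* y).
    by move: xyA => /set_mem/AP[h1 h2]; split => //=; rewrite ler_norml.
  move=> [a b] ab /= bY; have := xymax (a, b); apply; apply/mem_set/AP.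
  by split => //=; rewrite -ler_norml.
Qed.

(** The term eta (Re z)^2 makes the maximum strict.  At an interior maximum c of
|F| + eta (Re z)^2, compare c with the four points c + r, c - r, c + i r, c - i r:
in the average of F over these points the terms of order one and two of the Taylor
expansion cancel, while the average of (Re z)^2 exceeds its value at c by r^2 / 2. *)
Lemma max_principle (F : C -> V) (A : R) :
  0 <= A -> (forall z, closed_strip z -> cont_in (@closed_strip R) F z) -> holo (@open_strip R) F ->
  (forall z, closed_strip z -> Re z = 0 \/ Re z = 1 -> rnorm (F z) <= A) ->
  (forall e : R, 0 < e -> exists Y : R, forall z, closed_strip z ->
     Y <= `|Im z| -> rnorm (F z) <= e) ->
  forall z, closed_strip z -> rnorm (F z) <= A.
Proof.
move=> A0 Fc hF bd dec z1 z1S; apply/ler_addgt0Pr => eta eta0.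
pose v w := rnorm (F w) + eta * Re w ^+ 2.
suff : v z1 <= A + eta.
  apply: le_trans; rewrite /v lerDl mulr_ge0 ?sqr_ge0// ltW//.
rewrite leNgt; apply/negP => lt.
have S2 (w : C) : closed_strip w -> Re w ^+ 2 <= 1.
  by move=> /andP[w0 w1]; rewrite expr_le1.
(* beyond height Y the function v stays below its value at z1 *)
have [|Y hY] := dec ((v z1 - (A + eta)) / 2); first by rewrite divr_gt0// subr_gt0.
pose Y' := `|Y| + `|Im z1| + 1.
have Y1 := normr_ge0 Y; have Y2 := normr_ge0 (Im z1).
have [||c [cS cY] cmax] := @rect_max v Y'.
- by rewrite /Y'; lra.
- move=> z zS e e0; have e2 : 0 < e / 2 by rewrite divr_gt0.
  have [d d0 hd_] := Fc z zS _ e2.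
  exists (Num.min d (e / 2 / (2 * eta))).
    by rewrite lt_min d0 !divr_gt0// mulr_gt0.
  move=> w wS; rewrite lt_min ltr_pdivlMr ?mulr_gt0// => /andP[wd we].
  have h1 := hd_ w wS wd.
  have h2 : `|rnorm (F w) - rnorm (F z)| <= rnorm (F w - F z).
    have := rnormD (F w - F z) (F z); have := rnormD (F z - F w) (F w).
    by rewrite !subrK (rnormC (F z)) ler_norml => q1 q2; apply/andP; split; lra.
  have h3 : `|Re w ^+ 2 - Re z ^+ 2| <= 2 * cmod (w - z).
    rewrite subr_sqr normrM mulrC.
    apply: ler_pM => //.
      move: wS zS => /andP[w0 w1] /andP[z0 z1'].
      by rewrite ger0_norm; lra.
    by rewrite -ReB le_cmod_Re.
  rewrite /v opprD addrACA -mulrBr.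
  apply: le_trans (ler_normD _ _) _; rewrite normrM (gtr0_norm eta0).
  rewrite [leRHS]splitr lerD//; first exact: le_trans h2 h1.
  apply: le_trans (ler_wpM2l (ltW eta0) h3) _; lra.
have z1c : v z1 <= v c by apply: cmax => //; rewrite /Y'; lra.
have cY2 : `|Im c| < Y.
  rewrite ltNge; apply/negP => /(hY c cS) h.
  move: z1c; rewrite {2}/v; have := ler_wpM2l (ltW eta0) (S2 c cS).
  by move: lt h; lra.
(* on the sides v is at most A + eta, which is less than v z1 *)
have cO : open_strip c.
  have nb : ~ (Re c = 0 \/ Re c = 1).
    move=> /(bd c cS) h; have := ler_wpM2l (ltW eta0) (S2 c cS).
    by move: z1c lt h; rewrite {2}/v; lra.
  move: (cS) => /andP[c0 c1]; apply/andP; split; rewrite lt_neqAle ?c0 ?c1 andbT.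
    by apply/eqP => h; apply: nb; left.
  by apply/eqP => h; apply: nb; right.
have [d d0 [hS1 hS2]] := open_stripP cO.
set D := strip _ _ in hS1 hS2.
have /choice[F' hF'] : forall z, exists B, open_strip z -> deriv_in setT F z B.
  move=> z; have [/[dup] zO /hF[B hB]|n] := pselect (open_strip z); last by exists 0.
  have [r r0 hr] := open_strip_open zO.
  by exists B => _; exact: (deriv_in_open r0 hr hB).
have [F2 hF2] := holo_derivative hF' cO.
have Dc : D c by apply: hS1; rewrite subrr cmod0 ltW.
have eta4 : 0 < eta / 4 by rewrite divr_gt0.
have hFD w : D w -> deriv_in D F w (F' w).
  by move=> Dw; apply: (deriv_in_sub (D := setT)) => //; exact/hF'/hS2.
have [d' d'0 ht] := taylor2 (@strip_convex R _ _) Dc hFD (deriv_in_sub hS2 hF2) eta4.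
pose m := Num.min (Num.min d d') 1; pose r := m / 2.
have m0 : 0 < m by rewrite !lt_min d0 d'0 ltr01.
have md : m <= d by rewrite !ge_min lexx.
have md' : m <= d' by rewrite !ge_min lexx orbT.
have m1 : m <= 1 by rewrite !ge_min lexx !orbT.
have r0 : 0 < r by rewrite divr_gt0.
have rd : r < d by rewrite /r; lra.
have rd' : r < d' by rewrite /r; lra.
have r1 : r < 1 by rewrite /r; lra.
have key (w : C) : cmod w = 1 -> D (c + r%:C * w) /\
   rnorm (F (c + r%:C * w) - F c - (r%:C * w) *: F' c - ((r%:C * w) ^+ 2 / 2) *: F2) <= eta / 4 * r ^+ 2.
  move=> w1; have E : c + r%:C * w - c = r%:C * w by rewrite addrC addKr.
  have cE : cmod (c + r%:C * w - c) = r by rewrite E cmodM w1 mulr1 cmodR gtr0_norm.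
  have Dw : D (c + r%:C * w) by apply: hS1; rewrite cE ltW.
  split => //; have := ht _ Dw; rewrite cE E; exact.
have keyv (w : C) : cmod w = 1 -> rnorm (F (c + r%:C * w)) <= v c - eta * (Re c + r * Re w) ^+ 2.
  move=> w1; have [Dw _] := key w w1.
  have : v (c + r%:C * w) <= v c.
    apply: cmax; first exact/open_closed_strip/hS2.
    have iw : `|Im (c + r%:C * w)| <= `|Im c| + r.
      rewrite ImD (le_trans (ler_normD _ _))// lerD2l.
      by rewrite (le_trans (le_cmod_Im _))// cmodM w1 mulr1 cmodR gtr0_norm.
    apply: le_trans iw _; rewrite /Y'; have := ler_norm Y.
    by move: cY2 r1 Y2; lra.
  have -> : Re c + r * Re w = Re (c + r%:C * w).
    by rewrite ReD; case: (w) => a b /=; rewrite mul0r subr0.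
  by rewrite {1}/v; lra.
have n1 : cmod (1 : C) = 1 by rewrite cmod1.
have n2 : cmod (-1 : C) = 1 by rewrite cmodN cmod1.
have n3 : cmod ('i%C : C) = 1 by rewrite cmodi.
have n4 : cmod (- 'i%C : C) = 1 by rewrite cmodN cmodi.
have [_ k1] := key _ n1; have [_ k2] := key _ n2.
have [_ k3] := key _ n3; have [_ k4] := key _ n4.
have v1 := keyv _ n1; have v2 := keyv _ n2; have v3 := keyv _ n3; have v4 := keyv _ n4.
(* the Taylor remainder at c + r w *)
pose T w := F (c + r%:C * w) - F c - (r%:C * w) *: F' c - ((r%:C * w) ^+ 2 / 2) *: F2.
have : rnorm (4 *: F c) <= rnorm (F (c + r%:C * 1)) + rnorm (F (c + r%:C * -1)) +
   rnorm (F (c + r%:C * 'i%C)) + rnorm (F (c + r%:C * - 'i%C)) +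
   (rnorm (T 1) + rnorm (T (-1)) + rnorm (T 'i%C) + rnorm (T (- 'i%C))).
  have i2 : 'i%C * 'i%C = -1 :> C by rewrite -expr2 sqr_i.
  have -> : 4 *: F c = F (c + r%:C * 1) + F (c + r%:C * -1) +
   F (c + r%:C * 'i%C) + F (c + r%:C * - 'i%C) - (T 1 + T (-1) + T 'i%C + T (- 'i%C)).
    rewrite /T.
    have -> : (r%:C * 'i%C) ^+ 2 = - r%:C ^+ 2 :> C by rewrite exprMn sqr_i mulrN1.
    have -> : (r%:C * - 'i%C) ^+ 2 = - r%:C ^+ 2 :> C by rewrite exprMn sqrrN sqr_i mulrN1.
    by module; ring.
  rewrite (le_trans (rnormB _ _))// lerD//.
    by rewrite (le_trans (rnormD _ _))// lerD// (le_trans (rnormD _ _))// lerD// rnormD.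
  by rewrite (le_trans (rnormD _ _))// lerD// (le_trans (rnormD _ _))// lerD// rnormD.
rewrite rnormZ cmod_nat; move: v1 v2 v3 v4 k1 k2 k3 k4; rewrite -!/(T _) /= {1 2 3 4}/v.
set x := Re c; have r20 : 0 < r ^+ 2 by rewrite exprn_gt0.
have := mulr_gt0 eta0 r20.
rewrite !oppr0 !mulr0 !mulr1 !mulrN1 !addr0; lra.
Qed.

End MaximumPrinciple.

Section PhragmenLindelof.
Variable R : realType.
Local Notation C := (R[i]).
Variable V : completeNormedModType R[i].

(** The factor (1 + e z)^-2 has modulus at most 1 on the strip and decays
quadratically, so the maximum principle applies to its product with G; then e
tends to 0. *)
Lemma phragmen_lindelof (G : C -> V) (A M Y0 : R) : 0 <= A ->
  (forall z, closed_strip z -> cont_in (@closed_strip R) G z) -> holo (@open_strip R) G ->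
  (forall z, closed_strip z -> Re z = 0 \/ Re z = 1 -> rnorm (G z) <= A) ->
  (forall z, closed_strip z -> Y0 <= `|Im z| -> rnorm (G z) <= M * (1 + `|Im z|)) ->
  forall z, closed_strip z -> rnorm (G z) <= A.
Proof.
move=> A0 Gc hG bd gr z zS.
pose k (e : R) (w : C) : C := (1 + e%:C * w)^-1.
have reE (e : R) (w : C) : Re (1 + e%:C * w) = 1 + e * Re w.
  by rewrite ReD; case: (w) => a b /=; rewrite mul0r subr0.
have imE (e : R) (w : C) : Im (1 + e%:C * w) = e * Im w.
  by rewrite ImD; case: (w) => a b /=; rewrite mul0r addr0 add0r.
have big1 (e : R) w : 0 < e -> closed_strip w -> 1 <= cmod (1 + e%:C * w).
  move=> e0 /andP[w0 w1]; apply: le_trans (le_cmod_Re _); rewrite reE.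
  by apply: le_trans (ler_norm _); rewrite lerDl mulr_ge0// ltW.
have nz (e : R) w : 0 < e -> closed_strip w -> 1 + e%:C * w != 0.
  by move=> e0 /(big1 _ _ e0) h; rewrite -cmod_gt0 (lt_le_trans _ h).
have k1 (e : R) w : 0 < e -> closed_strip w -> cmod (k e w) <= 1.
  by move=> e0 /(big1 _ _ e0) h; rewrite cmodV invf_le1// (lt_le_trans _ h).
have kd (e : R) D w : 0 < e -> closed_strip w -> exists B, deriv_in D (k e : C -> cplx R) w B.
  move=> e0 wS; eexists; apply: (@deriv_in_affine _ _ setT D (fun u => u^-1 : cplx R) 1 e%:C w) => //.
  by apply: deriv_in_inv; exact: nz.
pose F e w := (k e w * k e w) *: G w.
have FE e : F e = (fun w => k e w *: (k e w *: G w)).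
  by apply/funext => w; rewrite /F scalerA.
have main e : 0 < e -> rnorm (F e z) <= A.
  move=> e0; apply: (max_principle A0 _ _ _ _ zS) => //.
  - move=> w wS; rewrite FE; have [B hB] := kd e (@closed_strip R) w e0 wS.
    by do 2 (apply: (cont_inM (deriv_in_cont hB))); exact: Gc.
  - move=> w wO; rewrite FE; have [B hB] := kd e (@open_strip R) w e0 (open_closed_strip wO).
    have [B' hB'] := hG w wO.
    by eexists; exact: (deriv_inM hB (deriv_inM hB hB')).
  - move=> w wS /(bd w wS) h; rewrite /F rnormZ cmodM.
    have c0 := cmod_ge0 (k e w); have c1 := k1 e w e0 wS; have n0 := rnorm_ge0 (G w).
    have : cmod (k e w) * cmod (k e w) <= 1 by rewrite -[leRHS]mulr1 ler_pM.
    by move=> h2; rewrite -[leRHS]mul1r ler_pM// mulr_ge0.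
  - move=> r r0; pose M1 := `|M| + 1.
    have M10 : 0 < M1 by rewrite ltr_wpDl.
    exists (`|Y0| + 1 + 2 * M1 / (r * e ^+ 2)) => w wS.
    set y := `|Im w| => hy.
    have re0 : 0 < r * e ^+ 2 by rewrite mulr_gt0// exprn_gt0.
    have q0 : 0 <= 2 * M1 / (r * e ^+ 2) by rewrite divr_ge0 ?mulr_ge0 ?ltW.
    have Yn := normr_ge0 Y0; have Yl := ler_norm Y0.
    have y1 : 1 <= y by lra.
    have h := gr w wS ltac:(rewrite -/y; lra).
    rewrite -/y in h.
    have h2 : rnorm (G w) <= M1 * (2 * y).
      apply: le_trans h _; rewrite /M1.
      have p1 : 0 <= (`|M| - M) * (1 + y) by rewrite mulr_ge0 ?subr_ge0 ?ler_norm//; lra.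
      have p2 : 0 <= `|M| * (y - 1) by rewrite mulr_ge0// subr_ge0.
      by move: p1 p2; lra.
    have kE : cmod (k e w) <= (e * y)^-1.
      rewrite cmodV lef_pV2 ?posrE ?cmod_gt0 ?nz ?mulr_gt0//; last by lra.
      by apply: le_trans (le_cmod_Im _); rewrite imE normrM gtr0_norm.
    have ey0 : 0 < e * y by rewrite mulr_gt0//; lra.
    rewrite /F rnormZ cmodM.
    apply: le_trans (_ : (e * y)^-1 * (e * y)^-1 * (M1 * (2 * y)) <= _).
      by rewrite !ler_pM ?mulr_ge0 ?cmod_ge0 ?rnorm_ge0.
    have -> : (e * y)^-1 * (e * y)^-1 * (M1 * (2 * y)) = (2 * M1 / (r * e ^+ 2)) * r / y.
      by field; rewrite !gt_eqF//; lra.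
    have y0 : 0 < y by apply: lt_le_trans y1.
    rewrite ler_pdivrMr// [r * y]mulrC ler_wpM2r ?(ltW r0)//.
    by apply: le_trans hy; rewrite lerDr addr_ge0.
apply/ler_addgt0Pr => eta eta0.
pose c := cmod z; have c0 : 0 <= c by exact: cmod_ge0.
have bnd e : 0 < e -> rnorm (G z) <= A * (1 + e * c) ^+ 2.
  move=> e0; have := main e e0; rewrite /F rnormZ cmodM cmodV.
  have g0 : 0 < cmod (1 + e%:C * z) by rewrite cmod_gt0 nz.
  have g1 : cmod (1 + e%:C * z) <= 1 + e * c.
    by rewrite (le_trans (cmodD _ _))// cmod1 cmodM cmodR gtr0_norm.
  rewrite -invfM ler_pdivrMl ?mulr_gt0// => /le_trans; apply.
  by rewrite mulrC ler_wpM2l// expr2 ler_pM// ltW.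
have q0 : 0 <= (A + 1) * (2 * c + c ^+ 2 + 1).
  by have := sqr_ge0 c; move=> c2; rewrite mulr_ge0//; lra.
have [e /andP[e0 e1] e2] := unit_small_mul eta0 q0.
have := bnd e e0.
move=> /le_trans; apply.
have -> : A * (1 + e * c) ^+ 2 = A + A * e * (2 * c + e * c ^+ 2) by ring.
rewrite lerD2l; apply: le_trans e2.
have cc : e * c ^+ 2 <= c ^+ 2 by rewrite ler_piMl ?sqr_ge0.
have h3 : A * e * (2 * c + e * c ^+ 2) <= A * e * (2 * c + c ^+ 2 + 1).
  by rewrite ler_wpM2l ?mulr_ge0 ?(ltW e0)//; lra.
apply: le_trans h3 _; rewrite mulrA [e * _]mulrC ler_wpM2r//; last first.
  by rewrite ler_wpM2r ?(ltW e0)//; lra.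
by have := sqr_ge0 c; lra.
Qed.

End PhragmenLindelof.

(** * Derivatives and integrals over the real line *)

Section Derivatives.

(** Convergence of difference quotients, stated without division. *)
Lemma dnbhs_deriveP (K : numFieldType) (W : normedModType K) (f : K^o -> W) (a : K^o) (l : W) :
  (fun h => h^-1 *: (f (h + a) - f a)) @ 0^' --> l <->
  forall e : K, 0 < e -> exists2 d : K, 0 < d & forall h : K, `|h| < d ->
    `|f (h + a) - f a - h *: l| <= e * `|h|.
Proof.
split=> [/cvgrPdist_le H e e0|H].
  have := H e e0; rewrite near_withinE => /nbhs_ballP[d /= d0 hd_].
  exists d => // h hd1; have [->|h0] := eqVneq h 0.
    by rewrite add0r subrr scale0r subrr !normr0 mulr0.
  have : ball (0 : K^o) d h by rewrite -ball_normE /= sub0r normrN.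
  move=> /hd_ /(_ h0).
  have -> : f (h + a) - f a - h *: l = - (h *: (l - h^-1 *: (f (h + a) - f a))).
    by rewrite scalerBr scalerA mulfV// scale1r opprB.
  by rewrite normrN normrZ mulrC => h1; rewrite ler_wpM2r.
apply/cvgrPdist_le => e e0; have [d d0 hd_] := H e e0.
rewrite near_withinE; apply/nbhs_ballP; exists d => // h.
rewrite -ball_normE /= sub0r normrN => hd1 h0.
have -> : l - h^-1 *: (f (h + a) - f a) = - (h^-1 *: (f (h + a) - f a - h *: l)).
  by rewrite (scalerBr _ (f (h + a) - f a) (h *: l)) scalerA mulVf// scale1r opprB.
rewrite normrN normrZ normfV ler_pdivrMl ?normr_gt0// mulrC.
exact: hd_.
Qed.

Lemma derivableP1 (K : numFieldType) (W : normedModType K) (f : K^o -> W) (a : K^o) :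
  derivable f a 1 <-> cvg ((fun h => h^-1 *: (f (h + a) - f a)) @ 0^').
Proof.
rewrite /derivable.
rewrite (_ : (fun h => h^-1 *: ((f \o shift a) (h *: 1) - f a)) =
  (fun h => h^-1 *: (f (h + a) - f a)))//.
by apply/funext => h /=; rewrite [h *: 1]mulr1.
Qed.

Variable R : realType.

Lemma derivable_inP (V : normedModType R[i]) (f : R[i]^o -> V) (z : R[i]^o) (l : V) :
  (fun h => h^-1 *: (f (h + z) - f z)) @ 0^' --> l <-> deriv_in setT (f : R[i] -> V) (z : R[i]) l.
Proof.
split=> [/dnbhs_deriveP H e e0|H].
  have [|_ /complex_gt0E[d d0 ->] hd_] := H e%:C; first by rewrite ltcR.
  exists d => // w _ wz; have := hd_ (w - z).
  by rewrite subrK cmodE ltcR -rmorphM le_rnorm => /(_ wz).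
apply/dnbhs_deriveP => _ /complex_gt0E[e e0 ->]; have [d d0 hd_] := H e e0.
exists d%:C; first by rewrite ltcR.
move=> h; rewrite cmodE ltcR -rmorphM le_rnorm => h1.
have := hd_ (h + z) I; rewrite addrK; exact.
Qed.

Lemma derivable_deriv_in (V : normedModType R[i]) (f : R[i]^o -> V) (z : R[i]^o) :
  derivable f z 1 -> deriv_in setT (f : R[i] -> V) (z : R[i]) (derive1 f z).
Proof. by move=> /derivableP1 h; apply/derivable_inP. Qed.

Lemma deriv_in_derivable (V : normedModType R[i]) (f : R[i]^o -> V) (z : R[i]^o) l :
  deriv_in setT (f : R[i] -> V) (z : R[i]) l -> derivable f z 1 /\ derive1 f z = l.
Proof.
move=> /derivable_inP h; split; first by apply/derivableP1/cvg_ex; exists l.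
exact: cvg_lim.
Qed.

Definition real_line : set R[i] := [set z | Im z = 0].

Lemma real_line_R (y : R) : real_line y%:C. Proof. by []. Qed.

Lemma real_lineE z : real_line z -> z = (Re z)%:C.
Proof. by case: z => a b; rewrite /real_line /= => ->. Qed.

Lemma derivable_real_line (u : R -> R) (y : R) : derivable u y 1 ->
  deriv_in real_line (fun z => (u (Re z))%:C : cplx R) y%:C (derive1 u y)%:C.
Proof.
move=> /derivableP1 /dnbhs_deriveP H e e0.
have [d d0 hd_] := H e e0; exists d => // w /real_lineE ->.
set x := Re w; rewrite -rmorphB cmodR /= => xd.
have := hd_ _ xd; rewrite subrK.
have -> : (u x)%:C - (u y)%:C - (x - y)%:C *: ((derive1 u y)%:C : cplx R) =
   (u x - u y - (x - y) *: derive1 u y)%:C :> cplx R.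
  by rewrite -[_ *: (_ : cplx R)]/((_ : R[i]) * _) -rmorphM -!rmorphB.
by rewrite cmod_rnorm cmodR.
Qed.

Lemma segm_real (a b : R) z : a <= b -> segm a%:C b%:C z -> exists2 y : R, a <= y <= b & z = y%:C.
Proof.
move=> ab [t /andP[t0 t1] ->]; exists (a + t * (b - a)).
  by apply/andP; split; nra.
by rewrite rmorphD rmorphM rmorphB.
Qed.

Lemma real_segm (a b y : R) : a <= y <= b -> segm a%:C b%:C y%:C.
Proof.
move=> /andP[ay yb]; have [ab|ab] := eqVneq a b.
  have -> : y = a by apply/eqP; rewrite eq_le ay ab yb.
  exact: segm_l.
have ba : b - a != 0 by rewrite subr_eq0 eq_sym.
have ab' : 0 < b - a by rewrite lt_neqAle eq_sym ba subr_ge0 (le_trans ay).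
exists ((y - a) / (b - a)).
  apply/andP; split; first by rewrite divr_ge0 ?(ltW ab')// subr_ge0.
  by rewrite ler_pdivrMr// mul1r lerD2r.
by rewrite -rmorphB -rmorphM -rmorphD divfK// addrC subrK.
Qed.

End Derivatives.

Section LineIntegral.
Variable R : realType.
Variable V : completeNormedModType R[i].
Local Notation C := (R[i]).

Lemma real_line_convex : convex_in (@real_line R).
Proof.
move=> a b /real_lineE -> /real_lineE -> _ [t _ ->].
by rewrite -rmorphB -rmorphM -rmorphD.
Qed.

Lemma real_line_closed : closed_in (@real_line R).
Proof.
move=> z H; apply/eqP; rewrite -normr_le0; apply/ler_addgt0Pr => e /H[w wR wz].
rewrite add0r -normrN -[- _]add0r -{1}wR -ImB.
by rewrite (le_trans (le_cmod_Im _))// ltW.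
Qed.

Variables (F : R -> V) (P : C -> V).
Hypothesis HP : forall y : R, deriv_in (@real_line R) P y%:C (F y).
Hypothesis Fc : forall y e : R, 0 < e -> exists2 d : R, 0 < d &
  forall x, `|x - y| < d -> rnorm (F x - F y) <= e.

Lemma mean_value_real (a b M : R) : a <= b -> (forall y, a <= y <= b -> rnorm (F y) <= M) ->
  rnorm (P b%:C - P a%:C) <= M * (b - a).
Proof.
move=> ab H; have -> : b - a = cmod (b%:C - a%:C) :> R.
  by rewrite -rmorphB cmodR ger0_norm// subr_ge0.
apply: mean_value => z /(segm_real ab)[y yab ->]; exists (F y); last exact: H.
by apply: (deriv_in_sub _ (HP y)); exact: real_line_convex.
Qed.

Lemma mean_value_real_lin (a b e : R) (L : V) : a <= b -> (forall y, a <= y <= b -> rnorm (F y - L) <= e) ->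
  rnorm (P b%:C - P a%:C - (b - a)%:C *: L) <= e * (b - a).
Proof.
move=> ab H; rewrite rmorphB.
have -> : b - a = cmod (b%:C - a%:C) :> R.
  by rewrite -rmorphB cmodR ger0_norm// subr_ge0.
apply: mean_value_lin => z /(segm_real ab)[y yab ->]; exists (F y); last exact: H.
by apply: (deriv_in_sub _ (HP y)); exact: real_line_convex.
Qed.

Lemma riemann_primitive a b : a <= b ->
  is_riemann_integral a b F (P b%:C - P a%:C).
Proof.
move=> ab e e0; have ba0 : 0 <= b - a by rewrite subr_ge0.
have ba1 : 0 < b - a + 1 by rewrite ltr_wpDl.
pose f (z : C) := F (Re z).
have fs : cont_segm f a%:C b%:C.
  move=> z /(segm_real ab)[y _ ->] r /(Fc y)[d d0 hd_]; exists d => // w _ wy.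
  by apply: hd_; rewrite -[y]/(Re y%:C) -ReB (le_lt_trans (le_cmod_Re _)).
have [|d d0 hd_] := cont_in_unif fs (e := e / 2 / (b - a + 1)); first by rewrite !divr_gt0.
exists d => // n s t s0 sn st.
have mono i : (i <= n)%N -> a <= s i /\ forall j, (j <= i)%N -> s j <= s i.
  elim: i => [|i IH] i_n; first by rewrite s0; split => // j; rewrite leqn0 => /eqP ->; rewrite s0.
  have [h1 h2] := IH (ltnW i_n); have [h3 h4 _] := st i i_n.
  have ss := le_trans h3 h4.
  split; first exact: le_trans h1 ss.
  move=> j; rewrite leq_eqVlt => /predU1P[->//|]; rewrite ltnS => /h2 h5.
  exact: le_trans h5 ss.
have sb i : (i <= n)%N -> s i <= b by move=> i_n; rewrite -sn; exact: (mono n _).2.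
have -> : P b%:C - P a%:C = \sum_(i < n) (P (s i.+1)%:C - P (s i)%:C).
  rewrite -(big_mkord xpredT (fun i => P (s i.+1)%:C - P (s i)%:C)).
  by rewrite (telescope_sumr (fun i => P (s i)%:C))// sn s0.
rewrite lt_rnorm -sumrB.
apply: le_lt_trans (rnorm_sum _ _ _) _.
have : \sum_(i < n) (e / 2 / (b - a + 1) * (s i.+1 - s i)) < e.
  rewrite -mulr_sumr -(big_mkord xpredT (fun i => s i.+1 - s i)) telescope_sumr// sn s0.
  apply: le_lt_trans (small_mul _ ba0) _; first by rewrite ltW// divr_gt0.
  by rewrite ltr_pdivrMr// ltr_pMr// ltr1n.
apply: le_lt_trans; apply: ler_sum => -[i i_n] _ /=.
have [h1 h2 h3] := st i i_n; have [h4 _] := mono i (ltnW i_n); have h5 := sb _ i_n.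
rewrite rnormC; apply: mean_value_real_lin; first exact: le_trans h2.
move=> y /andP[y1 y2].
have := hd_ y%:C (t i)%:C; rewrite /f /=; apply.
- by apply: real_segm; rewrite (le_trans h4) ?(le_trans _ h5).
- by apply: real_segm; rewrite (le_trans h4) ?(le_trans _ h5).
- rewrite -rmorphB cmodR; apply: le_lt_trans h3.
  by rewrite ler_norml; apply/andP; split; lra.
Qed.

(** Uniform partitions are fine enough for both integrals. *)
Lemma riemann_uniq a b (G : R -> V) v w : a <= b ->
  is_riemann_integral a b G v -> is_riemann_integral a b G w -> v = w.
Proof.
move=> ab hv hw; apply/subr0_eq/rnorm_small => e e0.
have e2 : 0 < e / 2 by rewrite divr_gt0.
have [d d0 h] := hv _ e2; have [d' d'0 h'] := hw _ e2.
pose m := Num.min d d'; have m0 : 0 < m by rewrite lt_min d0.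
pose n := (Num.truncn ((b - a) / m)).+1.
have nE : (b - a) / n%:R < m.
  rewrite ltr_pdivrMr ?ltr0n// mulrC -ltr_pdivrMr//.
  exact: truncnS_gt.
have n0 : n%:R != 0 :> R by rewrite pnatr_eq0.
pose s (i : nat) := a + i%:R * ((b - a) / n%:R).
have s0 : s 0%N = a by rewrite /s mul0r addr0.
have sn : s n = b by rewrite /s mulrC divfK// addrC subrK.
have ss i : s i.+1 - s i = (b - a) / n%:R by rewrite /s -natr1; ring.
have q0 : 0 <= (b - a) / n%:R by rewrite divr_ge0// subr_ge0.
have mesh x : (b - a) / n%:R < x -> forall i, (i < n)%N ->
    [/\ s i <= s i, s i <= s i.+1 & s i.+1 - s i < x].
  by move=> hx i _; split => //; rewrite ?ss// -subr_ge0 ss.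
have k1 := h n s s s0 sn (mesh _ (lt_le_trans nE _)).
have k2 := h' n s s s0 sn (mesh _ (lt_le_trans nE _)).
rewrite (le_trans (rnorm_tri (\sum_(i < n) (s i.+1 - s i)%:C *: G (s i)) _ _))//.
rewrite [leRHS]splitr rnormC lerD//.
  by rewrite -le_rnorm ltW// k1// /m ge_min lexx.
by rewrite -le_rnorm ltW// k2// /m ge_min lexx orbT.
Qed.

Lemma zero_left a : (forall y, y < a -> F y = 0) -> F a = 0.
Proof.
move=> H; apply: rnorm_small => e /(Fc a)[d d0 hd_].
have := hd_ (a - d / 2); rewrite (H (a - d / 2)); last by lra.
rewrite sub0r rnormN; apply; rewrite addrAC subrr add0r normrN gtr0_norm; lra.
Qed.

Lemma zero_right a : (forall y, a < y -> F y = 0) -> F a = 0.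
Proof.
move=> H; apply: rnorm_small => e /(Fc a)[d d0 hd_].
have := hd_ (a + d / 2); rewrite (H (a + d / 2)); last by lra.
rewrite sub0r rnormN; apply; rewrite addrAC subrr add0r gtr0_norm; lra.
Qed.

Let zeroP a b : a <= b -> (forall y, a <= y <= b -> F y = 0) -> P b%:C = P a%:C.
Proof.
move=> ab H; apply/subr0_eq/eqP; rewrite -rnorm_eq0 eq_le rnorm_ge0 andbT.
rewrite -[leRHS](mul0r (b - a)); apply: mean_value_real => // y /H ->.
by rewrite rnorm0.
Qed.

Let extend a b a' b' : a' <= a -> a <= b -> b <= b' ->
  (forall y, ~ (a <= y <= b) -> F y = 0) -> P b'%:C - P a'%:C = P b%:C - P a%:C.
Proof.
move=> aa ab bb H.
have Fa y : y <= a -> F y = 0.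
  rewrite le_eqVlt => /predU1P[->|ya]; last by apply: H; lra.
  by apply: zero_left => x xa; apply: H; lra.
have Fb y : b <= y -> F y = 0.
  rewrite le_eqVlt => /predU1P[<-|ya]; last by apply: H; lra.
  by apply: zero_right => x xa; apply: H; lra.
rewrite (zeroP bb) => [|y /andP[/Fb]//].
by rewrite (zeroP aa) => // y /andP[_ /Fa].
Qed.

(** [line_integral] selects an unspecified interval that contains the support; the
increment of P is the same for all such intervals. *)
Lemma line_integralE a b : a <= b -> (forall y, ~ (a <= y <= b) -> F y = 0) ->
  line_integral F = P b%:C - P a%:C.
Proof.
move=> ab H0; rewrite /line_integral; case: xgetP => [v _ [a' [b' [ab' H0' hv]]]|/(_ (P b%:C - P a%:C))].
  have -> := riemann_uniq ab' hv (riemann_primitive ab').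
  pose m := Num.min a a'; pose M := Num.max b b'.
  have h1 : m <= a by rewrite ge_min lexx.
  have h2 : m <= a' by rewrite ge_min lexx orbT.
  have h3 : b <= M by rewrite le_max lexx.
  have h4 : b' <= M by rewrite le_max lexx orbT.
  by rewrite -(extend h2 ab' h4 H0') (extend h1 ab h3 H0).
by case; exists a, b; split => //; exact: riemann_primitive.
Qed.

End LineIntegral.

(** * Smooth bump functions *)

Section Bump.
Variable R : realType.

(** The derivatives of exp(-1/x), extended by 0 to x <= 0, are linear combinations of
these functions. *)
Definition flat (k : nat) (x : R) : R :=
  if 0 < x then x^-1 ^+ k * expR (- x^-1) else 0.

(** A quadratic bound, from the exponential series: it gives the derivative at 0. *)
Lemma flat_le k (x : R) : `|flat k x| <= (k.+2)`!%:R * x ^+ 2.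
Proof.
rewrite /flat; case: ltP => [x0|_]; last by rewrite normr0 mulr_ge0 ?sqr_ge0.
have y0 : 0 < x^-1 by rewrite invr_gt0.
rewrite ger0_norm ?mulr_ge0 ?exprn_ge0 ?expR_ge0 ?(ltW y0)//.
have := expR_ge1Dxn k.+1 (ltW y0); set y := x^-1 in y0 *.
have f0 : 0 < (k.+2)`!%:R :> R by rewrite ltr0n fact_gt0.
move=> h; have {}h : y ^+ k.+2 / (k.+2)`!%:R <= expR y by apply: le_trans h; rewrite lerDr.
rewrite expRN.
have e0 := expR_gt0 y.
have -> : y ^+ k = y ^+ k.+2 * x ^+ 2.
  by rewrite -addn2 exprD -mulrA -exprMn mulVf ?gt_eqF// expr1n mulr1.
rewrite ler_pdivrMr// [leRHS]mulrAC ler_wpM2r ?sqr_ge0//.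
by rewrite -ler_pdivrMl // mulrC.
Qed.

Lemma flat_derive k (x : R) :
  is_derive x 1 (flat k) (- k%:R * flat k.+1 x + flat k.+2 x).
Proof.
have [x0|x0|x0] := ltgtP x 0.
- have -> : - k%:R * flat k.+1 x + flat k.+2 x = 0.
    by rewrite /flat ltNge (ltW x0)/= mulr0 addr0.
  apply: (@near_eq_is_derive _ _ _ (cst 0)).
  near=> y; rewrite /flat ltNge ifN// negbK ltW//.
  by near: y; exact: lt_nbhsl.
- have y0 : x^-1 != 0 by rewrite invr_eq0 gt_eqF.
  have x0' : x != 0 by rewrite gt_eqF.
  have di : is_derive x 1 (@GRing.inv R) (- x ^- 2).
    apply: is_derive_eq; first exact: (@is_deriveV R id x 1 1 x0').
    by rewrite [_ *: 1]mulr1.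
  pose p : R -> R := id ^+ k * (expR \o -%R).
  have pE y : p y = y ^+ k * expR (- y) by rewrite /p !fctE.
  have dp : is_derive x^-1 1 p
     (k%:R * x^-1 ^+ k.-1 * expR (- x^-1) - x^-1 ^+ k * expR (- x^-1)).
    rewrite /p; apply: is_derive_eq.
    rewrite !fctE /GRing.scale /=; ring.
  apply: (@near_eq_is_derive _ _ _ (p \o (@GRing.inv R))).
    near=> y; rewrite /= pE /flat ifT//.
    by near: y; exact: lt_nbhsr.
  apply: is_derive_eq.
  rewrite /flat x0.
  case: (k) => [|m] /=; rewrite ?expr0 !exprS; field => //.
- rewrite x0; have -> : - k%:R * flat k.+1 0 + flat k.+2 0 = 0.
    by rewrite /flat ltxx mulr0 addr0.
  suff H : (fun h => h^-1 *: (flat k (h + 0) - flat k 0)) @ 0^' --> (0 : R).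
    have H2 : derivable (flat k) 0 1 by apply/derivableP1/cvg_ex; exists 0.
    apply: DeriveDef => //; rewrite -derive1E; exact: cvg_lim.
  apply/dnbhs_deriveP => e e0.
  have f0 : 0 < (k.+2)`!%:R :> R by rewrite ltr0n fact_gt0.
  exists (e / (k.+2)`!%:R); first by rewrite divr_gt0.
  move=> h; rewrite ltr_pdivlMr// => he.
  rewrite addr0 scaler0 subr0 [flat k 0]/flat ltxx subr0.
  apply: le_trans (flat_le _ _) _.
  rewrite -real_normK ?num_real// expr2 mulrA ler_wpM2r//.
  by rewrite mulrC ltW.
Unshelve. all: by end_near. Qed.

(** A space of functions that is stable under derivation, so that its elements are
smooth. *)
Inductive flatspan (a b n : R) : (R -> R) -> Prop :=
| FlatGen c j k : flatspan a b n (fun x => c * (flat j (n * (x - a)) * flat k (n * (b - x))))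
| FlatAdd u v : flatspan a b n u -> flatspan a b n v -> flatspan a b n (fun x => u x + v x).

Lemma flatspan_derive a b n u : flatspan a b n u ->
  exists2 v, flatspan a b n v & forall x : R, is_derive x 1 u (v x).
Proof.
elim => [c j k|{}u v _ [u' fu hu] _ [v' fv hv]]; last first.
  exists (fun x => u' x + v' x); first exact: FlatAdd.
  by move=> x; exact: is_deriveD.
pose g j k c x := c * (flat j (n * (x - a)) * flat k (n * (b - x))).
exists (fun x => (g j.+1 k (c * n * - j%:R) x + g j.+2 k (c * n) x) +
   (g j k.+1 (c * n * k%:R) x + g j k.+2 (- (c * n)) x)).
  by apply: FlatAdd; apply: FlatAdd; exact: FlatGen.
move=> x; pose la := (fun x : R => n * (x - a)); pose lb := (fun x : R => n * (b - x)).
have dla : is_derive x 1 la n.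
  have : is_derive x 1 (n \*: (id - cst a)) (n *: (1 - 0)) by exact: is_deriveZ.
  by rewrite subr0 [n *: 1]mulr1.
have dlb : is_derive x 1 lb (- n).
  have : is_derive x 1 (n \*: (cst b - id)) (n *: (0 - 1)) by exact: is_deriveZ.
  by rewrite sub0r scalerN [n *: 1]mulr1.
have dfa := @is_derive1_comp _ (flat j) la x _ _ (flat_derive j (la x)) dla.
have dfb := @is_derive1_comp _ (flat k) lb x _ _ (flat_derive k (lb x)) dlb.
have := @is_deriveZ _ _ _ _ c x 1 _ (is_deriveM dfa dfb).
move=> h; apply: is_derive_eq h _.
by rewrite /GRing.scale /= /g /la /lb; ring.
Qed.

Lemma flatspan_smooth a b n u : flatspan a b n u -> smooth u.
Proof.
move=> fu m x; suff [v fv ->] : exists2 v, flatspan a b n v & derive1n m u = v.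
  have [w _ /(_ x) h] := flatspan_derive fv; exact: ex_derive.
elim: m => [|m [v fv IH]]; first by exists u.
have [w fw hw] := flatspan_derive fv; exists w => //.
rewrite /derive1n iterS -/(derive1n m u) IH; apply/funext => y.
by rewrite derive1E; exact: derive_val.
Qed.

Lemma smooth_bump (a b e : R) : a < b -> 0 < e -> exists phi : R -> R,
  [/\ smooth phi, forall x, 0 <= phi x <= 1, forall x, ~~ (a < x < b) -> phi x = 0 &
   forall x, a + e <= x <= b - e -> 1 - e <= phi x].
Proof.
(* n y >= 2 / e for y >= e, and then exp(- 1 / (n y)) >= 1 - e / 2 *)
move=> ab e0; pose n := 2 / e ^+ 2.
have n0 : 0 < n by rewrite divr_gt0// exprn_gt0.
pose phi x := 1 * (flat 0 (n * (x - a)) * flat 0 (n * (b - x))).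
have f01 x : 0 <= flat 0 x <= 1.
  rewrite /flat; case: ltP => [x0|]; last by rewrite lexx ler01.
  by rewrite expr0 mul1r expR_ge0 /= expRN invf_le1 ?expR_gt0// ltW// expR_gt1 invr_gt0.
have fz x : x <= 0 -> flat 0 x = 0 by rewrite /flat leNgt => /negbTE ->.
exists phi; split.
- exact/flatspan_smooth/FlatGen.
- move=> x; have /andP[h1 h2] := f01 (n * (x - a)); have /andP[h3 h4] := f01 (n * (b - x)).
  by rewrite /phi mul1r mulr_ge0//= -[leRHS]mulr1 ler_pM.
- move=> x nx; rewrite /phi mul1r; have [xa|ax] := leP x a.
    by rewrite fz ?mul0r// pmulr_rle0// subr_le0.
  have [bx|xb] := leP b x.
    by rewrite [flat 0 (n * (b - x))]fz ?mulr0// pmulr_rle0// subr_le0.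
  by rewrite ax xb in nx.
- move=> x /andP[x1 x2].
  have fe y : e <= y -> 1 - e / 2 <= flat 0 (n * y).
    move=> ey; have ny : 2 / e <= n * y.
      rewrite /n (_ : 2 / e = 2 / e ^+ 2 * e); last by field; rewrite gt_eqF.
      by rewrite ler_wpM2l// ltW.
    have y0 : 0 < n * y by rewrite mulr_gt0// (lt_le_trans e0).
    rewrite /flat y0 expr0 mul1r; apply: le_trans (expR_ge1Dx _).
    rewrite lerD2l lerN2 -[e / 2]invrK lef_pV2 ?posrE ?invr_gt0 ?divr_gt0//.
    by rewrite invf_div.
  have h1 := fe (x - a) ltac:(lra); have h2 := fe (b - x) ltac:(lra).
  have /andP[h3 h4] := f01 (n * (x - a)); have /andP[h5 h6] := f01 (n * (b - x)).
  rewrite /phi mul1r; have [e2|e2] := leP 0 (1 - e / 2).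
    apply: le_trans (ler_pM e2 e2 h1 h2).
    by have := sqr_ge0 (e / 2); lra.
  by apply: le_trans (mulr_ge0 h3 h5); lra.
Qed.

End Bump.

(** * Density of step functions in L^1 *)

Section StepDensity.
Variable R : realType.
Notation mu := (@lebesgue_measure R).
Implicit Types u v f g h : R -> R.

Definition integ u := mu.-integrable setT (EFin \o u).
Definition L1R u : R := \int[mu]_x `|u x|.

Lemma integ_lin (a : R) f g : integ f -> integ g -> integ (fun x => a * f x + g x).
Proof.
move=> hf hg; rewrite /integ.
have -> : EFin \o (fun x => a * f x + g x) = (fun x => a%:E * (EFin \o f) x)%E \+ (EFin \o g).
  by apply/funext => x /=; rewrite EFinD EFinM.
by apply: integrableD => //; exact: integrableZl.
Qed.

Lemma integ_add f g : integ f -> integ g -> integ (fun x => f x + g x).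
Proof.
move=> hf hg; rewrite /integ (_ : EFin \o _ = (EFin \o f) \+ (EFin \o g))%E//.
exact: integrableD.
Qed.

Lemma integ_sub f g : integ f -> integ g -> integ (fun x => f x - g x).
Proof.
move=> hf hg; have := integ_lin (-1) hg hf.
by rewrite (_ : (fun x => _) = (fun x => f x - g x))//; apply/funext => x; rewrite mulN1r addrC.
Qed.

Lemma integ_scale (a : R) f : integ f -> integ (fun x => a * f x).
Proof.
move=> hf; rewrite /integ (_ : EFin \o _ = (fun x => a%:E * (EFin \o f) x)%E).
  exact: integrableZl.
by apply/funext => x /=; rewrite EFinM.
Qed.

Lemma integ_abs f : integ f -> integ (fun x => `|f x|).
Proof. by move=> /integrable_norm. Qed.

Lemma L1R_le f g : integ f -> integ g -> (forall x, `|f x| <= `|g x|) -> L1R f <= L1R g.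
Proof.
by move=> hf hg fg; apply: le_Rintegral => //; exact: integ_abs.
Qed.

Lemma L1R_add f g : integ f -> integ g -> L1R (fun x => f x + g x) <= L1R f + L1R g.
Proof.
move=> hf hg; rewrite /L1R -RintegralD//; [|exact: integ_abs|exact: integ_abs].
apply: le_Rintegral => //.
- exact/integ_abs/integ_add.
- by apply: integ_add; exact: integ_abs.
- by move=> x _; exact: ler_normD.
Qed.

Lemma integ_patch f (A : set R) : measurable A -> mu.-integrable A (EFin \o f) -> integ (f \_ A).
Proof. by move=> mA; rewrite /integ -restrict_EFin => /integrable_mkcond; apply. Qed.

Lemma integ_patchT f (A : set R) : measurable A -> integ f -> integ (f \_ A).
Proof. by move=> mA hf; apply: integ_patch => //; exact: integrableS hf. Qed.

Lemma L1R_patch f (A : set R) : L1R (f \_ A) = \int[mu]_(x in A) `|f x|.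
Proof.
rewrite /L1R [RHS]Rintegral_mkcond; congr (Rintegral _ _ _); apply/funext => x.
by rewrite !patchE; case: ifPn => //; rewrite normr0.
Qed.

Definition cell (a b : R) : set R := `]a, b]%classic.

Definition cellC (a b : R) (y : R) : R[i] := (\1_(cell a b) y)%:C.

Lemma cell_meas a b : measurable (cell a b).
Proof. exact: measurable_itv. Qed.

Lemma integ_cell a b : integ (\1_(cell a b)).
Proof. exact: integrable_indic_itv. Qed.

Lemma cellE a b x : \1_(cell a b) x = ((a < x <= b)%R)%:R :> R.
Proof. by rewrite indicE /cell; congr (_%:R); rewrite mem_setE in_itv. Qed.

Lemma L1R_cell a b : a <= b -> L1R (\1_(cell a b)) = b - a.
Proof.
move=> ab; rewrite /L1R.
rewrite (_ : (fun x => `|\1_(cell a b) x|) = \1_(cell a b)); last first.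
  by apply/funext => x; rewrite cellE ger0_norm.
have mc : measurable (cell a b) by exact: measurable_itv.
have E := @lebesgue_measure_itv R `]a, b].
rewrite /Rintegral integral_indic// setIT [X in fine X]E /= lte_fin.
by case: ltP => h //=; apply/eqP; rewrite eq_sym subr_eq0 eq_le h ab.
Qed.

Lemma L1R_scale_cell (k : R) a b : a <= b -> L1R (fun x => k * \1_(cell a b) x) = `|k| * (b - a).
Proof.
move=> ab; rewrite -(L1R_cell ab) /L1R -RintegralZl//; last exact/integ_abs/integ_cell.
by congr (Rintegral _ _ _); apply/funext => x; rewrite normrM.
Qed.

(** A property of integrable functions that is stable under linear combinations and
limits in L^1 and that indicators of intervals have. *)
Variable D : (R -> R) -> Prop.
Hypothesis D_cell : forall a b, a <= b -> D (\1_(cell a b)).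
Hypothesis D_lin : forall (a : R) f g, integ f -> integ g -> D f -> D g -> D (fun x => a * f x + g x).
Hypothesis D_lim : forall u, integ u ->
  (forall e : R, 0 < e -> exists v, [/\ integ v, D v & L1R (fun x => u x - v x) <= e]) -> D u.

Let step_approx h (a b e : R) : a <= b -> continuous h -> 0 < e ->
  exists v, [/\ integ v, D v, forall x, a < x <= b -> `|h x - v x| <= e &
    forall x, ~~ (a < x <= b) -> v x = 0].
Proof.
move=> ab hc e0.
pose Q s t := exists v, [/\ integ v, D v, forall x, s < x <= t -> `|h x - v x| <= e &
    forall x, ~~ (s < x <= t) -> v x = 0].
apply: (@cousin R Q) => //.
  move=> s m t _ sm mt _ [v [iv Dv v1 v0]] [w [iw Dw w1 w0]].
  exists (fun x => 1 * v x + w x); split; [exact: integ_lin|exact: D_lin| |].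
    move=> x /andP[sx xt]; rewrite mul1r; have [xm|mx] := leP x m.
      by rewrite w0 ?addr0 ?v1 ?sx// ltNge xm.
    by rewrite v0 ?add0r ?w1 ?mx// [x <= m]leNgt mx andbF.
  move=> x nx; rewrite mul1r v0 ?w0 ?addr0//.
    by apply: contra nx => /andP[mx ->]; rewrite (le_lt_trans sm).
  by apply: contra nx => /andP[-> xm]; rewrite (le_trans xm).
move=> x _; have /cvgrPdist_le/(_ e e0) := hc x.
move=> /nbhs_ballP[d /= d0 hd_]; exists d => //.
move=> s t /andP[sx xt] ts _ _.
have st : s <= t by exact: le_trans xt.
have E0 y : \1_(cell s s) y = 0 :> R.
  by rewrite cellE; case: (ltP s y) => //= sy; rewrite leNgt sy.
exists (fun y => h x * \1_(cell s t) y + \1_(cell s s) y); split.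
- exact: (integ_lin _ (integ_cell _ _) (integ_cell _ _)).
- apply: D_lin; [exact: integ_cell|exact: integ_cell|exact: D_cell|exact: D_cell].
- move=> y /andP[sy yt]; rewrite E0 cellE sy yt /= mulr1 addr0 distrC.
  by apply: hd_; rewrite -ball_normE /= ltr_norml; apply/andP; split; lra.
- by move=> y ny; rewrite E0 cellE (negbTE ny) mulr0 addr0.
Qed.

Let cont_integ h (a b : R) : continuous h -> integ (h \_ (cell a b)).
Proof.
move=> hc; apply: integ_patch; first exact: measurable_itv.
have : mu.-integrable `[a, b]%classic (EFin \o h).
  apply: continuous_compact_integrable; first exact: segment_compact.
  exact: continuous_subspaceT.
apply: integrableS; [exact: measurable_itv|exact: measurable_itv|].
by apply: subset_itvr; rewrite bnd_simp.
Qed.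

Let D_cont h (M : R) : 0 < M -> continuous h -> D (h \_ (cell (- M) M)).
Proof.
move=> M0 hc; apply: D_lim; first exact: cont_integ.
move=> e e0; have MM : - M <= M by lra.
have M2 : 0 < 2 * M by rewrite mulr_gt0.
have e1 : 0 < e / (2 * M) by rewrite divr_gt0.
have [v [iv Dv v1 v0]] := step_approx MM hc e1.
exists v; split => //.
pose k := e / (2 * M).
apply: (@le_trans _ _ (L1R (fun x => k * \1_(cell (- M) M) x))).
  apply: L1R_le.
  - exact: integ_sub (cont_integ _ _ hc) iv.
  - exact: integ_scale (integ_cell _ _).
  - move=> x; rewrite patchE mem_setE in_itv /= cellE; case: ifPn => [xM|nx].
      by rewrite mulr1 (le_trans (v1 _ xM))// ler_norm.
    by rewrite v0// subr0 mulr0.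
rewrite L1R_scale_cell// ger0_norm ?(ltW e1)// /k.
by apply: eqW; field; rewrite gt_eqF.
Qed.

Let D_cut u (M : R) : 0 < M -> integ u -> D (u \_ (cell (- M) M)).
Proof.
move=> M0 iu; have mc := @cell_meas (- M) M.
apply: D_lim; first exact: integ_patchT.
move=> e e0; pose E := `[- M, M]%classic : set R.
have mE : measurable E by exact: measurable_itv.
have muE : (mu E < +oo)%E.
  by rewrite /E lebesgue_measure_itv /=; case: ifP => // _; rewrite -EFinB ltry.
have iE : mu.-integrable E (EFin \o u) by exact: integrableS iu.
have [g [gc gi]] := approximation_continuous_integrable mE muE iE.
move=> /fine_cvgP[[N1 _ fin1]] /cvgrPdist_le/(_ e e0)[N2 _ fin2].
pose n := maxn N1 N2; have := fin2 n (leq_maxr _ _).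
have := fin1 n (leq_maxl _ _); rewrite /= => fin.
rewrite sub0r normrN => h.
exists (g n \_ (cell (- M) M)); split; [exact: cont_integ|exact: D_cont|].
apply: le_trans h; apply: le_trans (ler_norm _).
have iug : mu.-integrable E (EFin \o (fun x => u x - g n x)).
  rewrite (_ : EFin \o _ = ((EFin \o u) \- (EFin \o g n))%E); last by apply/funext => x.
  exact: integrableB.
have -> : fine (\int[mu]_(z in E) `|(u z - g n z)%:E|) = L1R ((fun x => u x - g n x) \_ E).
  by rewrite L1R_patch.
apply: L1R_le.
- by apply: integ_sub; [exact: integ_patchT|exact: cont_integ].
- exact: integ_patch.
- move=> x; rewrite !patchE !mem_setE !in_itv /=.
  case: ifPn => [/andP[h1 h2]|_]; first by rewrite (ltW h1) h2.
  by rewrite subr0 normr0.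
Qed.

(** Continuous functions on a bounded interval are uniformly close to step functions
by Cousin's lemma, integrable functions on a bounded interval are close in L^1 to
continuous ones, and truncations converge by dominated convergence. *)
Lemma step_dense u : integ u -> D u.
Proof.
move=> iu; apply: D_lim => // e e0.
pose f n : R -> \bar R := EFin \o (u \_ (cell (- n.+1%:R) n.+1%:R)).
have mc n := @cell_meas (- n.+1%:R) n.+1%:R.
have mf n := measurable_int mu (integ_patchT (mc n) iu).
have mu_ := measurable_int mu iu.
have [||_ + _] := @dominated_convergence _ _ _ mu setT measurableT f (EFin \o u)
   (fun x => `|u x|%:E) mf mu_ _ (integ_abs iu) _.
- apply: aeW => x _; apply: cvg_near_cst.
  near=> n; rewrite /f /= patchE mem_setE in_itv /= ifT//.
  have : `|x| < n.+1%:R.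
    near: n; exists (Num.truncn `|x|) => // m /= hm.
    by rewrite (lt_le_trans (truncnS_gt _))// ler_nat ltnS.
  by rewrite ltr_norml => /andP[-> /ltW ->].
- apply: aeW => x n _; rewrite /f /= patchE lee_fin.
  by case: ifP => //; rewrite normr0.
move=> /fine_cvgP[[N _ fin1]] /cvgrPdist_le/(_ e e0)[N2 _ fin2].
pose n := maxn N N2; have := fin2 n (leq_maxr _ _).
rewrite /= sub0r normrN => h.
exists (u \_ (cell (- n.+1%:R) n.+1%:R)); split; [exact: integ_patchT|exact: D_cut|].
apply: le_trans h; apply: le_trans (ler_norm _).
rewrite /L1R /Rintegral le_eqVlt; apply/orP; left; apply/eqP; congr (fine _).
by apply: eq_integral => x _; rewrite /f /= distrC.
Unshelve. all: by end_near. Qed.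

End StepDensity.

(** * The operator defined by a Lipschitz function *)

Section Cumulative.
Variable R : realType.
Notation mu := (@lebesgue_measure R).
Implicit Types u f g : R -> R.

(** Used through its increments, the integrals of u over intervals ]x, y]. *)
Definition cumul u (x : R) : R := \int[mu]_(t in `]-oo, x]) u t.

Let mI (x : R) : measurable (`]-oo, x]%classic : set R).
Proof. exact: measurable_itv. Qed.

Let igI u x : integ u -> mu.-integrable (`]-oo, x]%classic : set R) (EFin \o u).
Proof. by move=> iu; apply: integrableS iu. Qed.

Lemma cumul_lin (a : R) f g x : integ f -> integ g ->
  cumul (fun y => a * f y + g y) x = a * cumul f x + cumul g x.
Proof.
move=> hf hg; rewrite /cumul RintegralD//; last 2 first.
- by apply: igI; exact: integ_scale.
- exact: igI.
by rewrite RintegralZl//; exact: igI.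
Qed.

Lemma cumul_abs u x y : integ u -> x <= y ->
  `|cumul u y - cumul u x| <= cumul (fun t => `|u t|) y - cumul (fun t => `|u t|) x.
Proof.
move=> iu xy; have ia := integ_abs iu.
rewrite /cumul !Rintegral_itvB ?bnd_simp//; [|exact: igI|exact: igI].
apply: le_normr_Rintegral; first exact: measurable_itv.
by apply: integrableS iu => //; exact: measurable_itv.
Qed.

Lemma cumul_ge0 u x : 0 <= cumul (fun t => `|u t|) x.
Proof. by apply: Rintegral_ge0 => t _. Qed.

Lemma cumul_le u x : integ u -> cumul (fun t => `|u t|) x <= L1R u.
Proof.
move=> iu; rewrite /cumul -L1R_patch; apply: L1R_le => //; first exact: integ_patchT.
by move=> t; rewrite patchE; case: ifPn => //; rewrite normr0.
Qed.

Lemma cumul_cell (a b x : R) : a <= b ->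
  cumul (\1_(cell a b)) x = Num.min b x - Num.min a x.
Proof.
move=> ab; rewrite /cumul /Rintegral integral_indic//; last exact: cell_meas.
have -> : cell a b `&` `]-oo, x]%classic = cell a (Num.min b x).
  apply/seteqP; split=> t; rewrite /cell /= !in_itv /= le_min.
    by move=> [/andP[-> ->] ->].
  by move=> /andP[-> /andP[-> ->]].
have E := @lebesgue_measure_itv R `]a, (Num.min b x)].
rewrite [X in fine X]E /= lte_fin; case: ltP => h /=.
  by congr (_ - _); apply/esym/min_idPl; move: h; rewrite lt_min => /andP[_ /ltW].
have [bx|xb] := leP b x.
  have -> : a = b by apply/eqP; rewrite eq_le ab; move: h; rewrite (min_idPl bx).
  by rewrite (min_idPl bx) subrr.
rewrite (min_idPr (ltW xb)) in h; rewrite (min_idPr h).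
by rewrite subrr.
Qed.

End Cumulative.

Section LipschitzOperator.
Variables (R : realType) (V : completeNormedModType R[i]).
Variables (G : R -> V) (c : R).
Hypothesis c0 : 0 <= c.
Hypothesis Glip : forall x y, rnorm (G y - G x) <= c * `|y - x|.
Implicit Types u f g : R -> R.

(* The points xk n k, for k <= Nn n, cut [- m n, m n] into cells of length
   1 / m n. *)
Let m (n : nat) : R := n.+1%:R.
Let m0 n : 0 < m n. Proof. by rewrite ltr0n. Qed.
Let xk (n k : nat) : R := - m n + k%:R / m n.
Let Nn (n : nat) : nat := (2 * n.+1 * n.+1)%N.

Let xkS n k : xk n k.+1 - xk n k = (m n)^-1.
Proof. by rewrite /xk -natr1; ring. Qed.

Let xkle n k : xk n k <= xk n k.+1.
Proof. by rewrite -subr_ge0 xkS invr_ge0 ltW. Qed.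

Let xk0 n : xk n 0 = - m n.
Proof. by rewrite /xk mul0r addr0. Qed.

Let xkN n : xk n (Nn n) = m n.
Proof. by rewrite /xk /Nn !natrM -/(m n); field; rewrite gt_eqF. Qed.

Let dG n k := G (xk n k.+1) - G (xk n k).

Let dG_le n k : rnorm (dG n k) <= c / m n.
Proof. by rewrite (le_trans (Glip _ _))// xkS ger0_norm// invr_ge0 ltW. Qed.

(** The sum over the cells of the mean value of u times the increment of G: it has
the sought value on functions that are constant on each cell.  All these operators
are bounded by c. *)
Let Tn (n : nat) u : V :=
  \sum_(k < Nn n) (m n * (cumul u (xk n k.+1) - cumul u (xk n k)))%:C *: dG n k.

Let Tn_lin n (a : R) f g : integ f -> integ g ->
  Tn n (fun y => a * f y + g y) = a%:C *: Tn n f + Tn n g.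
Proof.
move=> hf hg; rewrite /Tn scaler_sumr -big_split; apply: eq_bigr => k _ /=.
rewrite scalerA -rmorphM -scalerDl -rmorphD; congr (_%:C *: _).
by rewrite !cumul_lin//; ring.
Qed.

Let Tn_bound n u : integ u -> rnorm (Tn n u) <= c * L1R u.
Proof.
move=> iu; apply: le_trans (rnorm_sum _ _ _) _.
pose A k := cumul (fun t => `|u t|) (xk n k).
apply: (@le_trans _ _ (\sum_(k < Nn n) c * (A k.+1 - A k))).
  apply: ler_sum => k _; rewrite rnormZ cmodR normrM gtr0_norm//.
  have -> : c * (A k.+1 - A k) = m n * (A k.+1 - A k) * (c / m n).
    by field; rewrite gt_eqF.
  rewrite ler_pM ?rnorm_ge0// ?mulr_ge0 ?(ltW (m0 n))//.
  by rewrite ler_wpM2l ?(ltW (m0 n))//; exact: cumul_abs.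
rewrite -mulr_sumr ler_wpM2l//.
rewrite -(big_mkord xpredT (fun k => A k.+1 - A k)) telescope_sumr//.
by have := cumul_ge0 u (xk n 0); have := cumul_le (xk n (Nn n)) iu; rewrite /A; lra.
Qed.

(** The first K terms of [Tn n] applied to the indicator of ]-oo, b]; indicators of
bounded intervals are differences of two of these. *)
Let S n K (b : R) : V :=
  \sum_(k < K) (m n * (Num.min b (xk n k.+1) - Num.min b (xk n k)))%:C *: dG n k.

Let S_near n K b : xk n 0 <= b ->
  (xk n K <= b -> S n K b = G (xk n K) - G (xk n 0)) /\
  rnorm (S n K b - (G (Num.min b (xk n K)) - G (xk n 0))) <= 2 * (c / m n).
Proof.
move=> b0; have cm_ge0 : 0 <= c / m n by rewrite divr_ge0// ltW.
elim: K => [|K [IH1 IH2]].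
  rewrite /S big_ord0; split; first by rewrite subrr.
  by rewrite (min_idPr b0) !subrr rnorm0 mulr_ge0.
rewrite /S big_ord_recr /= -/(S n K b).
have [xb|] := boolP (xk n K.+1 <= b); last rewrite -ltNge => bx.
  have xb' : xk n K <= b by exact: le_trans (xkle n K) xb.
  have E : S n K b + (m n * (Num.min b (xk n K.+1) - Num.min b (xk n K)))%:C *: dG n K =
     G (xk n K.+1) - G (xk n 0).
    rewrite (min_idPr xb) (min_idPr xb') xkS mulfV ?gt_eqF// scale1r IH1// /dG.
    by rewrite addrC subrKA.
  by split => //; rewrite E (min_idPr xb) subrr rnorm0 mulr_ge0.
split => //.
rewrite (min_idPl (ltW bx)).
have [xb|] := boolP (xk n K <= b); last rewrite -ltNge => bx'; last first.
  rewrite (min_idPl (ltW bx')) in IH2 *.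
  by rewrite subrr mulr0 scale0r addr0.
rewrite (min_idPr xb) IH1//.
have -> : G (xk n K) - G (xk n 0) + (m n * (b - xk n K))%:C *: dG n K - (G b - G (xk n 0)) =
   (m n * (b - xk n K))%:C *: dG n K - (G b - G (xk n K)) by module; ring.
rewrite (le_trans (rnormB _ _))// mulr_natl mulr2n lerD//.
  rewrite rnormZ cmodR ger0_norm ?mulr_ge0 ?subr_ge0 ?(ltW (m0 n))//.
  rewrite -[leRHS]mul1r ler_pM ?rnorm_ge0 ?mulr_ge0 ?subr_ge0 ?(ltW (m0 n))//.
  rewrite mulrC -ler_pdivlMr// mul1r -(xkS n K); lra.
rewrite (le_trans (Glip _ _))// ler_wpM2l// -(xkS n K) ger0_norm ?subr_ge0//; lra.
Qed.

Definition avg_cvg u := exists v, rcvg (fun n => Tn n u) v.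

Let m_large (x : R) : exists N, forall n, (N <= n)%N -> x <= m n.
Proof.
exists (Num.truncn `|x|) => n hn; rewrite (le_trans (ler_norm x))//.
by rewrite ltW// (lt_le_trans (truncnS_gt _))// ler_nat ltnS.
Qed.

Let Tn_cell a b : a <= b -> rcvg (fun n => Tn n (\1_(cell a b))) (G b - G a).
Proof.
move=> ab e e0.
have [N1 h1] := m_large `|a|; have [N2 h2] := m_large `|b|.
have [N3 h3] := m_large (4 * c / e).
exists (maxn N1 (maxn N2 N3)) => n; rewrite !geq_max => /and3P[n1 n2 n3].
have := h1 n n1; rewrite ler_norml => /andP[a1 a2].
have := h2 n n2; rewrite ler_norml => /andP[b1 b2].
have {h3} := h3 n n3; rewrite ler_pdivrMr// => h3.
have E : Tn n (\1_(cell a b)) = S n (Nn n) b - S n (Nn n) a.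
  rewrite /Tn /S -sumrB; apply: eq_bigr => k _; rewrite -scalerBl -rmorphB.
  by congr (_%:C *: _); rewrite !cumul_cell//; ring.
have [|_ kb] := @S_near n (Nn n) b; first by rewrite xk0.
have [|_ ka] := @S_near n (Nn n) a; first by rewrite xk0.
rewrite xkN in ka kb; rewrite (min_idPl a2) in ka; rewrite (min_idPl b2) in kb.
have -> : Tn n (\1_(cell a b)) - (G b - G a) =
  (S n (Nn n) b - (G b - G (xk n 0))) - (S n (Nn n) a - (G a - G (xk n 0))).
  by rewrite E; module_over R[i]; ring.
rewrite (le_trans (rnormB _ _))//.
have : 4 * c / m n <= e by rewrite ler_pdivrMr// [e * _]mulrC.
move=> h; apply: le_trans h; apply: le_trans (lerD kb ka) _.
by apply: eqW; ring.
Qed.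

(** Convergence passes to limits in L^1 because the [Tn n] are uniformly bounded. *)
Let Tconv_all u : integ u -> avg_cvg u.
Proof.
apply: (@step_dense _ avg_cvg) => {u}.
- by move=> a b ab; exists (G b - G a); exact: Tn_cell.
- move=> a f g hf hg [v hv] [w hw]; exists (a%:C *: v + w).
  apply: (rcvg_ext (u := fun n => a%:C *: Tn n f + Tn n g)).
    by move=> n; rewrite Tn_lin.
  by apply: rcvgD => //; exact: rcvgZ.
- move=> u iu H; apply: rcvg_cauchy => e e0.
  have c1 : 0 < c + 1 by rewrite ltr_wpDl.
  have [|v [iv [l hl] uv]] := H (e / 4 / (c + 1)); first by rewrite !divr_gt0.
  have e4 : 0 < e / 4 by rewrite divr_gt0.
  have [N hN] := hl _ e4; exists N => n hn.
  have close k : rnorm (Tn k u - Tn k v) <= e / 4.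
    have -> : Tn k u - Tn k v = Tn k (fun x => u x - v x).
      have := Tn_lin k (-1) iv iu; rewrite rmorphN scaleN1r addrC => <-.
      by congr (Tn k _); apply/funext => x; rewrite mulN1r addrC.
    rewrite (le_trans (Tn_bound _ _))//; first exact: integ_sub.
    rewrite (le_trans (ler_wpM2l c0 uv))// mulrC small_mul// ltW//.
  have -> : Tn n u - Tn N u = (Tn n u - Tn n v) + (Tn n v - l) -
     ((Tn N u - Tn N v) + (Tn N v - l)) by module_over R[i]; ring.
  rewrite (le_trans (rnormB _ _))//.
  have -> : e = (e / 4 + e / 4) + (e / 4 + e / 4) by field.
  by rewrite lerD// (le_trans (rnormD _ _))// lerD// hN.
Qed.

Let Tr u : V := xget 0 [set v | rcvg (fun n => Tn n u) v].

Let TrP u : integ u -> rcvg (fun n => Tn n u) (Tr u).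
Proof.
move=> /Tconv_all[v hv]; rewrite /Tr; case: xgetP => [w _ //|/(_ v)].
by case.
Qed.

Let Tr_lin (a : R) f g : integ f -> integ g -> Tr (fun y => a * f y + g y) = a%:C *: Tr f + Tr g.
Proof.
move=> hf hg; apply: rcvg_uniq (TrP (integ_lin a hf hg)) _.
apply: (rcvg_ext (u := fun n => a%:C *: Tn n f + Tn n g)).
  by move=> n; rewrite Tn_lin.
by apply: rcvgD; [apply: rcvgZ|]; exact: TrP.
Qed.

Let Tr_bound u : integ u -> rnorm (Tr u) <= c * L1R u.
Proof. by move=> iu; apply: rcvg_le (TrP iu) _ => n; exact: Tn_bound. Qed.

Let Tr_cell a b : a <= b -> Tr (\1_(cell a b)) = G b - G a.
Proof. by move=> ab; apply: rcvg_uniq (TrP (integ_cell a b)) _; exact: Tn_cell. Qed.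

Lemma integ_cmod (u : R -> R[i]) : L1_function u -> integ (fun y => cmod (u y)).
Proof.
move=> [iR iI].
have mR := measurable_int _ iR; have mI := measurable_int _ iI.
apply: (@le_integrable _ _ _ (@lebesgue_measure R) setT measurableT
  (EFin \o (fun y => cmod (u y)))
  (fun y => (`|Re (u y)| + `|Im (u y)|)%:E)).
- apply/measurable_EFinP.
  rewrite (_ : (fun y => cmod (u y)) = (@Num.sqrt R) \o (fun y => Re (u y) ^+ 2 + Im (u y) ^+ 2)).
    apply: measurableT_comp.
      by apply: continuous_measurable_fun; exact: sqrt_continuous.
    by apply: measurable_funD; apply: measurable_funX; exact/measurable_EFinP.
  by apply/funext => y /=; rewrite -cmod_sqr sqrtr_sqr ger0_norm// cmod_ge0.
- move=> y _ /=; rewrite lee_fin ger0_norm ?cmod_ge0// (le_trans (cmod_le _))//.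
  by rewrite ler_norm.
- exact: integ_add (integ_abs iR) (integ_abs iI).
Qed.

(** The integral of u against dG.  A Lipschitz function with values in a Banach space
may be nowhere differentiable, so this operator replaces the derivative of G. *)
Lemma lipschitz_operator : exists2 T : (R -> R[i]) -> V, L1_continuous_linear T &
  forall a b, a <= b -> T (cellC a b) = G b - G a.
Proof.
exists (fun w : R -> R[i] => Tr (fun y => Re (w y)) + 'i%C *: Tr (fun y => Im (w y))).
  split.
    move=> z u v [uR uI] [vR vI]; case: z => a b.
    rewrite (_ : (fun y => Re ((a +i* b) * u y + v y)) =
      (fun y => a * Re (u y) + (- b * Im (u y) + Re (v y)))); last first.
      by apply/funext => y; case: (u y) (v y) => [p q] [r s] /=; ring.
    rewrite (_ : (fun y => Im ((a +i* b) * u y + v y)) =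
      (fun y => a * Im (u y) + (b * Re (u y) + Im (v y)))); last first.
      by apply/funext => y; case: (u y) (v y) => [p q] [r s] /=; ring.
    rewrite !Tr_lin//; try exact: integ_lin.
    have -> : a +i* b = a%:C + 'i%C * b%:C by exact: (complexE (a +i* b)).
    have i2 : 'i%C * 'i%C = -1 :> R[i] by rewrite -expr2 sqr_i.
    rewrite !scalerDr !scalerDl !scalerA rmorphN /=.
    have -> : 'i%C * b%:C * 'i%C = - b%:C :> R[i] by rewrite mulrAC i2 mulN1r.
    by module; ring.
  exists (2 * c) => u Lu; have iu := integ_cmod Lu; have [uR uI] := Lu.
  have nE : L1_norm u = L1R (fun y => cmod (u y)).
    by congr (Rintegral _ _ _); apply/funext => y; rewrite [RHS]ger0_norm ?cmod_ge0.
  rewrite le_rnorm (le_trans (rnormD _ _))// rnormZ cmodi mul1r nE.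
  have -> : 2 * c * L1R (fun y => cmod (u y)) = c * L1R (fun y => cmod (u y)) + c * L1R (fun y => cmod (u y)).
    by ring.
  rewrite lerD// (le_trans (Tr_bound _))// ler_wpM2l// L1R_le// => y.
    by rewrite (le_trans (le_cmod_Re _))// ler_norm.
  by rewrite (le_trans (le_cmod_Im _))// ler_norm.
move=> a b ab /=.
rewrite Tr_cell//.
have -> : Tr (fun=> 0) = 0.
  have := Tr_lin (-1) (integ_cell 0 0) (integ_cell 0 0).
  rewrite rmorphN scaleN1r addNr => <-; congr Tr; apply/funext => y.
  by rewrite mulN1r addNr.
by rewrite scaler0 addr0.
Qed.

End LipschitzOperator.

(** * Test functions and the space L^1 *)

Section TestFunctions.
Variable R : realType.
Implicit Types phi : R -> R[i].
Notation mu := (@lebesgue_measure R).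

Lemma test_deriv phi : test_function phi -> forall y : R, exists B : cplx R,
  deriv_in (@real_line R) (fun z => phi (Re z) : cplx R) y%:C B.
Proof.
move=> [sR sI _] y.
have hR := derivable_real_line (sR 0%N y); have hI := derivable_real_line (sI 0%N y).
eexists; have := deriv_inD hR (deriv_inZ ('i%C : R[i]) hI).
rewrite (_ : (fun w => _ + _) = (fun z => phi (Re z) : cplx R)); first exact.
by apply/funext => z; rewrite [RHS]complexE.
Qed.

Lemma test_cont phi : test_function phi -> forall y e : R, 0 < e ->
  exists2 d : R, 0 < d & forall x, `|x - y| < d -> cmod (phi x - phi y) <= e.
Proof.
move=> tp y e e0; have [B /deriv_in_cont /(_ e e0)[d d0 h]] := test_deriv tp y.
exists d => // x xy; apply: (h x%:C) => //.
by rewrite -rmorphB cmodR.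
Qed.

Lemma test_supp phi : test_function phi -> exists2 M : R, 0 < M &
  forall y, ~~ (- M < y <= M) -> phi y = 0.
Proof.
move=> [_ _ /compact_bounded/ex_strict_bound_gt0[M M0 hM]]; exists M => //.
move=> y ny; apply/eqP; apply: contraNT ny => nz.
have : `|y| < M by apply: hM; exact: subset_closure.
by rewrite ltr_norml => /andP[-> /ltW ->].
Qed.

Lemma supp_integ (u : R -> R) (M : R) : 0 < M -> (forall x, derivable u x 1) ->
  (forall y, ~~ (- M < y <= M) -> u y = 0) -> integ u.
Proof.
move=> M0 du u0.
have -> : u = u \_ (cell (- M) M).
  apply/funext => y; rewrite patchE mem_setE in_itv /=.
  by case: ifPn => // /u0.
apply: integ_patch; first exact: cell_meas.
have : mu.-integrable `[- M, M]%classic (EFin \o u).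
  apply: continuous_compact_integrable; first exact: segment_compact.
  apply: continuous_subspaceT => x.
  exact/differentiable_continuous/derivable1_diffP.
apply: integrableS; [exact: measurable_itv|exact: measurable_itv|].
by apply: subset_itvr; rewrite bnd_simp.
Qed.

Lemma L1_function_test phi : test_function phi -> L1_function phi.
Proof.
move=> tp; have [M M0 hM] := test_supp tp; have [sR sI _] := tp.
by split; apply: (supp_integ M0) => [x|y /hM ->//]; [exact: (sR 0%N x)|exact: (sI 0%N x)].
Qed.

Lemma L1_function_cell (a b : R) : L1_function (cellC a b).
Proof.
split => /=; first exact: integ_cell.
by have := integ_scale 0 (integ_cell a b); congr (_.-integrable _ _); apply/funext => y; rewrite /= mul0r.
Qed.

Lemma L1_function_lin (c : R[i]) (u v : R -> R[i]) : L1_function u -> L1_function v ->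
  L1_function (fun y => c * u y + v y).
Proof.
case: c => a b [uR uI] [vR vI]; split;
  [have := integ_lin a uR (integ_lin (- b) uI vR)|have := integ_lin a uI (integ_lin b uR vI)];
  congr (_.-integrable _ _); apply/funext => y /=;
  by case: (u y) (v y) => [p q] [r s] /=; congr (_%:E); ring.
Qed.

Lemma L1_functionB (u v : R -> R[i]) : L1_function u -> L1_function v -> L1_function (fun y => u y - v y).
Proof.
move=> hu hv; have := L1_function_lin (-1) hv hu.
by rewrite (_ : (fun y => -1 * _ + _) = (fun y => u y - v y))//; apply/funext => y; rewrite mulN1r addrC.
Qed.

Lemma L1_norm_le (u : R -> R[i]) (w : R -> R) : L1_function u -> integ w ->
  (forall y, cmod (u y) <= w y) -> L1_norm u <= L1R w.
Proof.
move=> Lu iw uw; apply: le_Rintegral => //; first exact: integ_cmod.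
  exact: integ_abs.
by move=> y _; rewrite -[Re _]/(cmod (u y)) (le_trans (uw y))// ler_norm.
Qed.

Lemma L1_norm_cell (u : R -> R[i]) (a b e : R) : a <= b -> 0 <= e -> L1_function u ->
  (forall y, a < y <= b -> cmod (u y) <= e) -> (forall y, ~~ (a < y <= b) -> u y = 0) ->
  L1_norm u <= e * (b - a).
Proof.
move=> ab e0 Lu h1 h0; rewrite -[e in leRHS]ger0_norm// -L1R_scale_cell//.
apply: L1_norm_le => //; first exact: integ_scale (integ_cell _ _).
move=> y; rewrite cellE; case: (boolP (a < y <= b)) => [/h1|/h0 ->]; first by rewrite mulr1.
by rewrite mulr0 cmod0.
Qed.

Lemma smooth0 : smooth (fun=> 0 : R).
Proof.
move=> n x; rewrite (_ : derive1n n (fun=> 0) = (fun=> 0)); first exact: derivable_cst.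
elim: n => // n IH; rewrite /derive1n iterS -/(derive1n n _) IH.
by apply/funext => y; rewrite derive1_cst.
Qed.

Lemma bump_test (a b e : R) : a < b -> 0 < e -> exists phi : R -> R,
  [/\ test_function (fun y => (phi y)%:C), forall x, 0 <= phi x <= 1,
   forall x, ~~ (a < x < b) -> phi x = 0 &
   forall x, a + e <= x <= b - e -> 1 - e <= phi x].
Proof.
move=> ab e0; have [phi [sp p1 p0 pe]] := smooth_bump ab e0.
exists phi; split => //; split => //=; first exact: smooth0.
apply: (@subclosed_compact _ _ `[a, b]%classic).
- exact: closed_closure.
- exact: segment_compact.
- rewrite [X in _ `<=` X](closure_id _).1; last exact: itv_closed.
  apply: closure_subset => y /=; rewrite in_itv /=.
  apply: contraNT => ny; apply/eqP; congr (_%:C); apply: p0.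
  by apply: contra ny => /andP[/ltW -> /ltW ->].
Qed.

Lemma at_rightP (V : normedModType R[i]) (F : R -> V) (l : V) :
  F e @[e --> 0^'+] --> l <-> forall r : R, 0 < r -> exists2 d : R, 0 < d &
    forall e, 0 < e < d -> rnorm (F e - l) <= r.
Proof.
split=> [/cvgrPdist_le H r r0|H].
  have := H r%:C; rewrite ltcR => /(_ r0).
  rewrite near_withinE => /nbhs_ballP[d /= d0 hd_]; exists d => // e /andP[e0 ed].
  have := hd_ e; rewrite -ball_normE /= sub0r normrN gtr0_norm// => /(_ ed e0).
  by rewrite le_rnorm rnormC.
apply/cvgrPdist_le => _ /complex_gt0E[r r0 ->]; have [d d0 hd_] := H r r0.
rewrite near_withinE; apply/nbhs_ballP; exists d => // e.
rewrite -ball_normE /= sub0r normrN => ed e0.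
by rewrite le_rnorm rnormC; apply: hd_; rewrite e0 -(gtr0_norm e0).
Qed.

Lemma L1_op_sub (V : normedModType R[i]) (T : (R -> R[i]) -> V) (u v : R -> R[i]) :
  L1_continuous_linear T -> L1_function u -> L1_function v ->
  T (fun y => u y - v y) = T u - T v.
Proof.
move=> [TL _] hu hv; have := TL (-1) v u hv hu.
rewrite scaleN1r addrC => <-; congr T; apply/funext => y.
by rewrite mulN1r addrC.
Qed.

End TestFunctions.

(** * Vertical lines and primitives on the strip *)

Section VerticalLines.
Variable R : realType.
Local Notation C := (R[i]).
Variable S : completeNormedModType R[i].
Variable f : C -> S.
Hypothesis hf : holo (@open_strip R) f.

Lemma open_strip_convex : convex_in (@open_strip R).
Proof.
move=> a b /andP[a0 a1] /andP[b0 b1] z.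
pose x1 := Num.min (Re a) (Re b).
pose x2 := Num.max (Re a) (Re b).
have aS : strip x1 x2 a by rewrite /strip /= ge_min le_max !lexx.
have bS : strip x1 x2 b by rewrite /strip /= ge_min le_max !lexx !orbT.
move=> /(strip_convex aS bS)/andP[z1 z2]; apply/andP; split.
  by rewrite (lt_le_trans _ z1)// lt_min a0.
by rewrite (le_lt_trans z2)// gt_max a1.
Qed.

Lemma holo_open z : open_strip z -> exists B, deriv_in setT f z B.
Proof.
move=> zO; have [B hB] := hf zO; have [r r0 hr] := open_strip_open zO.
by exists B; exact: (deriv_in_open r0 hr hB).
Qed.

Lemma vlineE (x y : R) : x%:C + 'i%C * y%:C = x +i* y :> C.
Proof. by rewrite [RHS]complexE. Qed.

Lemma vline_deriv (x y : R) (h : C -> S) B : deriv_in setT h (x +i* y) B ->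
  deriv_in (@real_line R) (fun z => h (x%:C + 'i%C * z)) y%:C ('i%C *: B).
Proof.
move=> H; apply: (deriv_in_affine (D := setT)) => //.
by rewrite vlineE.
Qed.

(** Extended from the line to the plane by the projection z |-> Re z, as relative
derivatives and segment integrals are defined for functions on the plane. *)
Definition line_fun (phi : R -> C) (x : R) : C -> S :=
  fun z => phi (Re z) *: f (x%:C + 'i%C * z).

Definition line_prim phi x : C -> S := segint (line_fun phi x) 0.

Lemma line_funE phi x (y : R) : line_fun phi x y%:C = phi y *: f (x +i* y).
Proof. by rewrite /line_fun vlineE. Qed.

Lemma line_fun_holo phi x : test_function phi -> 0 < x < 1 -> holo (@real_line R) (line_fun phi x).
Proof.
move=> tp x01 z zR; rewrite (real_lineE zR); set y := Re z.
have [b hb] := test_deriv tp y.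
have [B hB] := @holo_open (x +i* y) x01.
by eexists; apply: (deriv_inM hb); exact: vline_deriv hB.
Qed.

Lemma line_prim_deriv phi x (y : R) : test_function phi -> 0 < x < 1 ->
  deriv_in (@real_line R) (line_prim phi x) y%:C (phi y *: f (x +i* y)).
Proof.
move=> tp x01; rewrite -line_funE.
by apply: (segint_primitive (@real_line_convex R) (@real_line_closed R) (line_fun_holo tp x01)).
Qed.

Lemma line_prim_integral phi x (a b : R) : test_function phi -> 0 < x < 1 -> a <= b ->
  (forall y, ~~ (a < y <= b) -> phi y = 0) ->
  line_integral (fun y => phi y *: f (x +i* y)) = line_prim phi x b%:C - line_prim phi x a%:C.
Proof.
move=> tp x01 ab h0; apply: line_integralE => //.
- by move=> y; exact: line_prim_deriv.
- move=> y e e0; have [B /deriv_in_cont /(_ e e0)[d d0 h]] := line_fun_holo tp x01 (real_line_R y).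
  exists d => // t ty; have := h t%:C (real_line_R t); rewrite !line_funE; apply.
  by rewrite -rmorphB cmodR.
- move=> y ny; rewrite h0 ?scale0r//; apply/negP => /andP[h1 h2].
  by apply: ny; rewrite (ltW h1) h2.
Qed.

End VerticalLines.

Section Extension.
Variable R : realType.
Local Notation C := (R[i]).
Variable S : completeNormedModType R[i].
Variables (f : C -> S) (M : R).
Hypothesis hf : holo (@open_strip R) f.
Hypothesis M0 : 0 <= M.
Hypothesis fM : forall z, open_strip z -> rnorm (f z) <= M.

Definition strip_prim : C -> S := segint f (2^-1)%:C.

Lemma strip_prim_deriv z : open_strip z -> deriv_in setT strip_prim z (f z).
Proof.
move=> zO; have [d d0 [h1 h2]] := open_stripP zO.
pose x1 := Num.min (Re z - d) 2^-1; pose x2 := Num.max (Re z + d) 2^-1.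
have sub : strip (Re z - d) (Re z + d) `<=` strip x1 x2.
  move=> w /andP[w1 w2]; apply/andP; split.
    by rewrite (le_trans _ w1)// ge_min lexx.
  by rewrite (le_trans w2)// le_max lexx.
have lo : 0 < Re z - d /\ Re z + d < 1.
  have /andP[p1 _] : open_strip ((Re z - d)%:C : C).
    by apply: h2; rewrite /strip /= lexx /=; lra.
  have /andP[_ p2] : open_strip ((Re z + d)%:C : C).
    by apply: h2; rewrite /strip /= lexx andbT; lra.
  by [].
have subO : strip x1 x2 `<=` @open_strip R.
  move=> w /andP[w1 w2]; apply/andP; split.
    by rewrite (lt_le_trans _ w1)// lt_min lo.1; lra.
  by rewrite (le_lt_trans w2)// gt_max lo.2; lra.
have hD : holo (strip x1 x2) f.
  move=> w wD; have [B hB] := hf (subO _ wD).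
  by exists B; exact: deriv_in_sub subO hB.
apply: (deriv_in_open d0 (D := strip x1 x2)).
  by move=> w wz; apply/sub/h1; rewrite ltW.
apply: (segint_primitive (@strip_convex R _ _) (@strip_closed R _ _) hD).
  by apply/andP; split; [rewrite ge_min lexx orbT|rewrite le_max lexx orbT].
by apply/sub/h1; rewrite subrr cmod0 ltW.
Qed.

Lemma strip_prim_lip z w : open_strip z -> open_strip w -> rnorm (strip_prim w - strip_prim z) <= M * cmod (w - z).
Proof.
move=> zO wO; apply: mean_value => u /(@open_strip_convex R _ _ zO wO) uO.
by exists (f u); [exact: deriv_in_sub (strip_prim_deriv uO)|exact: fM].
Qed.

(** The contraction of ratio 1 - s towards the line Re z = 1/2. *)
Definition shrink (s : R) (z : C) : C := z + (s * (2^-1 - Re z))%:C.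

Lemma shrink_open_strip s (z : C) : 0 < s <= 1 -> closed_strip z -> open_strip (shrink s z).
Proof.
move=> /andP[s0 s1] /andP[z0 z1]; rewrite /open_strip /shrink /= ReD /=.
move: (Re z) z0 z1 => x x0 x1.
have h1 : 0 <= (1 - s) * x by rewrite mulr_ge0// subr_ge0.
have h2 : 0 <= (1 - s) * (1 - x) by rewrite mulr_ge0// subr_ge0.
by apply/andP; split; lra.
Qed.

Let half_le (z : C) : closed_strip z -> `|2^-1 - Re z| <= 1.
Proof. by move=> /andP[z0 z1]; rewrite ler_norml; apply/andP; split; lra. Qed.

Lemma shrink_shrink s t (z : C) : closed_strip z -> cmod (shrink s z - shrink t z) <= `|s - t|.
Proof.
move=> /half_le h; rewrite /shrink.
have -> : z + (s * (2^-1 - Re z))%:C - (z + (t * (2^-1 - Re z))%:C) =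
  ((s - t) * (2^-1 - Re z))%:C.
  by rewrite opprD addrACA subrr add0r -rmorphB mulrBl.
by rewrite cmodR normrM -[leRHS]mulr1 ler_wpM2l.
Qed.

Let sn (n : nat) : R := n.+1%:R^-1.
Let sn01 n : 0 < sn n <= 1.
Proof. by rewrite invr_gt0 ltr0n /= invf_le1 ?ltr0n// ler1n. Qed.

Let sn_small (e : R) : 0 < e -> exists N, forall n, (N <= n)%N -> sn n <= e.
Proof.
move=> e0; exists (Num.truncn e^-1) => n hn.
rewrite -[e]invrK lef_pV2 ?posrE ?ltr0n ?invr_gt0//.
by rewrite ltW// (lt_le_trans (truncnS_gt _))// ler_nat ltnS.
Qed.

(** The continuous extension of the Lipschitz function [strip_prim f] to the closed
strip. *)
Definition strip_ext (z : C) : S := xget 0 [set v | rcvg (fun n => strip_prim (shrink (sn n) z)) v].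

Let strip_ext_cvg z : closed_strip z -> rcvg (fun n => strip_prim (shrink (sn n) z)) (strip_ext z).
Proof.
move=> zS; rewrite /strip_ext; case: xgetP => [v _ //|/forallNP N].
exfalso; suff [l hl] : exists l, rcvg (fun n => strip_prim (shrink (sn n) z)) l by case: N; exists l.
apply: rcvg_cauchy => e e0.
have M1 : 0 < M + 1 by rewrite ltr_wpDl.
have [K hK] := sn_small (divr_gt0 e0 M1); exists K => n Kn.
rewrite (le_trans (strip_prim_lip _ _))//; try exact: shrink_open_strip.
have h1 : cmod (shrink (sn n) z - shrink (sn K) z) <= e / (M + 1).
  rewrite (le_trans (shrink_shrink _ _ zS))// ler_norml.
  have /andP[p1 _] := sn01 n; have /andP[p2 _] := sn01 K.
  by have := hK n Kn; have := hK K (leqnn _) => q1 q2; apply/andP; split; lra.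
rewrite (le_trans (ler_wpM2l M0 h1))// mulrC small_mul// ltW//.
Qed.

Lemma strip_ext_near s z : 0 < s <= 1 -> closed_strip z -> rnorm (strip_prim (shrink s z) - strip_ext z) <= M * s.
Proof.
move=> s01 zS; apply/ler_addgt0Pr => e e0; have e2 : 0 < e / 2 by rewrite divr_gt0.
have [N1 h1] := strip_ext_cvg zS e2.
have M1 : 0 < M + 1 by rewrite ltr_wpDl.
have [N2 h2] := sn_small (divr_gt0 e2 M1).
pose n := maxn N1 N2; have {}h1 := h1 n (leq_maxl _ _); have {}h2 := h2 n (leq_maxr _ _).
rewrite (le_trans (rnorm_tri (strip_prim (shrink (sn n) z)) _ _))//.
have -> : M * s + e = (M * s + e / 2) + e / 2 by field.
rewrite lerD//.
rewrite (le_trans (strip_prim_lip _ _))//; try exact: shrink_open_strip.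
have h3 : cmod (shrink s z - shrink (sn n) z) <= s + sn n.
  rewrite (le_trans (shrink_shrink _ _ zS))// (le_trans (ler_normB _ _))//.
  by move: s01 (sn01 n) => /andP[s0 _] /andP[n0 _]; rewrite !gtr0_norm.
apply: le_trans (ler_wpM2l M0 h3) _; rewrite mulrDr lerD2l.
by rewrite (le_trans (ler_wpM2l M0 h2))// mulrC small_mul// ltW.
Qed.

Lemma strip_ext_open z : open_strip z -> strip_ext z = strip_prim z.
Proof.
move=> zO; have zS := open_closed_strip zO.
apply/subr0_eq/rnorm_small => e e0.
have [s s01 se] := unit_small_mul e0 (mulr_ge0 (ler0n R 2) M0).
have /andP[s0 _] := s01.
rewrite rnormC (le_trans (rnorm_tri (strip_prim (shrink s z)) _ _))//.
have h1 := strip_ext_near s01 zS.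
have h2 : rnorm (strip_prim z - strip_prim (shrink s z)) <= M * s.
  rewrite rnormC; apply: le_trans (strip_prim_lip zO (shrink_open_strip s01 zS)) _.
  rewrite ler_wpM2l// /shrink addrC addKr cmodR normrM (gtr0_norm s0).
  by rewrite -[leRHS]mulr1 ler_wpM2l ?(ltW s0)// half_le.
apply: le_trans (lerD h2 h1) _.
by have -> : M * s + M * s = s * (2 * M) by ring.
Qed.

Lemma strip_ext_lip z w : closed_strip z -> closed_strip w -> rnorm (strip_ext w - strip_ext z) <= M * cmod (w - z).
Proof.
move=> zS wS; apply/ler_addgt0Pr => e e0.
have [s s01 se] := unit_small_mul e0 (mulr_ge0 (ler0n R 3) M0).
have /andP[s0 _] := s01.
have h1 := strip_ext_near s01 zS; have h2 := strip_ext_near s01 wS; rewrite rnormC in h2.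
have h3 := strip_prim_lip (shrink_open_strip s01 zS) (shrink_open_strip s01 wS).
have h4 : cmod (shrink s w - shrink s z) <= cmod (w - z) + s.
  have -> : shrink s w - shrink s z = (w - z) + (s * (Re z - Re w))%:C.
    rewrite /shrink !rmorphM !rmorphB /=; ring.
  rewrite (le_trans (cmodD _ _))// lerD2l cmodR normrM (gtr0_norm s0).
  rewrite -[leRHS]mulr1 ler_wpM2l ?(ltW s0)//.
  by move: zS wS => /andP[z0 z1] /andP[w0 w1]; rewrite ler_norml; apply/andP; split; lra.
rewrite (le_trans (rnorm_tri (strip_prim (shrink s w)) _ _))//.
apply: le_trans (lerD h2 (rnorm_tri (strip_prim (shrink s z)) _ _)) _.
apply: le_trans (lerD (lexx _) (lerD (le_trans h3 (ler_wpM2l M0 h4)) h1)) _.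
have -> : M * s + (M * (cmod (w - z) + s) + M * s) = M * cmod (w - z) + s * (3 * M) by ring.
by rewrite lerD2l.
Qed.

End Extension.

(** * Boundary increments of the primitive *)

Lemma L1_norm_ge0 (R : realType) (u : R -> R[i]) : 0 <= L1_norm u.
Proof. by apply: Rintegral_ge0 => y _; exact: cmod_ge0. Qed.

Lemma L1_op_bound (R : realType) (V : normedModType R[i]) (T : (R -> R[i]) -> V) :
  L1_continuous_linear T ->
  exists2 M : R, 0 <= M & forall u, L1_function u -> rnorm (T u) <= M * L1_norm u.
Proof.
move=> [_ [M hM]]; exists `|M| => // u /hM; rewrite le_rnorm => /le_trans; apply.
by rewrite ler_wpM2r ?L1_norm_ge0// ler_norm.
Qed.

Section BoundaryIncrement.
Variable R : realType.
Local Notation C := (R[i]).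
Variables (S V : completeNormedModType R[i]) (inc : {linear V -> S}).
Hypothesis inc_le : forall a, rnorm (inc a) <= rnorm a.
Variables (f : C -> S) (M : R).
Hypothesis hf : holo (@open_strip R) f.
Hypothesis M0 : 0 <= M.
Hypothesis fM : forall z, open_strip z -> rnorm (f z) <= M.
(* rho e is the abscissa at distance e from the side Re z = kappa: both sides of
   the strip are treated at once. *)
Variables (rho : R -> R) (kappa : R).
Hypothesis k01 : 0 <= kappa <= 1.
Hypothesis rhoE : forall e y : R, rho e +i* y = shrink (2 * e) (kappa +i* y).
Variable T : (R -> C) -> V.
Hypothesis HT : L1_continuous_linear T.
Hypothesis Hlim : forall phi, test_function phi -> forall r : R, 0 < r ->
  exists2 d : R, 0 < d & forall e, 0 < e < d ->
    rnorm (line_integral (fun y => phi y *: f (rho e +i* y)) - inc (T phi)) <= r.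

Let kS (y : R) : closed_strip (kappa +i* y). Proof. exact: k01. Qed.

Let rho01 e : 0 < e -> 2 * e <= 1 -> 0 < rho e < 1.
Proof.
move=> e0 e1; have : open_strip (rho e +i* 0 : C).
  by rewrite rhoE; apply: shrink_open_strip => //; rewrite e1 mulr_gt0.
by [].
Qed.

Let bump_L1 (phi : R -> R) (a b e : R) : 0 < e -> 2 * e <= b - a ->
  L1_function (fun y => (phi y)%:C) -> (forall x, 0 <= phi x <= 1) ->
  (forall x, ~~ (a < x < b) -> phi x = 0) ->
  (forall x, a + e <= x <= b - e -> 1 - e <= phi x) ->
  L1_norm (fun y => (phi y)%:C - cellC a b y) <= e * (2 + (b - a)).
Proof.
move=> e0 eab Lphi p1 p0 pe.
pose w x := \1_(cell a (a + e)) x + (e * \1_(cell a b) x + \1_(cell (b - e) b) x) : R.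
have ab : a <= b by lra.
have i1 : integ (fun x => e * \1_(cell a b) x + \1_(cell (b - e) b) x).
  exact: (integ_lin _ (integ_cell _ _) (integ_cell _ _)).
have iw : integ w by exact: integ_add (integ_cell a (a + e)) i1.
apply: (@le_trans _ _ (L1R w)).
  apply: L1_norm_le => //; first by apply: L1_functionB => //; exact: L1_function_cell.
  move=> x; rewrite /cellC -rmorphB cmodR /w !cellE.
  have /andP[q0 q1] := p1 x.
  have [xa|ax] := leP x a.
    by rewrite p0 /= ?subrr ?normr0 ?mulr0 ?addr0 ?add0r ?ler0n//; rewrite ltNge xa.
  have [xb|bx] := leP x b; last first.
    by rewrite p0 /= ?subrr ?normr0 ?mulr0 ?addr0 ?add0r ?ler0n// ax /= -leNgt ltW.
  rewrite /= mulr1.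
  have h1 : `|phi x - 1| <= 1 by rewrite ler_norml; apply/andP; split; lra.
  have [xe|ex] := leP x (a + e).
    by rewrite (le_trans h1)// lerDl addr_ge0 ?ler0n// ltW.
  rewrite add0r; have [bx|xbe] := ltP (b - e) x.
    by rewrite (le_trans h1)// lerDr ltW.
  rewrite addr0; have := pe x; rewrite (ltW ex) xbe => /(_ isT) q2.
  by rewrite ler_norml; apply/andP; split; lra.
have -> : e * (2 + (b - a)) = e + (e * (b - a) + e) by ring.
apply: le_trans (L1R_add (integ_cell _ _) i1) _.
rewrite L1R_cell; last by rewrite lerDl ltW.
rewrite [a + e]addrC addrK lerD2l.
apply: le_trans (L1R_add (integ_scale _ (integ_cell _ _)) (integ_cell _ _)) _.
rewrite L1R_scale_cell// (gtr0_norm e0) lerD2l L1R_cell; last by rewrite gerBl ltW.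
by rewrite opprB addrCA subrr addr0.
Qed.

(** On the line Re z = rho e, close to the side, the increment of the primitive and
i times the integral of phi f differ by the integral of i (1 - phi) f, which is
small when phi is a bump close to the indicator of ]a, b]; and the integral of
phi f is close to T(phi), hence to the value of T on that indicator. *)
Lemma strip_ext_increment (a b : R) : a < b ->
  strip_ext f (kappa +i* b) - strip_ext f (kappa +i* a) =
  'i%C *: inc (T (cellC a b)).
Proof.
move=> ab; have [MT MT0 hMT] := L1_op_bound HT.
pose L := b - a; have L0 : 0 < L by rewrite subr_gt0.
pose K := 4 * M + M * L + 1 + MT * (2 + L).
have L0' := ltW L0.
have K0 : 0 <= K.
  have h1 : 0 <= M * L by exact: mulr_ge0.
  have h2 : 0 <= MT * (2 + L) by apply: mulr_ge0 => //; lra.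
  have h3 : 0 <= 4 * M by exact: mulr_ge0.
  by apply: addr_ge0 => //; apply: addr_ge0 => //; exact: addr_ge0.
have K1 : 0 < K + 1 by rewrite ltr_wpDl.
apply/subr0_eq/rnorm_small => dl dl0.
have dK : 0 < dl / (K + 1) by rewrite divr_gt0.
pose e := Num.min (Num.min 1 (L / 2)) (dl / (K + 1)).
have e0 : 0 < e by rewrite !lt_min ltr01 divr_gt0.
have e1 : e <= 1 by rewrite !ge_min lexx.
have eL : e <= L / 2 by rewrite !ge_min lexx orbT.
have edl : e <= dl / (K + 1) by rewrite !ge_min lexx !orbT.
suff : rnorm (strip_ext f (kappa +i* b) - strip_ext f (kappa +i* a) -
    'i%C *: inc (T (cellC a b))) <= e * K.
  move=> /le_trans; apply; apply: le_trans (ler_wpM2r K0 edl) _.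
  by rewrite small_mul// ltW.
have [phi [tphi p1 p0 pe]] := bump_test ab e0.
have [d d0 hd_] := Hlim tphi e0.
pose ep := Num.min d e / 4.
have m0 : 0 < Num.min d e by rewrite lt_min d0.
have md : Num.min d e <= d by rewrite ge_min lexx.
have me : Num.min d e <= e by rewrite ge_min lexx orbT.
have ep0 : 0 < ep by rewrite divr_gt0.
have epd : ep < d by rewrite /ep; lra.
have epe : 2 * ep <= e by rewrite /ep; lra.
have r01 : 0 < rho ep < 1 by apply: rho01 => //; lra.
have s01 : 0 < 2 * ep <= 1 by rewrite mulr_gt0//=; lra.
have B1 y : rnorm (strip_prim f (rho ep +i* y) - strip_ext f (kappa +i* y)) <= M * e.
  rewrite rhoE; apply: le_trans (strip_ext_near hf M0 fM s01 (kS y)) _.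
  by rewrite ler_wpM2l.
pose P := line_prim f (fun y => (phi y)%:C) (rho ep).
have cphi x : ~~ (a < x <= b) -> (phi x)%:C = 0 :> C.
  move=> nx; rewrite p0//; apply: contra nx => /andP[-> xb].
  exact: ltW.
have LI := line_prim_integral hf tphi r01 (ltW ab) cphi.
have B3 : rnorm (P b%:C - P a%:C - inc (T (fun y => (phi y)%:C))) <= e.
  by rewrite -LI; apply: hd_; rewrite ep0.
have B4 : rnorm (inc (T (fun y => (phi y)%:C)) - inc (T (cellC a b))) <=
   MT * (e * (2 + L)).
  have Lp := L1_function_test tphi; have Lc := @L1_function_cell R a b.
  rewrite -linearB (le_trans (inc_le _))// -(L1_op_sub HT Lp Lc).
  rewrite (le_trans (hMT _ _))//; first exact: L1_functionB.
  rewrite ler_wpM2l//; apply: bump_L1 => //.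
  by move: eL; rewrite /L; lra.
(* Q is a primitive of i (1 - phi) f: on the two end pieces of length e the factor
   1 - phi is at most 1, in between at most e *)
have B2 : rnorm (strip_prim f (rho ep +i* b) - strip_prim f (rho ep +i* a) - 'i%C *: (P b%:C - P a%:C)) <=
   M * e + M * e * L + M * e.
  pose F y := ('i%C * (1 - (phi y)%:C)) *: f (rho ep +i* y).
  pose Q (z : C) := strip_prim f ((rho ep)%:C + 'i%C * z) - 'i%C *: P z.
  have QF (y : R) : deriv_in (@real_line R) Q y%:C (F y).
    have -> : F y = 'i%C *: f (rho ep +i* y) - 'i%C *: ((phi y)%:C *: f (rho ep +i* y)).
      by rewrite /F; module; ring.
    apply: deriv_inB; first by apply: vline_deriv; apply: strip_prim_deriv.
    by apply: deriv_inZ; exact: line_prim_deriv.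
  have FM y (t : R) : `|1 - phi y| <= t -> rnorm (F y) <= M * t.
    move=> h; have E : 1 - (phi y)%:C = (1 - phi y)%:C :> C by rewrite rmorphB rmorph1.
    rewrite /F rnormZ cmodM cmodi mul1r E cmodR mulrC.
    by rewrite ler_pM ?rnorm_ge0//; exact: fM.
  have one y : `|1 - phi y| <= 1.
    by have /andP[q0 q1] := p1 y; rewrite ler_norml; apply/andP; split; lra.
  have ae : a <= a + e by rewrite lerDl ltW.
  have aebe : a + e <= b - e by move: eL; rewrite /L; lra.
  have be : b - e <= b by rewrite gerBl ltW.
  have c1 := mean_value_real QF ae (fun y _ => FM y 1 (one y)).
  have c3 := mean_value_real QF be (fun y _ => FM y 1 (one y)).
  have c2 : rnorm (Q (b - e)%:C - Q (a + e)%:C) <= M * e * (b - e - (a + e)).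
    apply: (mean_value_real QF aebe) => y /pe q; apply: FM.
    by have /andP[q0 q1] := p1 y; rewrite ler_norml; apply/andP; split; lra.
  have -> : strip_prim f (rho ep +i* b) - strip_prim f (rho ep +i* a) - 'i%C *: (P b%:C - P a%:C) =
    (Q (a + e)%:C - Q a%:C) + (Q (b - e)%:C - Q (a + e)%:C) + (Q b%:C - Q (b - e)%:C).
    have -> : (Q (a + e)%:C - Q a%:C) + (Q (b - e)%:C - Q (a + e)%:C) + (Q b%:C - Q (b - e)%:C) =
       Q b%:C - Q a%:C by module_over R[i]; ring.
    by rewrite /Q !vlineE; module; ring.
  rewrite (le_trans (rnormD _ _))// lerD//; last first.
    by apply: le_trans c3 _; rewrite mulr1 opprB addrC subrK.
  rewrite (le_trans (rnormD _ _))// lerD//.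
    by apply: le_trans c1 _; rewrite mulr1 addrAC subrr add0r.
  apply: le_trans c2 _; rewrite ler_wpM2l ?mulr_ge0 ?(ltW e0)//.
  by rewrite /L; lra.
have -> : strip_ext f (kappa +i* b) - strip_ext f (kappa +i* a) -
    'i%C *: inc (T (cellC a b)) =
  (strip_prim f (rho ep +i* b) - strip_prim f (rho ep +i* a) - 'i%C *: (P b%:C - P a%:C)) +
  ('i%C *: (P b%:C - P a%:C - inc (T (fun y => (phi y)%:C))) +
   'i%C *: (inc (T (fun y => (phi y)%:C)) - inc (T (cellC a b)))) +
  ((strip_prim f (rho ep +i* a) - strip_ext f (kappa +i* a)) -
   (strip_prim f (rho ep +i* b) - strip_ext f (kappa +i* b))).
  by module; ring.
rewrite (le_trans (rnormD _ _))//.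
have -> : e * K = (M * e + M * e * L + M * e) + (e + MT * (e * (2 + L))) + (M * e + M * e).
  by rewrite /K; ring.
rewrite lerD//; last by rewrite (le_trans (rnormB _ _))// lerD.
rewrite (le_trans (rnormD _ _))// lerD//.
by rewrite (le_trans (rnormD _ _))// !rnormZ cmodi !mul1r lerD.
Qed.

Lemma strip_ext_lipschitz_into : exists c : R, forall y t : R, exists2 a : V,
  strip_ext f (kappa +i* (y + t)) - strip_ext f (kappa +i* y) = inc a & `|a| <= (c * `|t|)%:C.
Proof.
have [MT MT0 hMT] := L1_op_bound HT.
have cellb (a b : R) : a < b -> rnorm (T (cellC a b)) <= MT * (b - a).
  move=> ab; apply: le_trans (hMT _ (@L1_function_cell R a b)) _.
  rewrite ler_wpM2l//; have := @L1_norm_cell _ (cellC a b) a b 1.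
  rewrite mul1r; apply => //; first exact: ltW.
  - exact: L1_function_cell.
  - by move=> y h; rewrite /cellC cellE h cmodR normr1.
  - by move=> y h; rewrite /cellC cellE (negbTE h).
exists MT => y t; have [t0|t0|->] := ltgtP t 0.
- exists (- ('i%C *: T (cellC (y + t) y))).
    rewrite linearN linearZZ -strip_ext_increment; last by rewrite gtrDl.
    by rewrite opprB.
  rewrite le_rnorm rnormN rnormZ cmodi mul1r (le_trans (cellb _ _ _)) ?gtrDl//.
  by rewrite opprD addNKr ltr0_norm.
- exists ('i%C *: T (cellC y (y + t))).
    by rewrite linearZZ -strip_ext_increment// ltrDl.
  rewrite le_rnorm rnormZ cmodi mul1r (le_trans (cellb _ _ _)) ?ltrDl//.
  by rewrite addrAC subrr add0r gtr0_norm.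
- by exists 0; [rewrite addr0 subrr linear0|rewrite le_rnorm rnorm0 normr0 mulr0].
Qed.

End BoundaryIncrement.

(** * Boundary values of the derivative *)

Section BoundaryValue.
Variable R : realType.
Local Notation C := (R[i]).
Variables (S V : completeNormedModType R[i]) (inc : {linear V -> S}).
Hypothesis inc_le : forall a, rnorm (inc a) <= rnorm a.
Hypothesis inc_inj : injective inc.
Variables (g f : C -> S) (M : R).
Hypothesis gc : forall z, closed_strip z -> cont_in (@closed_strip R) g z.
Hypothesis gf : forall z, open_strip z -> deriv_in setT g z (f z).
Hypothesis hf : holo (@open_strip R) f.
Hypothesis M0 : 0 <= M.
Hypothesis fM : forall z, open_strip z -> rnorm (f z) <= M.
(* The abscissa rho e tends to that of the side Re z = kappa: both sides of the
   strip are treated at once. *)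
Variables (rho : R -> R) (kappa : R).
Hypothesis k01 : 0 <= kappa <= 1.
Hypothesis rho01 : forall e, 0 < e < 1 -> 0 < rho e < 1.
Hypothesis rho_near : forall e, 0 < e < 1 -> `|rho e - kappa| <= e.
Variable c : R.
Hypothesis glip : forall y t : R, exists2 a : V,
  g (kappa +i* (y + t)) - g (kappa +i* y) = inc a & `|a| <= (c * `|t|)%:C.

Let primitive : exists2 G : R -> V,
  forall x y, inc (G y - G x) = g (kappa +i* y) - g (kappa +i* x) &
  forall x y, rnorm (G y - G x) <= `|c| * `|y - x|.
Proof.
have /choice[G hG] : forall y, exists a, inc a = g (kappa +i* y) - g (kappa +i* 0).
  by move=> y; have [a ha _] := glip 0 y; rewrite add0r in ha; exists a.
have GE x y : inc (G y - G x) = g (kappa +i* y) - g (kappa +i* x).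
  by rewrite linearB !hG opprB addrA subrK.
exists G => // x y; have [a] := glip x (y - x).
rewrite [x + _]addrC subrK -GE => /inc_inj <-; rewrite le_rnorm => /le_trans; apply.
by rewrite ler_wpM2r// ler_norm.
Qed.

(** Up to the factor -i, T is the operator of the Lipschitz primitive G.  For a step
function v close to phi, the integral of v f over the line Re z = rho e is a
combination of increments of g, which converges to T(v) since g is continuous up
to the boundary.  The error made by replacing phi with v is controlled by the bound
of f on the line, and by the norm of T in the limit. *)
Lemma boundary_value_exists : exists2 T : (R -> C) -> V, L1_continuous_linear T &
  forall phi, test_function phi -> forall r : R, 0 < r ->
  exists2 d : R, 0 < d & forall e, 0 < e < d ->
    rnorm (line_integral (fun y => phi y *: f (rho e +i* y)) - inc (T phi)) <= r.
Proof.
have [G GE Glip] := primitive.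
have [T0 HT0 T0cell] := lipschitz_operator (normr_ge0 c) Glip.
pose T u := (- 'i%C : C) *: T0 u.
have HT : L1_continuous_linear T.
  have [L [B hB]] := HT0; split.
    by move=> a u v hu hv; rewrite /T L//; module; ring.
  exists B => u /hB; rewrite !le_rnorm /T rnormZ cmodN cmodi mul1r; exact.
exists T => // phi tphi r r0.
have [MT MT0 hMT] := L1_op_bound HT.
have [N N0 phi0] := test_supp tphi.
pose K := M * (2 * N) + MT * (2 * N).
have N2 : 0 <= 2 * N by rewrite mulr_ge0// ltW.
have K0 : 0 <= K by rewrite addr_ge0// mulr_ge0.
have K1 : 0 < K + 1 by rewrite ltr_wpDl.
pose e' := r / 2 / (K + 1); have e'0 : 0 < e' by rewrite !divr_gt0.
pose P e : C -> S := line_prim f phi (rho e).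
(* v is a step function on ]s, t] and A e the integral of v f over the line
   Re z = rho e, written with increments of g *)
pose Q s t := exists v, exists A : R -> S,
  [/\ L1_function v, forall y, s < y <= t -> cmod (phi y - v y) <= e',
   forall y, ~~ (s < y <= t) -> v y = 0,
   forall e, 0 < e < 1 -> rnorm (P e t%:C - P e s%:C - A e) <= M * e' * (t - s) &
   forall r, 0 < r -> exists2 d : R, 0 < d & forall e, 0 < e < d -> rnorm (A e - inc (T v)) <= r].
have [|||v [A [Lv v1 v0 vA vT]]] := @cousin R Q (- N) N.
- by lra.
- move=> s m t _ sm mt _ [v [A [Lv v1 v0 vA vT]]] [w [B [Lw w1 w0 wB wT]]].
  exists (fun y => 1 * v y + w y), (fun e => A e + B e); split.
  + exact: L1_function_lin.
  + move=> y /andP[sy yt]; rewrite mul1r; have [ym|my] := leP y m.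
      by rewrite w0 ?addr0 ?v1 ?sy// ltNge ym.
    by rewrite v0 ?add0r ?w1 ?my// [y <= m]leNgt my andbF.
  + move=> y ny; rewrite mul1r v0 ?w0 ?addr0//.
      by apply: contra ny => /andP[my ->]; rewrite (le_lt_trans sm).
    by apply: contra ny => /andP[-> ym]; rewrite (le_trans ym).
  + move=> e e01.
    have -> : P e t%:C - P e s%:C - (A e + B e) =
       (P e m%:C - P e s%:C - A e) + (P e t%:C - P e m%:C - B e).
      by module_over R[i]; ring.
    rewrite (le_trans (rnormD _ _))// (le_trans (lerD (vA e e01) (wB e e01)))//.
    by rewrite -mulrDr addrC subrKA.
  + move=> q q0; have q2 : 0 < q / 2 by rewrite divr_gt0.
    have [d d0 h] := vT _ q2; have [d' d'0 h'] := wT _ q2.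
    exists (Num.min d d'); first by rewrite lt_min d0.
    move=> e /andP[e0]; rewrite lt_min => /andP[ed ed'].
    have [TL _] := HT; rewrite (TL 1 v w Lv Lw) scale1r linearD opprD addrACA.
    by rewrite (le_trans (rnormD _ _))// [leRHS]splitr lerD ?h ?h' ?e0.
- move=> x _; have [d d0 hd_] := test_cont tphi x e'0.
  exists d => // s t /andP[sx xt] ts _ _; have st : s <= t by exact: le_trans xt.
  have E0 y : cellC s s y = 0.
    rewrite /cellC cellE; case: (ltP s y) => //= sy; rewrite leNgt sy//.
  exists (fun y => phi x * cellC s t y + cellC s s y).
  exists (fun e => phi x *: ((- 'i%C : C) *: (g (rho e +i* t) - g (rho e +i* s)))); split.
  + by apply: L1_function_lin; exact: L1_function_cell.
  + move=> y /andP[sy yt]; rewrite E0 addr0 /cellC cellE sy yt mulr1.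
    by apply: hd_; rewrite ltr_norml; apply/andP; split; lra.
  + by move=> y ny; rewrite E0 addr0 /cellC cellE (negbTE ny) mulr0.
  + move=> e e01.
    pose Q' (z : C) := P e z - phi x *: ((- 'i%C : C) *: g ((rho e)%:C + 'i%C * z)).
    have HQ (y : R) : deriv_in (@real_line R) Q' y%:C ((phi y - phi x) *: f (rho e +i* y)).
      have -> : (phi y - phi x) *: f (rho e +i* y) = phi y *: f (rho e +i* y) -
          phi x *: ((- 'i%C : C) *: ('i%C *: f (rho e +i* y))).
        have -> : (- 'i%C : C) *: ('i%C *: f (rho e +i* y)) = f (rho e +i* y).
          by rewrite scalerA mulNr -expr2 sqr_i opprK scale1r.
        by module; ring.
      apply: deriv_inB; first by apply: line_prim_deriv => //; exact: rho01.
      do 2 apply: deriv_inZ; apply: vline_deriv; apply: gf; exact: rho01.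
    have -> : P e t%:C - P e s%:C -
        phi x *: ((- 'i%C : C) *: (g (rho e +i* t) - g (rho e +i* s))) = Q' t%:C - Q' s%:C.
      by rewrite /Q' !vlineE; module; ring.
    apply: (mean_value_real HQ st) => y /andP[sy yt]; rewrite rnormZ mulrC.
    rewrite ler_pM ?rnorm_ge0 ?cmod_ge0//; first by apply: fM; exact: rho01.
    by apply: hd_; rewrite ltr_norml; apply/andP; split; lra.
  + move=> q q0.
    have TE : inc (T (fun y => phi x * cellC s t y + cellC s s y)) =
        phi x *: ((- 'i%C : C) *: (g (kappa +i* t) - g (kappa +i* s))).
      have [TL _] := HT; rewrite (TL (phi x) _ _ (@L1_function_cell R s t) (@L1_function_cell R s s)).
      rewrite /T (T0cell _ _ st) (T0cell s s (lexx s)) subrr scaler0 addr0 -GE.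
      by rewrite (linearZZ inc) (linearZZ inc).
    rewrite TE.
    have p1 : 0 < cmod (phi x) + 1 by rewrite ltr_wpDl ?cmod_ge0.
    have q1 : 0 < q / (cmod (phi x) + 1) / 2 by rewrite !divr_gt0.
    have kS y : closed_strip (kappa +i* y) by exact: k01.
    have [d1 d10 h1] := gc (kS t) q1; have [d2 d20 h2] := gc (kS s) q1.
    exists (Num.min 1 (Num.min d1 d2)); first by rewrite !lt_min ltr01 d10.
    move=> e /andP[e0]; rewrite !lt_min => /and3P[e1 ed1 ed2].
    have e01 : 0 < e < 1 by rewrite e0.
    have rS y : closed_strip (rho e +i* y).
      by apply: open_closed_strip; exact: rho01.
    have rk (y : R) : cmod ((rho e +i* y) - (kappa +i* y)) <= e.
      rewrite (le_trans (cmod_le _))//= subrr normr0 addr0; exact: rho_near.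
    rewrite -!scalerBr !rnormZ cmodN cmodi mul1r.
    have -> : g (rho e +i* t) - g (rho e +i* s) - (g (kappa +i* t) - g (kappa +i* s)) =
      (g (rho e +i* t) - g (kappa +i* t)) - (g (rho e +i* s) - g (kappa +i* s)).
      by module_over R[i]; ring.
    have k1 := h1 _ (rS t) (le_lt_trans (rk t) ed1).
    have k2 := h2 _ (rS s) (le_lt_trans (rk s) ed2).
    apply: le_trans (ler_wpM2l (cmod_ge0 _) (le_trans (rnormB _ _) (lerD k1 k2))) _.
    by rewrite -splitr mulrC small_mul ?cmod_ge0// ltW.
have r2 : 0 < r / 2 by rewrite divr_gt0.
have [d d0 hd_] := vT _ r2.
exists (Num.min 1 d); first by rewrite lt_min ltr01.
move=> e /andP[e0]; rewrite lt_min => /andP[e1 ed].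
have e01 : 0 < e < 1 by rewrite e0.
have NN : - N <= N by lra.
rewrite (line_prim_integral hf tphi (rho01 e01) NN phi0) -/(P e).
have Lp := L1_function_test tphi.
have h1 := vA e e01.
have h2 : rnorm (A e - inc (T v)) <= r / 2 by apply: hd_; rewrite e0.
have h3 : rnorm (inc (T v) - inc (T phi)) <= MT * (e' * (2 * N)).
  rewrite rnormC -linearB (le_trans (inc_le _))// -(L1_op_sub HT Lp Lv).
  rewrite (le_trans (hMT _ _))//; first exact: L1_functionB.
  rewrite ler_wpM2l// (_ : 2 * N = N - - N); last by ring.
  apply: L1_norm_cell => //; [exact: ltW|exact: L1_functionB|].
  by move=> y ny; rewrite v0// phi0// subrr.
have -> : P e N%:C - P e (- N)%:C - inc (T phi) =
  (P e N%:C - P e (- N)%:C - A e) + (A e - inc (T v)) + (inc (T v) - inc (T phi)).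
  by module_over R[i]; ring.
rewrite (le_trans (rnormD _ _))// (le_trans (lerD (rnormD _ _) (lexx _)))//.
apply: le_trans (lerD (lerD h1 h2) h3) _.
have -> : M * e' * (N - - N) + r / 2 + MT * (e' * (2 * N)) = e' * K + r / 2.
  by rewrite /K; ring.
by rewrite [leRHS]splitr lerD2r /e' small_mul// ltW.
Qed.

End BoundaryValue.

Section Distribution.
Variable R : realType.
Local Notation C := (R[i]).
Variables (S V : completeNormedModType R[i]) (inc : {linear V -> S}).
Hypothesis inc_le : forall a, rnorm (inc a) <= rnorm a.
Variable T : (R -> C) -> V.
Hypothesis HT : L1_continuous_linear T.

(** A distribution of order 0, since on functions supported in a fixed compact set the
L^1 norm is bounded by the supremum. *)
Lemma L1_is_distribution : is_distribution (fun phi => inc (T phi)).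
Proof.
have [MT MT0 hMT] := L1_op_bound HT.
split.
  move=> c phi psi tphi tpsi; have [TL _] := HT.
  by rewrite (TL c phi psi (L1_function_test tphi) (L1_function_test tpsi)) linearP.
move=> K /compact_bounded/ex_strict_bound_gt0[N N0 hN].
exists 0%N, (MT * (2 * N)) => phi tphi sK B hB.
have cB y : cmod (phi y) <= B.
  have := hB 0%N y (leqnn _); rewrite /cderive1n /= cmodE lecR.
  by case: (phi y).
have B0 : 0 <= B by rewrite (le_trans (cmod_ge0 _) (cB 0)).
rewrite le_rnorm (le_trans (inc_le _))// (le_trans (hMT _ (L1_function_test tphi)))//.
rewrite -mulrA ler_wpM2l// mulrC (_ : 2 * N = N - - N); last by ring.
apply: L1_norm_cell => //; [by lra|exact: L1_function_test|].
move=> y ny; apply/eqP; apply: contraNT ny => nz.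
have : `|y| < N by apply: hN; exact: sK.
by rewrite ltr_norml => /andP[-> /ltW ->].
Qed.

End Distribution.

(** * The two inclusions *)

Section Continuity.
Variables (R : realType) (S : completeNormedModType R[i]).

Lemma within_cont_inP (g : R[i]^o -> S) :
  {within @closed_strip R, continuous g} <->
  (forall z : R[i], closed_strip z -> cont_in (@closed_strip R) (g : R[i] -> S) z).
Proof.
split=> [/subspace_continuousP H z zS e e0|H].
  have /cvgrPdist_le/(_ e%:C) := H z zS; rewrite ltcR => /(_ e0).
  rewrite near_withinE => /nbhs_ballP[_ /= /complex_gt0E[d d0 ->] hd_].
  exists d => // w wS wz; have := hd_ w; rewrite le_rnorm rnormC; apply => //.
  by apply/ball_rnorm; rewrite rnormC.
apply/subspace_continuousP => z zS; apply/cvgrPdist_le => _ /complex_gt0E[e e0 ->].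
have [d d0 hd_] := H z zS e e0.
rewrite near_withinE; apply/nbhs_ballP; exists d%:C; first by rewrite /= ltcR.
move=> w /ball_rnorm wz wS; rewrite le_rnorm rnormC; apply: hd_ => //.
by rewrite cmodB; exact: wz.
Qed.

End Continuity.

Section Inclusions.
Variables (R : realType) (X : compatiblePair R).

Lemma incl0_le (a : space0 X) : rnorm (incl0 a) <= rnorm a.
Proof.
have := sum_norm_le a (0 : space1 X).
by rewrite linear0 addr0 normr0 addr0 rnormE lecR -[sum_norm _]/(Re (sum_norm _)%:C) -sum_normE.
Qed.

Lemma incl1_le (a : space1 X) : rnorm (incl1 a) <= rnorm a.
Proof.
have := sum_norm_le (0 : space0 X) a.
by rewrite linear0 add0r normr0 add0r rnormE lecR -[sum_norm _]/(Re (sum_norm _)%:C) -sum_normE.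
Qed.

Lemma incl0_inj : injective (@incl0 R X).
Proof. by move=> a b /(congr1 (@sum_val R X)) /= /emb0_inj. Qed.

Lemma incl1_inj : injective (@incl1 R X).
Proof. by move=> a b /(congr1 (@sum_val R X)) /= /emb1_inj. Qed.

End Inclusions.

Section Inclusion.
Variables (R : realType) (X : compatiblePair R).
Local Notation C := (R[i]).
Local Notation S := (sumSpace X).

(** The function g is the extended primitive of f. *)
Lemma Hinfty_calderon2 (f : C -> S) (z0 : C) : Hinfty X f -> open_strip z0 ->
  exists2 g : C -> S, Bspace X g & derive1 (g : R[i]^o -> S) z0 = f z0.
Proof.
move=> [[hol [M0 fM0]] [h0 [_ bv0] [T0 HT0 h0T]] [h1 [_ bv1] [T1 HT1 h1T]]] z0O.
have hf : holo (@open_strip R) f.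
  move=> z zO; exists (derive1 (f : R[i]^o -> S) z).
  by apply: (deriv_in_sub (D := setT)) => //; apply: derivable_deriv_in; exact: hol.
pose M := `|M0|; have M_ge0 : 0 <= M by exact: normr_ge0.
have fM z : open_strip z -> rnorm (f z) <= M.
  by move=> /fM0; rewrite le_rnorm => /le_trans; apply; exact: ler_norm.
pose g := strip_ext f.
have ghd z : open_strip z -> deriv_in setT g z (f z).
  move=> zO; have [d d0 hd_] := open_strip_open zO.
  apply: (@deriv_in_local _ _ setT setT (strip_prim f) _ _ _ d) => //.
    by move=> w _ /hd_ wO; split => //; rewrite /g (strip_ext_open hf M_ge0 fM).
  exact: strip_prim_deriv.
have glip := strip_ext_lip hf M_ge0 fM.
exists g; last by have [] := deriv_in_derivable (ghd _ z0O).
split.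
- apply/within_cont_inP => z zS e e0; have M1 : 0 < M + 1 by rewrite ltr_wpDl.
  exists (e / (M + 1)); first by rewrite divr_gt0.
  move=> w wS wz; rewrite (le_trans (glip _ _ zS wS))//.
  by rewrite (le_trans (ler_wpM2l M_ge0 (ltW wz)))// mulrC small_mul// ltW.
- by move=> z zO; have [] := deriv_in_derivable (ghd z zO).
- pose c : C := (2^-1)%:C.
  have cS : closed_strip c by apply/andP; split; rewrite /=; lra.
  exists (rnorm (g c) + 2 * M), 1 => z zS; set y := `|Im z|.
  move=> y1; rewrite le_rnorm.
  have hz : rnorm (g z) <= rnorm (g z - g c) + rnorm (g c) by rewrite -{1}(subrK (g c) (g z)) rnormD.
  apply: le_trans hz _; have zc := glip _ _ cS zS.
  have zc1 : cmod (z - c) <= 1 + y.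
    rewrite (le_trans (cmod_le _))// ImB /= subr0 lerD// ReB /=.
    by move: zS => /andP[q0 q1]; rewrite ler_norml; apply/andP; split; lra.
  apply: le_trans (lerD (le_trans zc (ler_wpM2l M_ge0 zc1)) (lexx _)) _.
  have p1 : 0 <= M * (y - 1) by rewrite mulr_ge0// subr_ge0.
  have p2 : 0 <= rnorm (g c) * (y - 1) by rewrite mulr_ge0 ?rnorm_ge0// subr_ge0.
  by move: p1 p2; lra.
- have rhoE e y : e +i* y = shrink (2 * e) (0 +i* y) :> C.
    by apply/eqP; rewrite /shrink eq_complex /= add0r addr0 eqxx andbT; apply/eqP; field.
  apply: (@strip_ext_lipschitz_into R S (space0 X) (@incl0 R X) (@incl0_le R X) f M hf M_ge0 fM id 0 _ rhoE T0 HT0).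
    by rewrite lexx ler01.
  by move=> phi tphi; have := (at_rightP _ _).1 (bv0 phi tphi); rewrite h0T.
- have rhoE e y : (1 - e) +i* y = shrink (2 * e) (1 +i* y) :> C.
    by apply/eqP; rewrite /shrink eq_complex /= addr0 eqxx andbT; apply/eqP; field.
  apply: (@strip_ext_lipschitz_into R S (space1 X) (@incl1 R X) (@incl1_le R X) f M hf M_ge0 fM
    (fun e => 1 - e) 1 _ rhoE T1 HT1).
    by rewrite lexx ler01.
  by move=> phi tphi; have := (at_rightP _ _).1 (bv1 phi tphi); rewrite h1T.
Qed.

(** The vertical differences g(z + i t) - g(z) are controlled on the boundary by the
Lipschitz conditions, hence everywhere, and they control g' in the limit. *)
Lemma Bspace_derivative (g : C -> S) : Bspace X g ->
  Hinfty X (fun z => derive1 (g : R[i]^o -> S) z).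
Proof.
move=> [/within_cont_inP gc hol [M0 [Y0 gr]] [c0 lip0] [c1 lip1]].
pose f z := derive1 (g : R[i]^o -> S) z.
have ghd z : open_strip z -> deriv_in setT g z (f z) by move=> zO; apply: derivable_deriv_in; exact: hol.
have hf : holo (@open_strip R) f by exact: holo_derivative ghd.
have hg : holo (@open_strip R) g.
  by move=> z zO; exists (f z); apply: (deriv_in_sub (D := setT)) => //; exact: ghd.
pose c := Num.max `|c0| `|c1|.
have c_ge0 : 0 <= c by rewrite le_max normr_ge0.
have cc0 : c0 <= c by rewrite le_max ler_norm.
have cc1 : c1 <= c by rewrite le_max ler_norm orbT.
have diff (t : R) z : closed_strip z -> rnorm (g (0 +i* t + z) - g z) <= c * `|t|.
  pose M := `|M0|; have M_ge0 : 0 <= M by exact: normr_ge0.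
  have mul1 w : 0 +i* t + w = 0 +i* t + 1 * w by rewrite mul1r.
  have Sh w : closed_strip w -> closed_strip (0 +i* t + w) by rewrite /closed_strip /= ReD /= add0r.
  have Oh w : open_strip w -> open_strip (0 +i* t + w) by rewrite /open_strip /= ReD /= add0r.
  apply: (@phragmen_lindelof R S (fun z => g (0 +i* t + z) - g z) (c * `|t|) (M * (2 + `|t|)) (`|Y0| + `|t|)).
  - by rewrite mulr_ge0.
  - move=> w wS e e0; have e2 : 0 < e / 2 by rewrite divr_gt0.
    have [d d0 h] := gc _ (Sh w wS) _ e2; have [d' d'0 h'] := gc _ wS _ e2.
    exists (Num.min d d'); first by rewrite lt_min d0.
    move=> u uS; rewrite lt_min => /andP[ud ud'].
    have k1 := h _ (Sh u uS); have k2 := h' _ uS ud'.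
    have E : 0 +i* t + u - (0 +i* t + w) = u - w by ring.
    rewrite E in k1.
    have -> : g (0 +i* t + u) - g u - (g (0 +i* t + w) - g w) =
      (g (0 +i* t + u) - g (0 +i* t + w)) - (g u - g w) by module_over R[i]; ring.
    by rewrite (le_trans (rnormB _ _))// [leRHS]splitr lerD// k1.
  - move=> w wO; exists (f (0 +i* t + w) - f w); apply: deriv_inB.
      have := @deriv_in_affine R S setT (@open_strip R) g (0 +i* t) 1 w (f (0 +i* t + w)).
      rewrite -mul1 scale1r (_ : (fun u => g (0 +i* t + 1 * u)) = (fun u => g (0 +i* t + u))).
        by apply => //; exact/ghd/Oh.
      by apply/funext => u; rewrite mul1r.
    by apply: (deriv_in_sub (D := setT)) => //; exact: ghd.
  - case=> x y wS [] /= ->.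
      have -> : 0 +i* t + (0 +i* y) = 0 +i* (y + t) :> C.
        by apply/eqP; rewrite eq_complex /= addr0 addrC !eqxx.
      have [a -> ha] := lip0 y t; apply: le_trans (incl0_le _) _.
      by move: ha; rewrite le_rnorm => /le_trans; apply; rewrite ler_wpM2r.
    have -> : 0 +i* t + (1 +i* y) = 1 +i* (y + t) :> C.
      by apply/eqP; rewrite eq_complex /= add0r addrC !eqxx.
    have [a -> ha] := lip1 y t; apply: le_trans (incl1_le _) _.
    by move: ha; rewrite le_rnorm => /le_trans; apply; rewrite ler_wpM2r.
  - move=> w wS; set y := `|Im w| => hy.
    have gro u : closed_strip u -> `|Y0| <= `|Im u| -> rnorm (g u) <= M * `|Im u|.
      move=> uS hu; have h := gr u uS.
      have := h (le_trans (ler_norm _) hu).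
      rewrite le_rnorm => /le_trans; apply.
      by rewrite ler_wpM2r// ler_norm.
    have imE : Im (0 +i* t + w) = t + Im w by rewrite ImD.
    have a1 : `|Im (0 +i* t + w)| <= `|t| + y by rewrite imE ler_normD.
    have a2 : y <= `|Im (0 +i* t + w)| + `|t|.
      rewrite imE /y -{1}[Im w](addKr t) addrC.
      by rewrite (le_trans (ler_normB _ _)).
    have t0 := normr_ge0 t; have y0 := normr_ge0 (Im w); rewrite -/y in y0.
    have b1 := gro _ (Sh _ wS) ltac:(lra).
    have b2 := gro _ wS ltac:(rewrite -/y; lra); rewrite -/y in b2.
    apply: le_trans (rnormB _ _) _; apply: le_trans (lerD b1 b2) _.
    have b3 := ler_wpM2l M_ge0 a1.
    have p1 : 0 <= M * (`|t| * y) by rewrite !mulr_ge0.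
    by move: b3 p1 M_ge0; lra.
have fc z : open_strip z -> rnorm (f z) <= c.
  move=> zO; apply/ler_addgt0Pr => e e0.
  have zS := open_closed_strip zO.
  have [d d0 hd_] := ghd z zO e e0.
  pose t := d / 2; have t0 : 0 < t by rewrite divr_gt0.
  have E : 0 +i* t + z - z = 0 +i* t :> C by rewrite addrK.
  have cE : cmod (0 +i* t : C) = t.
    have -> : 0 +i* t = 'i%C * t%:C :> C by rewrite [LHS]complexE /= rmorph0 add0r.
    by rewrite cmodM cmodi mul1r cmodR gtr0_norm.
  have := hd_ (0 +i* t + z) I; rewrite E cE => /(_ ltac:(rewrite /t; lra)) h.
  have k : rnorm ((0 +i* t : C) *: f z) <= (c + e) * t.
    have -> : (0 +i* t : C) *: f z = (g (0 +i* t + z) - g z) -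
       (g (0 +i* t + z) - g z - (0 +i* t : C) *: f z) by rewrite opprB addrCA subrr addr0.
    rewrite (le_trans (rnormB _ _))// mulrDl lerD//.
    by rewrite -[t in leRHS](gtr0_norm t0) diff.
  by move: k; rewrite rnormZ cE mulrC ler_pM2r.
have r0 (e : R) : 0 < e < 1 -> 0 < e < 1 by [].
have n0 (e : R) : 0 < e < 1 -> `|e - 0| <= e by move=> /andP[e0 _]; rewrite subr0 gtr0_norm.
have r1 (e : R) : 0 < e < 1 -> 0 < 1 - e < 1 by move=> /andP[e0 e1]; apply/andP; split; lra.
have n1 (e : R) : 0 < e < 1 -> `|1 - e - 1| <= e.
  by move=> /andP[e0 _]; rewrite addrAC subrr add0r normrN gtr0_norm.
have k0 : 0 <= (0 : R) <= 1 by rewrite lexx ler01.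
have k1 : 0 <= (1 : R) <= 1 by rewrite lexx ler01.
have [T0 HT0 lim0] := boundary_value_exists (@incl0_le R X) (@incl0_inj R X)
  gc ghd hf c_ge0 fc k0 r0 n0 lip0.
have [T1 HT1 lim1] := boundary_value_exists (@incl1_le R X) (@incl1_inj R X)
  gc ghd hf c_ge0 fc k1 r1 n1 lip1.
split.
- split; last by exists c => z zO; rewrite le_rnorm; exact: fc.
  move=> z zO; have [B hB] := hf z zO; have [r rp hr] := open_strip_open zO.
  by have [] := deriv_in_derivable (deriv_in_open rp hr hB).
- exists (fun phi => incl0 (T0 phi)); last by exists T0.
  split; first exact: L1_is_distribution (@incl0_le R X) _ HT0.
  by move=> phi tphi; apply/at_rightP; exact: lim0.
- exists (fun phi => incl1 (T1 phi)); last by exists T1.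
  split; first exact: L1_is_distribution (@incl1_le R X) _ HT1.
  by move=> phi tphi; apply/at_rightP; exact: lim1.
Qed.

End Inclusion.

Theorem mainTheorem2 (R : realType) (X : compatiblePair R) (theta : R)
    (theta_gt0 : 0 < theta) (theta_lt1 : theta < 1) :
  [set f theta%:C | f in Hinfty X] = calderon2 X theta.
Proof.
have tO : open_strip (theta%:C : R[i]) by apply/andP.
apply/seteqP; split=> [_ [f fH <-]|_ [g gB <-]].
  by have [g gB <-] := Hinfty_calderon2 fH tO; exists g.
by exists (fun z => derive1 g z) => //; exact: Bspace_derivative.
Qed.
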